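(* Let $L/K$ be a finite Galois extension, let $G$ be a finite group, and let $\omega\in Z^3(G,L^\times)$ be a normalized $3$-cocycle. Then $\operatorname{Vec}_{G,L}^{\omega}$ has a split $K$-form if and only if $$[\omega]\in\operatorname{im}\bigl(H^3(G,K^\times)\longrightarrow H^3(G,L^\times)\bigr).$$
   Context: $G$ acts trivially on $K^\times$ and $L^\times$. $\operatorname{Vec}_{G,L}^\omega$ is the fusion category of finite-dimensional $G$-graded $L$-vector spaces with associator determined by $\omega$. A fusion category over a field $F$ is an $F$-linear semisimple abelian category with finite-dimensional morphism spaces and finitely many isomorphism classes of simple objects, with a rigid monoidal structure such that $\operatorname{End}(\mathbf 1)=F$; it is split if $\operatorname{End}(X)=F$ for every simple $X$. A $K$-form of a split fusion category $\mathcal C$ over $L$ is a fusion category $\mathcal C_K$ over $K$ with an $L$-linear tensor equivalence $\mathcal C_K\otimes_KL\simeq\mathcal C$ (scalar extension including idempotent completion); it is split if $\mathcal C_K$ is split. *)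

(* Defs.v *)
From HB Require Import structures.
From mathcomp Require Import all_boot all_order all_fingroup all_algebra all_field.
From mathcomp Require Import boolp ring.

Set Implicit Arguments.
Unset Strict Implicit.
Unset Printing Implicit Defensive.

Import GRing.Theory.
Local Open Scope ring_scope.

Section Cohomology.
Variables (gT : finGroupType) (F : fieldType).
Implicit Types (w : gT -> gT -> gT -> F) (m : gT -> gT -> F).

(* Cochains with values in F^* are F-valued functions that never vanish; the
   action of the group on F^* is trivial. *)
Definition cocycle3 w : Prop :=
  (forall g h k, w g h k != 0) /\
  (forall g h k l,
     w h k l * w g (h * k)%g l * w g h k = w (g * h)%g k l * w g h (k * l)%g).

Definition normalized3 w : Prop :=
  forall g h, [/\ w 1%g g h = 1, w g 1%g h = 1 & w g h 1%g = 1].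

Definition coboundary m (g h k : gT) : F :=
  m h k * m g (h * k)%g / (m (g * h)%g k * m g h).

Definition cohomologous w w' : Prop :=
  exists2 m : gT -> gT -> F, forall g h, m g h != 0 &
    forall g h k, w' g h k = w g h k * coboundary m g h k.

Lemma cohomologous_refl w : cohomologous w w.
Proof.
exists (fun _ _ => 1) => [g h|g h k]; first exact: oner_neq0.
by rewrite /coboundary !mulr1 divr1 mulr1.
Qed.

Lemma cohomologous_sym w w' : cohomologous w w' -> cohomologous w' w.
Proof.
move=> [m m0 wm]; exists (fun g h => (m g h)^-1) => [g h|g h k].
  by rewrite invr_eq0.
by rewrite wm /coboundary; field; rewrite !m0 oner_neq0.
Qed.

Lemma cohomologous_trans w w' w'' :
  cohomologous w w' -> cohomologous w' w'' -> cohomologous w w''.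
Proof.
move=> [m m0 wm] [n n0 wn]; exists (fun g h => m g h * n g h) => [g h|g h k].
  by rewrite mulf_neq0.
by rewrite wn wm /coboundary; field; rewrite !m0 !n0.
Qed.

Record Z3 := MkZ3 {
  Z3fun :> gT -> gT -> gT -> F;
  Z3P : cocycle3 Z3fun }.

(* The quotient Z^3 / B^3, as the set of cohomology classes. *)
Record H3 := MkH3 {
  H3mem :> Z3 -> Prop;
  H3P : exists w : Z3, H3mem = (fun w' : Z3 => cohomologous w w') }.

Definition H3class (w : Z3) : H3 :=
  @MkH3 (fun w' : Z3 => cohomologous w w') (ex_intro _ w erefl).

Lemma H3_inj (x y : H3) : (H3mem x = H3mem y) -> x = y.
Proof.
case: x y => [x xP] [y yP] /= exy; move: yP; rewrite -exy => yP.
by congr MkH3; apply: Prop_irrelevance.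
Qed.

Lemma H3class_eq (w w' : Z3) : H3class w = H3class w' <-> cohomologous w w'.
Proof.
split=> [e|ww'].
  have: H3mem (H3class w') w' by exact: cohomologous_refl.
  by rewrite -e.
apply/H3_inj/predeqP => u /=; split; apply: cohomologous_trans => //.
exact: cohomologous_sym.
Qed.

End Cohomology.

Section CoefficientChange.
Variables (gT : finGroupType) (F E : fieldType) (f : {rmorphism F -> E}).

Lemma map_cocycle3 (w : gT -> gT -> gT -> F) :
  cocycle3 w -> cocycle3 (fun g h k => f (w g h k)).
Proof.
move=> [w0 wP]; split=> [g h k|g h k l]; first by rewrite fmorph_eq0.
by rewrite -!rmorphM wP.
Qed.

Definition Z3map (w : Z3 gT F) : Z3 gT E := MkZ3 (map_cocycle3 (Z3P w)).

Lemma cohomologous_map (w w' : Z3 gT F) :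
  cohomologous w w' -> cohomologous (Z3map w) (Z3map w').
Proof.
move=> [m m0 wm]; exists (fun g h => f (m g h)) => [g h|g h k] /=.
  by rewrite fmorph_eq0.
by rewrite wm /coboundary !(rmorphM, fmorphV).
Qed.

Lemma H3map_subproof (x : H3 gT F) : exists w : Z3 gT E,
  (fun w' : Z3 gT E => exists2 v, x v & cohomologous (Z3map v) w') =
  (fun w' : Z3 gT E => cohomologous w w').
Proof.
have [w ->] := H3P x; exists (Z3map w); apply/predeqP => u /=; split.
  by move=> [v /cohomologous_map wv]; apply: cohomologous_trans.
by move=> wu; exists w => //; apply: cohomologous_refl.
Qed.

Definition H3map (x : H3 gT F) : H3 gT E := MkH3 (H3map_subproof x).

Lemma H3mapE (w : Z3 gT F) : H3map (H3class w) = H3class (Z3map w).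
Proof.
apply/H3_inj/predeqP => u /=; split.
  by move=> [v /cohomologous_map wv]; apply: cohomologous_trans.
by move=> wu; exists w => //; apply: cohomologous_refl.
Qed.

End CoefficientChange.

Record lincat (F : fieldType) := LinCat {
  obj :> Type;
  mor : obj -> obj -> vectType F;
  idm : forall X, mor X X;
  comp : forall X Y Z, mor Y Z -> mor X Y -> mor X Z;
  comp1m : forall X Y (f : mor X Y), comp (idm Y) f = f;
  compm1 : forall X Y (f : mor X Y), comp f (idm X) = f;
  compA : forall X Y Z W (h : mor Z W) (g : mor Y Z) (f : mor X Y),
    comp h (comp g f) = comp (comp h g) f;
  comp_linl : forall X Y Z (f : mor X Y),
    linear (fun g : mor Y Z => comp g f);
  comp_linr : forall X Y Z (g : mor Y Z),
    linear (fun f : mor X Y => comp g f) }.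

Arguments mor {F C} X Y : rename.
Arguments idm {F C} X : rename.
Arguments comp {F C X Y Z} g f : rename.

Declare Scope cat_scope.
Delimit Scope cat_scope with CAT.
Local Open Scope cat_scope.

Notation "g \oc f" := (comp g f) (at level 50, left associativity) : cat_scope.

Definition inverse_mor (F : fieldType) (C : lincat F) (X Y : C)
    (f : mor X Y) (g : mor Y X) : Prop :=
  g \oc f = idm X /\ f \oc g = idm Y.

Definition is_iso (F : fieldType) (C : lincat F) (X Y : C) (f : mor X Y) :
    Prop :=
  exists g, inverse_mor f g.

Definition isomorphic (F : fieldType) (C : lincat F) (X Y : C) : Prop :=
  exists f : mor X Y, is_iso f.

Record moncat (F : fieldType) := MonCat {
  mon_cat :> lincat F;
  tens : mon_cat -> mon_cat -> mon_cat;
  tensm : forall X X' Y Y' : mon_cat,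
    mor X X' -> mor Y Y' -> mor (tens X Y) (tens X' Y');
  one : mon_cat;
  assoc : forall X Y Z : mon_cat,
    mor (tens (tens X Y) Z) (tens X (tens Y Z));
  lunit : forall X : mon_cat, mor (tens one X) X;
  runit : forall X : mon_cat, mor (tens X one) X;
  tensm1 : forall X Y : mon_cat, tensm (idm X) (idm Y) = idm (tens X Y);
  tensm_comp : forall (X X' X'' Y Y' Y'' : mon_cat)
      (f' : mor X' X'') (f : mor X X') (g' : mor Y' Y'') (g : mor Y Y'),
    tensm (f' \oc f) (g' \oc g) = tensm f' g' \oc tensm f g;
  tensm_linl : forall (X X' Y Y' : mon_cat) (g : mor Y Y'),
    linear (fun f : mor X X' => tensm f g);
  tensm_linr : forall (X X' Y Y' : mon_cat) (f : mor X X'),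
    linear (fun g : mor Y Y' => tensm f g);
  assoc_iso : forall X Y Z : mon_cat, is_iso (assoc X Y Z);
  lunit_iso : forall X : mon_cat, is_iso (lunit X);
  runit_iso : forall X : mon_cat, is_iso (runit X);
  assoc_nat : forall (X X' Y Y' Z Z' : mon_cat)
      (f : mor X X') (g : mor Y Y') (h : mor Z Z'),
    assoc X' Y' Z' \oc tensm (tensm f g) h =
    tensm f (tensm g h) \oc assoc X Y Z;
  lunit_nat : forall (X Y : mon_cat) (f : mor X Y),
    lunit Y \oc tensm (idm one) f = f \oc lunit X;
  runit_nat : forall (X Y : mon_cat) (f : mor X Y),
    runit Y \oc tensm f (idm one) = f \oc runit X;
  pentagon : forall X Y Z W : mon_cat,
    tensm (idm X) (assoc Y Z W) \oc assoc X (tens Y Z) W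
      \oc tensm (assoc X Y Z) (idm W) =
    assoc X Y (tens Z W) \oc assoc (tens X Y) Z W;
  triangle : forall X Y : mon_cat,
    tensm (idm X) (lunit Y) \oc assoc X one Y = tensm (runit X) (idm Y) }.

Arguments tens {F C} X Y : rename.
Arguments tensm {F C X X' Y Y'} f g : rename.
Arguments one {F} C : rename.
Arguments assoc {F C} X Y Z : rename.
Arguments lunit {F C} X : rename.
Arguments runit {F C} X : rename.

Notation "X \ox Y" := (tens X Y) (at level 40, left associativity) : cat_scope.
Notation "f \om g" := (tensm f g) (at level 40, left associativity) : cat_scope.

Section AbelianCategories.
Variables (F : fieldType) (C : lincat F).
Implicit Types X Y Z : C.

Definition zero_obj Z : Prop :=
  forall X, (forall f : mor X Z, f = 0) /\ (forall f : mor Z X, f = 0).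

Definition mono X Y (f : mor X Y) : Prop :=
  forall Z (g h : mor Z X), f \oc g = f \oc h -> g = h.

Definition epi X Y (f : mor X Y) : Prop :=
  forall Z (g h : mor Y Z), g \oc f = h \oc f -> g = h.

Definition is_kernel X Y Z (k : mor Z X) (f : mor X Y) : Prop :=
  f \oc k = 0 /\
  forall W (g : mor W X), f \oc g = 0 -> exists! u : mor W Z, k \oc u = g.

Definition is_cokernel X Y Z (c : mor Y Z) (f : mor X Y) : Prop :=
  c \oc f = 0 /\
  forall W (g : mor Y W), g \oc f = 0 -> exists! u : mor Z W, u \oc c = g.

Definition is_direct_sum n (S : 'I_n -> C) X
    (i : forall a, mor (S a) X) (p : forall a, mor X (S a)) : Prop :=
  [/\ forall a, p a \oc i a = idm (S a),
      forall a b, a != b -> p b \oc i a = 0 &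
      \sum_a (i a \oc p a) = idm X].

Definition direct_sum n (S : 'I_n -> C) X : Prop :=
  exists i p, @is_direct_sum n S X i p.

Definition abelian_cat : Prop :=
  [/\ exists Z, zero_obj Z,
      forall X Y, exists Z, direct_sum (fun a : 'I_2 => if a == 0 then X else Y) Z,
      forall X Y (f : mor X Y), (exists Z (k : mor Z X), is_kernel k f) /\
                                (exists Z (c : mor Y Z), is_cokernel c f),
      forall X Y (f : mor X Y), mono f -> exists Z (g : mor Y Z), is_kernel f g &
      forall X Y (f : mor X Y), epi f -> exists Z (g : mor Z X), is_cokernel f g].

Definition simple_obj X : Prop :=
  ~ zero_obj X /\
  forall Y (f : mor Y X), mono f -> zero_obj Y \/ is_iso f.

Definition semisimple : Prop :=
  forall X, exists n (S : 'I_n -> C),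
    (forall a, simple_obj (S a)) /\ direct_sum S X.

Definition finitely_many_simples : Prop :=
  exists n (S : 'I_n -> C), forall X, simple_obj X ->
    exists a, isomorphic X (S a).

(* End(X) = F: every endomorphism is a unique scalar multiple of the identity *)
Definition scalar_end X : Prop :=
  forall f : mor X X, exists! a : F, f = a *: idm X.

End AbelianCategories.

Section Rigidity.
Variables (F : fieldType) (C : moncat F).

(* Y is a left dual of X. In the second zig-zag identity, b is the inverse of
   the associator. *)
Definition dual_pair (Y X : C)
    (ev : mor (Y \ox X) (one C)) (coev : mor (one C) (X \ox Y)) : Prop :=
  runit X \oc (idm X \om ev) \oc assoc X Y X \oc (coev \om idm X) = lunit X /\
  exists2 b, inverse_mor (assoc Y X Y) b &
    lunit Y \oc (ev \om idm Y) \oc b \oc (idm Y \om coev) = runit Y.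

Definition rigid : Prop :=
  forall X : C, (exists Y ev coev, @dual_pair Y X ev coev) /\
                (exists Y ev coev, @dual_pair X Y ev coev).

Definition is_fusion : Prop :=
  [/\ abelian_cat C /\ semisimple C, finitely_many_simples C, rigid &
      scalar_end (one C)].

Definition split_fusion : Prop :=
  is_fusion /\ forall X : C, simple_obj X -> scalar_end X.

End Rigidity.

Record linfunctor (F : fieldType) (C D : lincat F) := LinFunctor {
  fobj :> C -> D;
  fmor : forall X Y, mor X Y -> mor (fobj X) (fobj Y);
  fmor1 : forall X, fmor (idm X) = idm (fobj X);
  fmor_comp : forall X Y Z (g : mor Y Z) (f : mor X Y),
    fmor (g \oc f) = fmor g \oc fmor f;
  fmor_lin : forall X Y, linear (@fmor X Y) }.

Arguments fmor {F C D} f {X Y} : rename.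

Definition quasi_inverse (F : fieldType) (C D : lincat F)
    (T : linfunctor C D) (S : linfunctor D C) : Prop :=
  (exists eta : forall X : C, mor X (S (T X)),
     (forall X, is_iso (eta X)) /\
     forall X Y (f : mor X Y), eta Y \oc f = fmor S (fmor T f) \oc eta X) /\
  (exists eps : forall X : D, mor (T (S X)) X,
     (forall X, is_iso (eps X)) /\
     forall X Y (f : mor X Y), eps Y \oc fmor T (fmor S f) = f \oc eps X).

Definition is_equivalence (F : fieldType) (C D : lincat F)
    (T : linfunctor C D) : Prop :=
  exists S : linfunctor D C, quasi_inverse T S.

Record tensfunctor (F : fieldType) (C D : moncat F) := TensFunctor {
  tens_functor :> linfunctor C D;
  ften : forall X Y : C,
    mor (tens_functor X \ox tens_functor Y) (tens_functor (X \ox Y));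
  fone : mor (one D) (tens_functor (one C));
  ften_iso : forall X Y, is_iso (ften X Y);
  fone_iso : is_iso fone;
  ften_nat : forall (X X' Y Y' : C) (f : mor X X') (g : mor Y Y'),
    ften X' Y' \oc (fmor tens_functor f \om fmor tens_functor g) =
    fmor tens_functor (f \om g) \oc ften X Y;
  ften_assoc : forall X Y Z : C,
    fmor tens_functor (assoc X Y Z) \oc ften (X \ox Y) Z
      \oc (ften X Y \om idm (tens_functor Z)) =
    ften X (Y \ox Z) \oc (idm (tens_functor X) \om ften Y Z)
      \oc assoc (tens_functor X) (tens_functor Y) (tens_functor Z);
  ften_lunit : forall X : C,
    fmor tens_functor (lunit X) \oc ften (one C) X
      \oc (fone \om idm (tens_functor X)) = lunit (tens_functor X);
  ften_runit : forall X : C,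
    fmor tens_functor (runit X) \oc ften X (one C)
      \oc (idm (tens_functor X) \om fone) = runit (tens_functor X) }.

Definition tens_equivalent (F : fieldType) (C D : moncat F) : Prop :=
  exists T : tensfunctor C D, is_equivalence T.
Definition bilin (F : fieldType) (U V W : lmodType F) (m : U -> V -> W) : Prop :=
  (forall v, linear (m^~ v)) /\ (forall u, linear (m u)).

Section LinearFacts.
Variables (F : fieldType) (U V : lmodType F) (f : U -> V).
Hypothesis fL : linear f.

Definition to_linear : {linear U -> V} :=
  HB.pack f (GRing.isLinear.Build F U V *:%R f fL).

Lemma lin_sum I (r : seq I) (P : pred I) (E : I -> U) :
  f (\sum_(i <- r | P i) E i) = \sum_(i <- r | P i) f (E i).
Proof. exact: (linear_sum to_linear). Qed.

Lemma linZ a u : f (a *: u) = a *: f u.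
Proof. exact: (linearZ_LR to_linear). Qed.

Lemma linD u v : f (u + v) = f u + f v.
Proof. exact: (linearD to_linear). Qed.

Lemma lin0 : f 0 = 0.
Proof. exact: (linear0 to_linear). Qed.

End LinearFacts.

Local Notation vb V i := ((vbasis (@fullv _ V))`_i).
Local Notation vcoord i v := (coord (vbasis fullv) i v).

Lemma vcoordK (F : fieldType) (V : vectType F) (v : V) :
  v = \sum_i vcoord i v *: vb V i.
Proof. exact: coord_vbasis (memvf v). Qed.

Section ScalarExtension.
Variables (K : fieldType) (L : fieldExtType K).

(* V (x)_K L in coordinates: vbasis fullv, a K-basis of V, becomes an L-basis,
   and ext_in v is v (x) 1. *)
Definition ext (V : vectType K) : vectType L := 'rV[L]_(\dim (@fullv _ V)).

Definition ext_in (V : vectType K) (v : V) : ext V := \row_i (vcoord i v)%:A.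

Definition ext_bil (U V W : vectType K) (m : U -> V -> W)
    (x : ext U) (y : ext V) : ext W :=
  \sum_i \sum_j (x 0 i * y 0 j) *: ext_in (m (vb U i) (vb V j)).

Lemma ext_in_is_lin (V : vectType K) a (u v : V) :
  ext_in (a *: u + v) = a%:A *: ext_in u + ext_in v.
Proof.
apply/rowP=> i; rewrite !mxE linearP /=.
change (in_alg L (a * vcoord i u + vcoord i v) =
  in_alg L a * in_alg L (vcoord i u) + in_alg L (vcoord i v)).
by rewrite rmorphD rmorphM.
Qed.

Lemma ext_in0 (V : vectType K) : ext_in (0 : V) = 0.
Proof. by apply/rowP=> i; rewrite !mxE linear0 scale0r. Qed.

Lemma ext_inD (V : vectType K) (u v : V) : ext_in (u + v) = ext_in u + ext_in v.
Proof. by have := ext_in_is_lin 1 u v; rewrite !scale1r. Qed.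

Lemma ext_inZ (V : vectType K) a (u : V) : ext_in (a *: u) = a%:A *: ext_in u.
Proof. by have := ext_in_is_lin a u 0; rewrite ext_in0 !addr0. Qed.

Lemma ext_in_sum (V : vectType K) I (r : seq I) (P : pred I) (E : I -> V) :
  ext_in (\sum_(i <- r | P i) E i) = \sum_(i <- r | P i) ext_in (E i).
Proof. exact: (big_morph _ (@ext_inD V) (ext_in0 V)). Qed.

Lemma ext_in_basis (V : vectType K) (i : 'I_(\dim (@fullv _ V))) :
  ext_in (vb V i) = delta_mx 0 i.
Proof.
apply/rowP=> j; rewrite !mxE eqxx /= coord_free ?(basis_free (vbasisP _)) //.
rewrite [j == i]eq_sym; case: eqP => _ /=; rewrite ?scale1r ?scale0r //.
Qed.

Lemma ext_decomp (V : vectType K) (x : ext V) :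
  x = \sum_i x 0 i *: ext_in (vb V i).
Proof.
by rewrite {1}[x]row_sum_delta; apply: eq_bigr => i _; rewrite ext_in_basis.
Qed.

Lemma ext_ind (V : vectType K) (P : ext V -> Prop) :
  (forall v, P (ext_in v)) ->
  (forall a x y, P x -> P y -> P (a *: x + y)) ->
  forall x, P x.
Proof.
move=> Pin Plin x; rewrite [x]ext_decomp.
have P0 : P 0 by rewrite -(ext_in0 V).
elim/big_ind: _ => // [u v Pu Pv|i _]; first by rewrite -[u]scale1r; apply: Plin.
by rewrite -[_ *: _]addr0; apply: Plin.
Qed.

Section Bilinear.
Variables (U V W : vectType K) (m : U -> V -> W).

Lemma ext_bil_linl (y : ext V) : linear (fun x : ext U => ext_bil m x y).
Proof.
move=> a x x'; rewrite /ext_bil scaler_sumr -big_split; apply: eq_bigr => i _.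
rewrite scaler_sumr -big_split; apply: eq_bigr => j _ /=.
by rewrite !mxE mulrDl scalerDl scalerA mulrA.
Qed.

Lemma ext_bil_linr (x : ext U) : linear (fun y : ext V => ext_bil m x y).
Proof.
move=> a y y'; rewrite /ext_bil scaler_sumr -big_split; apply: eq_bigr => i _.
rewrite scaler_sumr -big_split; apply: eq_bigr => j _ /=.
by rewrite !mxE mulrDr scalerDl scalerA mulrCA.
Qed.

Hypotheses (ml : forall v, linear (m^~ v)) (mr : forall u, linear (m u)).

Lemma ext_bilE u v : ext_bil m (ext_in u) (ext_in v) = ext_in (m u v).
Proof.
rewrite {2}[u]vcoordK {2}[v]vcoordK (lin_sum (ml _)) ext_in_sum.
apply: eq_bigr => i _; rewrite (linZ (ml _)) (lin_sum (mr _)) ext_inZ ext_in_sum.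
rewrite scaler_sumr; apply: eq_bigr => j _.
by rewrite (linZ (mr _)) ext_inZ scalerA !mxE.
Qed.

End Bilinear.

End ScalarExtension.

Arguments ext {K} L V.
Arguments ext_in {K} L {V} v.

Section ExtendCategory.
Variables (K : fieldType) (L : fieldExtType K).

Section Linear.
Variable C : lincat K.

Definition ext_comp (X Y Z : C) :
    ext L (mor Y Z) -> ext L (mor X Y) -> ext L (mor X Z) :=
  ext_bil (@comp K C X Y Z).

Lemma ext_compE (X Y Z : C) (g : mor Y Z) (f : mor X Y) :
  ext_comp (ext_in L g) (ext_in L f) = ext_in L (g \oc f).
Proof. by apply: ext_bilE; [apply: comp_linl | apply: comp_linr]. Qed.

Lemma ext_comp_linl (X Y Z : C) (f : ext L (mor X Y)) :
  linear (fun g : ext L (mor Y Z) => ext_comp g f).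
Proof. exact: ext_bil_linl. Qed.

Lemma ext_comp_linr (X Y Z : C) (g : ext L (mor Y Z)) :
  linear (fun f : ext L (mor X Y) => ext_comp g f).
Proof. exact: ext_bil_linr. Qed.

Lemma ext_comp1m (X Y : C) (f : ext L (mor X Y)) :
  ext_comp (ext_in L (idm Y)) f = f.
Proof.
elim/ext_ind: f => [f|a f g IHf IHg]; first by rewrite ext_compE comp1m.
by rewrite ext_comp_linr IHf IHg.
Qed.

Lemma ext_compm1 (X Y : C) (f : ext L (mor X Y)) :
  ext_comp f (ext_in L (idm X)) = f.
Proof.
elim/ext_ind: f => [f|a f g IHf IHg]; first by rewrite ext_compE compm1.
by rewrite ext_comp_linl IHf IHg.
Qed.

Lemma ext_compA (X Y Z W : C) (h : ext L (mor Z W)) (g : ext L (mor Y Z))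
    (f : ext L (mor X Y)) :
  ext_comp h (ext_comp g f) = ext_comp (ext_comp h g) f.
Proof.
elim/ext_ind: h => [h|a h h' IH IH']; last by rewrite !ext_comp_linl IH IH'.
elim/ext_ind: g => [g|a g g' IH IH'].
  elim/ext_ind: f => [f|a f f' IH IH']; first by rewrite !ext_compE compA.
  by rewrite !ext_comp_linr IH IH'.
by rewrite ext_comp_linl !ext_comp_linr ext_comp_linl IH IH'.
Qed.

Definition ext_lincat : lincat L :=
  @LinCat L C (fun X Y => ext L (mor X Y)) (fun X => ext_in L (idm X))
    ext_comp ext_comp1m ext_compm1 ext_compA ext_comp_linl ext_comp_linr.

End Linear.

Variable C : moncat K.
Let E := ext_lincat C.

Definition ext_tensm (X X' Y Y' : C) :
    ext L (mor X X') -> ext L (mor Y Y') -> ext L (mor (X \ox Y) (X' \ox Y')) :=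
  ext_bil (@tensm K C X X' Y Y').

Lemma ext_tensmE (X X' Y Y' : C) (f : mor X X') (g : mor Y Y') :
  ext_tensm (ext_in L f) (ext_in L g) = ext_in L (f \om g).
Proof. by apply: ext_bilE; [apply: tensm_linl | apply: tensm_linr]. Qed.

Lemma ext_tensm_linl (X X' Y Y' : C) (g : ext L (mor Y Y')) :
  linear (fun f : ext L (mor X X') => ext_tensm f g).
Proof. exact: ext_bil_linl. Qed.

Lemma ext_tensm_linr (X X' Y Y' : C) (f : ext L (mor X X')) :
  linear (fun g : ext L (mor Y Y') => ext_tensm f g).
Proof. exact: ext_bil_linr. Qed.

Lemma ext_tensm1 (X Y : C) :
  ext_tensm (ext_in L (idm X)) (ext_in L (idm Y)) = ext_in L (idm (X \ox Y)).
Proof. by rewrite ext_tensmE tensm1. Qed.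

Lemma ext_tensm_comp (X X' X'' Y Y' Y'' : C)
    (f' : ext L (mor X' X'')) (f : ext L (mor X X'))
    (g' : ext L (mor Y' Y'')) (g : ext L (mor Y Y')) :
  ext_tensm (ext_comp f' f) (ext_comp g' g) =
  ext_comp (ext_tensm f' g') (ext_tensm f g).
Proof.
elim/ext_ind: f' => [f'|a x y IH IH']; last first.
  by rewrite ext_comp_linl !ext_tensm_linl ext_comp_linl IH IH'.
elim/ext_ind: f => [f|a x y IH IH']; last first.
  by rewrite ext_comp_linr !ext_tensm_linl ext_comp_linr IH IH'.
elim/ext_ind: g' => [g'|a x y IH IH']; last first.
  by rewrite ext_comp_linl !ext_tensm_linr ext_comp_linl IH IH'.
elim/ext_ind: g => [g|a x y IH IH']; last first.
  by rewrite ext_comp_linr !ext_tensm_linr ext_comp_linr IH IH'.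
by rewrite !ext_compE !ext_tensmE ext_compE tensm_comp.
Qed.

Lemma ext_iso (X Y : C) (f : mor X Y) : is_iso f -> @is_iso L E X Y (ext_in L f).
Proof.
by move=> [g [gf fg]]; exists (ext_in L g); split; rewrite /= ext_compE ?gf ?fg.
Qed.

Lemma ext_assoc_nat (X X' Y Y' Z Z' : C) (f : ext L (mor X X'))
    (g : ext L (mor Y Y')) (h : ext L (mor Z Z')) :
  ext_comp (ext_in L (assoc X' Y' Z')) (ext_tensm (ext_tensm f g) h) =
  ext_comp (ext_tensm f (ext_tensm g h)) (ext_in L (assoc X Y Z)).
Proof.
elim/ext_ind: f => [f|a x y IH IH']; last first.
  by rewrite !ext_tensm_linl ext_comp_linr ext_comp_linl IH IH'.
elim/ext_ind: g => [g|a x y IH IH']; last first.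
  by rewrite ext_tensm_linr !ext_tensm_linl ext_tensm_linr ext_comp_linr
    ext_comp_linl IH IH'.
elim/ext_ind: h => [h|a x y IH IH']; last first.
  by rewrite !ext_tensm_linr ext_comp_linr ext_comp_linl IH IH'.
by rewrite !ext_tensmE !ext_compE assoc_nat.
Qed.

Lemma ext_lunit_nat (X Y : C) (f : ext L (mor X Y)) :
  ext_comp (ext_in L (lunit Y)) (ext_tensm (ext_in L (idm (one C))) f) =
  ext_comp f (ext_in L (lunit X)).
Proof.
elim/ext_ind: f => [f|a x y IH IH']; last first.
  by rewrite !ext_tensm_linr ext_comp_linr ext_comp_linl IH IH'.
by rewrite !ext_tensmE !ext_compE lunit_nat.
Qed.

Lemma ext_runit_nat (X Y : C) (f : ext L (mor X Y)) :
  ext_comp (ext_in L (runit Y)) (ext_tensm f (ext_in L (idm (one C)))) =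
  ext_comp f (ext_in L (runit X)).
Proof.
elim/ext_ind: f => [f|a x y IH IH']; last first.
  by rewrite !ext_tensm_linl ext_comp_linr ext_comp_linl IH IH'.
by rewrite !ext_tensmE !ext_compE runit_nat.
Qed.

Lemma ext_pentagon (X Y Z W : C) :
  ext_comp (ext_comp (ext_tensm (ext_in L (idm X)) (ext_in L (assoc Y Z W)))
      (ext_in L (assoc X (Y \ox Z) W)))
    (ext_tensm (ext_in L (assoc X Y Z)) (ext_in L (idm W))) =
  ext_comp (ext_in L (assoc X Y (Z \ox W))) (ext_in L (assoc (X \ox Y) Z W)).
Proof. by rewrite !ext_tensmE !ext_compE pentagon. Qed.

Lemma ext_triangle (X Y : C) :
  ext_comp (ext_tensm (ext_in L (idm X)) (ext_in L (lunit Y)))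
    (ext_in L (assoc X (one C) Y)) =
  ext_tensm (ext_in L (runit X)) (ext_in L (idm Y)).
Proof. by rewrite !ext_tensmE !ext_compE triangle. Qed.

(* Same objects as C, morphism spaces tensored with L; the idempotent completion
   is taken separately. *)
Definition ext_cat : moncat L :=
  @MonCat L E (@tens K C) ext_tensm (one C)
    (fun X Y Z => ext_in L (assoc X Y Z))
    (fun X => ext_in L (lunit X)) (fun X => ext_in L (runit X))
    ext_tensm1 ext_tensm_comp ext_tensm_linl ext_tensm_linr
    (fun X Y Z => ext_iso (assoc_iso X Y Z))
    (fun X => ext_iso (lunit_iso X)) (fun X => ext_iso (runit_iso X))
    ext_assoc_nat ext_lunit_nat ext_runit_nat ext_pentagon ext_triangle.

End ExtendCategory.

Arguments ext_cat {K} L C.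
Section Karoubi.
Variable F : fieldType.

Section Linear.
Variable C : lincat F.

Record kar_obj := KarObj {
  kar_src : C;
  kar_idem : mor kar_src kar_src;
  kar_idemP : kar_idem \oc kar_idem = kar_idem }.
Implicit Types X Y Z : kar_obj.

(* Morphisms (X, e) -> (Y, e') are the f : X -> Y with e' f e = f. *)
Lemma kar_sandwich_lin X Y :
  linear (fun f : mor (kar_src X) (kar_src Y) => kar_idem Y \oc f \oc kar_idem X).
Proof. by move=> a f g; rewrite comp_linr comp_linl. Qed.

Definition kar_sub X Y : {vspace (mor (kar_src X) (kar_src Y))} :=
  fixedSpace (linfun (to_linear (@kar_sandwich_lin X Y))).

Lemma kar_subP X Y (f : mor (kar_src X) (kar_src Y)) :
  reflect (kar_idem Y \oc f \oc kar_idem X = f) (f \in kar_sub X Y).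
Proof. by apply: (iffP fixedSpaceP); rewrite lfunE. Qed.

Definition kar_mor X Y : vectType F := subvs_of (kar_sub X Y).

Lemma kar_subI X Y (f : mor (kar_src X) (kar_src Y)) :
  kar_idem Y \oc f = f -> f \oc kar_idem X = f -> f \in kar_sub X Y.
Proof. by move=> ef fe; apply/kar_subP; rewrite ef fe. Qed.

Lemma kar_morl X Y (f : kar_mor X Y) : kar_idem Y \oc vsval f = vsval f.
Proof.
by have /kar_subP fE := valP f; rewrite -[in LHS]fE !compA kar_idemP fE.
Qed.

Lemma kar_morr X Y (f : kar_mor X Y) : vsval f \oc kar_idem X = vsval f.
Proof.
by have /kar_subP fE := valP f; rewrite -[in LHS]fE -!compA kar_idemP compA fE.
Qed.

Lemma kar_idm_sub X : kar_idem X \in kar_sub X X.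
Proof. by apply: kar_subI; exact: kar_idemP. Qed.

Definition kar_idm X : kar_mor X X := Subvs (kar_idm_sub X).

Lemma kar_comp_sub X Y Z (g : kar_mor Y Z) (f : kar_mor X Y) :
  vsval g \oc vsval f \in kar_sub X Z.
Proof. by apply: kar_subI; rewrite ?compA ?kar_morl // -compA kar_morr. Qed.

Definition kar_comp X Y Z (g : kar_mor Y Z) (f : kar_mor X Y) : kar_mor X Z :=
  Subvs (kar_comp_sub g f).

Lemma kar_comp1m X Y (f : kar_mor X Y) : kar_comp (kar_idm Y) f = f.
Proof. by apply: val_inj; exact: kar_morl. Qed.

Lemma kar_compm1 X Y (f : kar_mor X Y) : kar_comp f (kar_idm X) = f.
Proof. by apply: val_inj; exact: kar_morr. Qed.

Lemma kar_compA X Y Z W (h : kar_mor Z W) (g : kar_mor Y Z) (f : kar_mor X Y) :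
  kar_comp h (kar_comp g f) = kar_comp (kar_comp h g) f.
Proof. by apply: val_inj; exact: compA. Qed.

Lemma kar_comp_linl X Y Z (f : kar_mor X Y) :
  linear (fun g : kar_mor Y Z => kar_comp g f).
Proof. by move=> a g g'; apply: val_inj; exact: comp_linl. Qed.

Lemma kar_comp_linr X Y Z (g : kar_mor Y Z) :
  linear (fun f : kar_mor X Y => kar_comp g f).
Proof. by move=> a f f'; apply: val_inj; exact: comp_linr. Qed.

Definition kar_lincat : lincat F :=
  LinCat kar_comp1m kar_compm1 kar_compA kar_comp_linl kar_comp_linr.

End Linear.

Variable C : moncat F.
Implicit Types X Y Z : kar_obj C.

Lemma kar_tens_idem X Y :
  (kar_idem X \om kar_idem Y) \oc (kar_idem X \om kar_idem Y) =
  kar_idem X \om kar_idem Y.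
Proof. by rewrite -tensm_comp !kar_idemP. Qed.

Definition kar_tens X Y : kar_obj C := KarObj (kar_tens_idem X Y).

Lemma kar_tensm_sub X X' Y Y' (f : kar_mor X X') (g : kar_mor Y Y') :
  vsval f \om vsval g \in kar_sub (kar_tens X Y) (kar_tens X' Y').
Proof. by apply: kar_subI; rewrite /= -tensm_comp ?kar_morl ?kar_morr. Qed.

Definition kar_tensm X X' Y Y' (f : kar_mor X X') (g : kar_mor Y Y') :
    kar_mor (kar_tens X Y) (kar_tens X' Y') :=
  Subvs (kar_tensm_sub f g).

Definition kar_one : kar_obj C := KarObj (comp1m (idm (one C))).

Lemma kar_nat_sub X Y (a : mor (kar_src X) (kar_src Y)) :
  a \oc kar_idem X = kar_idem Y \oc a -> kar_idem Y \oc a \in kar_sub X Y.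
Proof.
by move=> aE; apply: kar_subI; rewrite -?compA ?aE compA kar_idemP.
Qed.

Lemma kar_nat_iso X Y (a : mor (kar_src X) (kar_src Y))
    (aE : a \oc kar_idem X = kar_idem Y \oc a) :
  is_iso a -> @is_iso F (kar_lincat C) X Y (Subvs (kar_nat_sub aE)).
Proof.
move=> [b [ba ab]].
have bE : b \oc kar_idem Y = kar_idem X \oc b.
  rewrite -[LHS]compm1 -ab compA -(compA b) -aE.
  by rewrite -(compA b) -compA (compA b) ba comp1m.
exists (Subvs (kar_nat_sub bE)); split; apply: val_inj => /=.
  by rewrite -compA (compA b) bE -!compA ba compm1 kar_idemP.
by rewrite -compA (compA a) aE -!compA ab compm1 kar_idemP.
Qed.

Definition kar_assoc X Y Z :
    kar_mor (kar_tens (kar_tens X Y) Z) (kar_tens X (kar_tens Y Z)) :=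
  Subvs (@kar_nat_sub (kar_tens (kar_tens X Y) Z) (kar_tens X (kar_tens Y Z))
    _ (assoc_nat (kar_idem X) (kar_idem Y) (kar_idem Z))).

Definition kar_lunit X : kar_mor (kar_tens kar_one X) X :=
  Subvs (@kar_nat_sub (kar_tens kar_one X) X _ (lunit_nat (kar_idem X))).

Definition kar_runit X : kar_mor (kar_tens X kar_one) X :=
  Subvs (@kar_nat_sub (kar_tens X kar_one) X _ (runit_nat (kar_idem X))).

Lemma kar_tensm1 X Y :
  kar_tensm (kar_idm X) (kar_idm Y) = kar_idm (kar_tens X Y).
Proof. exact: val_inj. Qed.

Lemma kar_tensm_comp X X' X'' Y Y' Y''
    (f' : kar_mor X' X'') (f : kar_mor X X')
    (g' : kar_mor Y' Y'') (g : kar_mor Y Y') :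
  kar_tensm (kar_comp f' f) (kar_comp g' g) =
  kar_comp (kar_tensm f' g') (kar_tensm f g).
Proof. by apply: val_inj; exact: tensm_comp. Qed.

Lemma kar_tensm_linl X X' Y Y' (g : kar_mor Y Y') :
  linear (fun f : kar_mor X X' => kar_tensm f g).
Proof. by move=> a f f'; apply: val_inj; exact: tensm_linl. Qed.

Lemma kar_tensm_linr X X' Y Y' (f : kar_mor X X') :
  linear (fun g : kar_mor Y Y' => kar_tensm f g).
Proof. by move=> a g g'; apply: val_inj; exact: tensm_linr. Qed.

Lemma kar_assoc_nat X X' Y Y' Z Z' (f : kar_mor X X') (g : kar_mor Y Y')
    (h : kar_mor Z Z') :
  kar_comp (kar_assoc X' Y' Z') (kar_tensm (kar_tensm f g) h) =
  kar_comp (kar_tensm f (kar_tensm g h)) (kar_assoc X Y Z).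
Proof.
apply: val_inj => /=; rewrite -compA assoc_nat !compA -!tensm_comp.
by rewrite !kar_morl !kar_morr.
Qed.

Lemma kar_lunit_nat X Y (f : kar_mor X Y) :
  kar_comp (kar_lunit Y) (kar_tensm (kar_idm kar_one) f) =
  kar_comp f (kar_lunit X).
Proof.
by apply: val_inj => /=; rewrite -compA lunit_nat !compA kar_morl kar_morr.
Qed.

Lemma kar_runit_nat X Y (f : kar_mor X Y) :
  kar_comp (kar_runit Y) (kar_tensm f (kar_idm kar_one)) =
  kar_comp f (kar_runit X).
Proof.
by apply: val_inj => /=; rewrite -compA runit_nat !compA kar_morl kar_morr.
Qed.

Lemma kar_pentagon X Y Z W :
  kar_comp (kar_comp (kar_tensm (kar_idm X) (kar_assoc Y Z W))
      (kar_assoc X (kar_tens Y Z) W)) (kar_tensm (kar_assoc X Y Z) (kar_idm W)) =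
  kar_comp (kar_assoc X Y (kar_tens Z W)) (kar_assoc (kar_tens X Y) Z W).
Proof.

apply: val_inj => /=.
set x := kar_idem X; set y := kar_idem Y; set z := kar_idem Z; set w := kar_idem W.
have xyz_idem : x \om (y \om z) \oc (x \om (y \om z)) = x \om (y \om z).
  exact: (kar_idemP (kar_tens X (kar_tens Y Z))).
have ww : w \oc w = w := kar_idemP W.

set A1 := assoc (kar_src Y) (kar_src Z) (kar_src W).
set A2 := assoc (kar_src X) (kar_src Y \ox kar_src Z) (kar_src W).
set A3 := assoc (kar_src X) (kar_src Y) (kar_src Z).
have -> : x \om (y \om (z \om w) \oc A1) =
    x \om (y \om (z \om w)) \oc (idm (kar_src X) \om A1).
  by rewrite -tensm_comp compm1.
have E3 : (x \om (y \om z) \oc A3) \om w =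
    (x \om (y \om z)) \om w \oc (A3 \om idm (kar_src W)).
  by rewrite -tensm_comp compm1.
have E3' : (x \om (y \om z) \oc A3) \om w =
    (A3 \om idm (kar_src W)) \oc (((x \om y) \om z) \om w).
  by rewrite -tensm_comp comp1m assoc_nat.
rewrite -(assoc_nat x (y \om z) w) -/A2.

have -> : x \om (y \om (z \om w)) \oc (idm (kar_src X) \om A1)
      \oc (A2 \oc ((x \om (y \om z)) \om w)) \oc ((x \om (y \om z) \oc A3) \om w) =
    x \om (y \om (z \om w)) \oc ((idm (kar_src X) \om A1) \oc A2
      \oc (A3 \om idm (kar_src W))) \oc (((x \om y) \om z) \om w).
  by rewrite -!compA -E3' -tensm_comp ww (compA _ _ A3) xyz_idem.
rewrite pentagon -!compA; congr (_ \oc _).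
by rewrite assoc_nat.
Qed.

Lemma kar_triangle X Y :
  kar_comp (kar_tensm (kar_idm X) (kar_lunit Y)) (kar_assoc X kar_one Y) =
  kar_tensm (kar_runit X) (kar_idm Y).
Proof.
apply: val_inj => /=; set x := kar_idem X; set y := kar_idem Y.
have xx : x \oc x = x := kar_idemP X.
have yy : y \oc y = y := kar_idemP Y.
rewrite compA -tensm_comp xx -compA lunit_nat compA yy.
rewrite -[x in x \om _]compm1 tensm_comp -compA triangle -tensm_comp.
by rewrite compm1.
Qed.

Definition karoubi : moncat F :=
  @MonCat F (kar_lincat C) kar_tens kar_tensm kar_one
    kar_assoc kar_lunit kar_runit
    kar_tensm1 kar_tensm_comp kar_tensm_linl kar_tensm_linr
    (fun X Y Z => @kar_nat_iso (kar_tens (kar_tens X Y) Z)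
      (kar_tens X (kar_tens Y Z)) _ _ (assoc_iso (kar_src X) (kar_src Y) (kar_src Z)))
    (fun X => @kar_nat_iso (kar_tens kar_one X) X _ _ (lunit_iso (kar_src X)))
    (fun X => @kar_nat_iso (kar_tens X kar_one) X _ _ (runit_iso (kar_src X)))
    kar_assoc_nat kar_lunit_nat kar_runit_nat kar_pentagon kar_triangle.

End Karoubi.
Section TensorProduct.
Variable F : fieldType.
Implicit Types U V W T : vectType F.

Lemma lfunL V W (f : 'Hom(V, W)) : linear f.
Proof. by move=> a x y; rewrite linearP. Qed.

(* V (x) W in coordinates with respect to vbasis fullv on both sides; ten v w
   is the pure tensor. *)
Definition tsp V W : vectType F :=
  'M[F]_(\dim (@fullv _ V), \dim (@fullv _ W)).

Definition ten V W (v : V) (w : W) : tsp V W :=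
  \matrix_(i, j) (vcoord i v * vcoord j w).

Definition tlift_fun V W T (b : V -> W -> T) (t : tsp V W) : T :=
  \sum_i \sum_j t i j *: b (vb V i) (vb W j).

Lemma tlift_fun_lin V W T (b : V -> W -> T) : linear (tlift_fun b).
Proof.
move=> a x y; rewrite /tlift_fun scaler_sumr -big_split; apply: eq_bigr => i _.
rewrite scaler_sumr -big_split; apply: eq_bigr => j _ /=.
by rewrite !mxE scalerDl scalerA.
Qed.

Definition tlift V W T (b : V -> W -> T) : 'Hom(tsp V W, T) :=
  linfun (to_linear (tlift_fun_lin b)).

Lemma ten_linl V W (w : W) : linear (fun v : V => ten v w).
Proof. by move=> a u v; apply/matrixP=> i j; rewrite !mxE linearP /= mulrDl mulrA. Qed.

Lemma ten_linr V W (v : V) : linear (fun w : W => ten v w).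
Proof. by move=> a u w; apply/matrixP=> i j; rewrite !mxE linearP /= mulrDr mulrCA. Qed.

Lemma ten0l V W (w : W) : ten (0 : V) w = 0.
Proof. exact: (lin0 (@ten_linl V W w)). Qed.

Lemma ten0r V W (v : V) : ten v (0 : W) = 0.
Proof. exact: (lin0 (@ten_linr V W v)). Qed.

Lemma ten_basis V W (i : 'I_(\dim (@fullv _ V))) (j : 'I_(\dim (@fullv _ W))) : ten (vb V i) (vb W j) = delta_mx i j.
Proof.
apply/matrixP=> k l; rewrite !mxE !coord_free ?(basis_free (vbasisP _)) //.
by rewrite -natrM mulnb [i == k]eq_sym [j == l]eq_sym.
Qed.

Lemma ten_decomp V W (t : tsp V W) :
  t = \sum_i \sum_j t i j *: ten (vb V i) (vb W j).
Proof.
rewrite {1}[t]matrix_sum_delta; apply: eq_bigr => i _; apply: eq_bigr => j _.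
by rewrite ten_basis.
Qed.

Lemma ten_ind V W (P : tsp V W -> Prop) :
  (forall v w, P (ten v w)) ->
  (forall a x y, P x -> P y -> P (a *: x + y)) ->
  forall t, P t.
Proof.
move=> Pten Plin t; rewrite [t]ten_decomp.
have P0 : P 0 by rewrite -(ten0l V (0 : W)).
have PD x y : P x -> P y -> P (x + y) by rewrite -{2}[x]scale1r; apply: Plin.
elim/big_ind: _ => // i _; elim/big_ind: _ => // j _.
by rewrite -[_ *: _]addr0; apply: Plin.
Qed.

Lemma tliftE V W T (b : V -> W -> T) v w : bilin b -> tlift b (ten v w) = b v w.
Proof.
move=> [bl br]; rewrite lfunE /= /tlift_fun {2}[v]vcoordK {2}[w]vcoordK.
rewrite (lin_sum (bl _)); apply: eq_bigr => i _.
rewrite (linZ (bl _)) (lin_sum (br _)) scaler_sumr; apply: eq_bigr => j _.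
by rewrite (linZ (br _)) scalerA !mxE.
Qed.

Definition tmap V V' W W' (f : 'Hom(V, V')) (g : 'Hom(W, W')) :
    'Hom(tsp V W, tsp V' W') :=
  tlift (fun v w => ten (f v) (g w)).

Lemma tmapE V V' W W' (f : 'Hom(V, V')) (g : 'Hom(W, W')) v w :
  tmap f g (ten v w) = ten (f v) (g w).
Proof.
by apply: tliftE; split=> [y|x] a u u'; rewrite lfunL ?ten_linl ?ten_linr.
Qed.

Lemma thomP V W T (f g : 'Hom(tsp V W, T)) :
  (forall v w, f (ten v w) = g (ten v w)) -> f = g.
Proof.
move=> fg; apply/lfunP=> t; elim/ten_ind: t => [|a x y IH IH'] //.
by rewrite !lfunL IH IH'.
Qed.

Lemma tmap_linl V V' W W' (g : 'Hom(W, W')) :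
  linear (fun f : 'Hom(V, V') => tmap f g).
Proof.
move=> a f f'; apply: thomP => v w.
by rewrite !(tmapE, add_lfunE, scale_lfunE) ten_linl.
Qed.

Lemma tmap_linr V V' W W' (f : 'Hom(V, V')) :
  linear (fun g : 'Hom(W, W') => tmap f g).
Proof.
move=> a g g'; apply: thomP => v w.
by rewrite !(tmapE, add_lfunE, scale_lfunE) ten_linr.
Qed.

Lemma tmap1 V W : tmap \1%VF \1%VF = \1%VF :> 'End(tsp V W).
Proof. by apply: thomP => v w; rewrite tmapE !id_lfunE. Qed.

Lemma tmap_comp V V' V'' W W' W'' (f' : 'Hom(V', V'')) (f : 'Hom(V, V'))
    (g' : 'Hom(W', W'')) (g : 'Hom(W, W')) :
  tmap (f' \o f) (g' \o g) = (tmap f' g' \o tmap f g)%VF.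
Proof. by apply: thomP => v w; rewrite !(tmapE, comp_lfunE). Qed.

Definition tassoc U V W : 'Hom(tsp (tsp U V) W, tsp U (tsp V W)) :=
  tlift (fun t w => tlift (fun u v => ten u (ten v w)) t).

Lemma tassocE U V W (u : U) (v : V) (w : W) :
  tassoc U V W (ten (ten u v) w) = ten u (ten v w).
Proof.
have b2 z : bilin (fun (x : U) (y : V) => ten x (ten y z)).
  by split=> y a x x'; rewrite ?ten_linl ?ten_linr.
rewrite tliftE ?tliftE //; split=> [z a s t|t a z z']; first by rewrite lfunL.
elim/ten_ind: t => [x y|c s t IH IH']; first by rewrite !tliftE ?ten_linr ?ten_linr.
rewrite !lfunL IH IH' !scalerDr !scalerA [c * a]mulrC.
by rewrite addrACA.
Qed.

Definition tassocV U V W : 'Hom(tsp U (tsp V W), tsp (tsp U V) W) :=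
  tlift (fun u t => tlift (fun v w => ten (ten u v) w) t).

Lemma tassocVE U V W (u : U) (v : V) (w : W) :
  tassocV U V W (ten u (ten v w)) = ten (ten u v) w.
Proof.
have b2 z : bilin (fun (x : V) (y : W) => ten (ten z x) y).
  by split=> y a x x'; rewrite ?ten_linr ?ten_linl.
rewrite tliftE ?tliftE //; split=> [t a z z'|z a s t]; last by rewrite lfunL.
elim/ten_ind: t => [x y|c s t IH IH']; first by rewrite !tliftE ?ten_linl ?ten_linl.
rewrite !lfunL IH IH' !scalerDr !scalerA [c * a]mulrC.
by rewrite addrACA.
Qed.

Definition tlunit V : 'Hom(tsp F^o V, V) := tlift (fun (a : F^o) v => (a : F) *: v).

Lemma tlunitE V (a : F^o) (v : V) : tlunit V (ten a v) = (a : F) *: v.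
Proof.
apply: (@tliftE F^o V V (fun a v => (a : F) *: v)).
split=> [u c x y|x c u w]; first by rewrite scalerDl scalerA.
by rewrite scalerDr !scalerA mulrC.
Qed.

Definition trunit V : 'Hom(tsp V F^o, V) := tlift (fun v (a : F^o) => (a : F) *: v).

Lemma trunitE V (a : F^o) (v : V) : trunit V (ten v a) = (a : F) *: v.
Proof.
apply: (@tliftE V F^o V (fun v a => (a : F) *: v)).
split=> [x c u w|u c x y]; last by rewrite scalerDl scalerA.
by rewrite scalerDr !scalerA mulrC.
Qed.

Definition tsub V W (A : {vspace V}) (B : {vspace W}) : {vspace tsp V W} :=
  <<[seq ten a b | a <- vbasis A, b <- vbasis B]>>%VS.

Lemma memv_tsub V W (A : {vspace V}) (B : {vspace W}) a b :
  a \in A -> b \in B -> ten a b \in tsub A B.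
Proof.
move=> /coord_vbasis-> /coord_vbasis->; rewrite (lin_sum (@ten_linl _ _ _)).
apply: memv_suml => i _; rewrite (linZ (@ten_linl _ _ _)) (lin_sum (@ten_linr _ _ _)).
apply: memvZ; apply: memv_suml => j _; rewrite (linZ (@ten_linr _ _ _)).
by apply/memvZ/memv_span/allpairs_f; rewrite mem_nth ?size_tuple.
Qed.

Lemma tsub_ind V W (A : {vspace V}) (B : {vspace W}) (P : tsp V W -> Prop) :
  (forall a b, a \in A -> b \in B -> P (ten a b)) ->
  (forall a x y, P x -> P y -> P (a *: x + y)) ->
  forall t, t \in tsub A B -> P t.
Proof.
move=> Pten Plin t /(@coord_span _ _ _ (in_tuple _)) ->.
have P0 : P 0 by rewrite -(ten0l V (0 : W)); apply: Pten; rewrite mem0v.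
have PD x y : P x -> P y -> P (x + y) by rewrite -{2}[x]scale1r; apply: Plin.
elim/big_ind: _ => // i _; rewrite -[_ *: _]addr0; apply: Plin => //.
have /allpairsP[[a b] /= [Aa Bb ->]] :
    (in_tuple [seq ten a b | a <- vbasis A, b <- vbasis B])`_i
      \in [seq ten a b | a <- vbasis A, b <- vbasis B].
  by apply: mem_nth.
by apply: Pten; apply: vbasis_mem.
Qed.

End TensorProduct.
Section GradedSpaces.
Variables (gT : finGroupType) (F : fieldType).

Record gspace := GSpace {
  gcar : vectType F;
  gcomp : gT -> {vspace gcar};
  gdirect : directv (\sum_g gcomp g);
  gfull : fullv = (\sum_g gcomp g)%VS }.
Implicit Types U V W : gspace.

Definition gproj V (g : gT) : 'End(gcar V) := sumv_pi_for (gfull V) g.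

Lemma memv_gproj V g v : gproj V g v \in gcomp V g.
Proof. exact: memv_sum_pi. Qed.

Lemma gproj_sum V v : \sum_g gproj V g v = v.
Proof. by apply: sumv_pi_sum; rewrite memvf. Qed.

Lemma gproj_uniq V (u : gT -> gcar V) :
  (forall g, u g \in gcomp V g) -> forall g, gproj V g (\sum_g u g) = u g.
Proof.
move=> uP g; have /directv_sum_unique dV := gdirect V.
have := dV (fun h => gproj V h (\sum_g u g)) u.
rewrite gproj_sum eqxx => /(_ (fun h _ => memv_gproj _ _) (fun h _ => uP h)).
by move=> /esym/forall_inP/(_ g isT)/eqP.
Qed.

Lemma gproj_homog V g h v :
  v \in gcomp V h -> gproj V g v = if g == h then v else 0.
Proof.
move=> vP; pose u k := if k == h then v else 0.
have uP k : u k \in gcomp V k by rewrite /u; case: eqP => [->|]; rewrite ?mem0v.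
have uv : \sum_k u k = v.
  by rewrite (bigD1 h) //= /u eqxx big1 ?addr0 // => k /negPf->.
by rewrite -[in LHS]uv (gproj_uniq uP).
Qed.

(* Degree-preserving part of f; the morphisms of graded spaces are the f equal
   to it, i.e. those with f(V_g) contained in W_g (gsubP). *)
Definition gdiag_fun V W (f : 'Hom(gcar V, gcar W)) : 'Hom(gcar V, gcar W) :=
  \sum_g (gproj W g \o f \o gproj V g)%VF.

Lemma gdiag_lin V W : linear (@gdiag_fun V W).
Proof.
move=> a f f'; rewrite /gdiag_fun scaler_sumr -big_split; apply: eq_bigr => g _ /=.
by rewrite comp_lfunDr comp_lfunDl -comp_lfunZr -comp_lfunZl.
Qed.

Definition gsub V W : {vspace 'Hom(gcar V, gcar W)} :=
  fixedSpace (linfun (to_linear (@gdiag_lin V W))).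

Lemma gdiagE V W (f : 'Hom(gcar V, gcar W)) g v :
  v \in gcomp V g -> gdiag_fun f v = gproj W g (f v).
Proof.
move=> vP; rewrite /gdiag_fun sum_lfunE (bigD1 g) //= big1 => [|h /negPf hg].
  by rewrite addr0 !comp_lfunE (gproj_homog _ vP) eqxx.
by rewrite !comp_lfunE (gproj_homog _ vP) hg !linear0.
Qed.

Lemma gsubP V W (f : 'Hom(gcar V, gcar W)) :
  f \in gsub V W <-> (forall g v, v \in gcomp V g -> f v \in gcomp W g).
Proof.
split=> [/fixedSpaceP fE g v vP|fP].
  by rewrite -fE lfunE /= (gdiagE _ vP) memv_gproj.
apply/fixedSpaceP; rewrite lfunE; apply/lfunP=> v /=.
rewrite -(gproj_sum v) !linear_sum; apply: eq_bigr => g _ /=.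
have vP := memv_gproj g v; rewrite (gdiagE _ vP).
by rewrite (gproj_homog _ (fP _ _ vP)) eqxx.
Qed.

Definition gmor V W : vectType F := subvs_of (gsub V W).

Lemma gmor_comp V W (f : gmor V W) g v :
  v \in gcomp V g -> vsval f v \in gcomp W g.
Proof. by have /gsubP := valP f; apply. Qed.

Lemma gid_sub V : \1%VF \in gsub V V.
Proof. by apply/gsubP=> g v; rewrite id_lfunE. Qed.

Definition gid V : gmor V V := Subvs (gid_sub V).

Lemma gcomp_sub U V W (g : gmor V W) (f : gmor U V) :
  (vsval g \o vsval f)%VF \in gsub U W.
Proof. by apply/gsubP=> h v vP; rewrite comp_lfunE; do 2!apply: gmor_comp. Qed.

Definition gcomp_mor U V W (g : gmor V W) (f : gmor U V) : gmor U W :=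
  Subvs (gcomp_sub g f).

Lemma gcomp1m V W (f : gmor V W) : gcomp_mor (gid W) f = f.
Proof. by apply: val_inj; exact: comp_lfun1l. Qed.

Lemma gcompm1 V W (f : gmor V W) : gcomp_mor f (gid V) = f.
Proof. by apply: val_inj; exact: comp_lfun1r. Qed.

Lemma gcompA U V W T (h : gmor W T) (g : gmor V W) (f : gmor U V) :
  gcomp_mor h (gcomp_mor g f) = gcomp_mor (gcomp_mor h g) f.
Proof. by apply: val_inj; exact: comp_lfunA. Qed.

Lemma gcomp_linl U V W (f : gmor U V) :
  linear (fun g : gmor V W => gcomp_mor g f).
Proof.
by move=> a g g'; apply: val_inj; rewrite /= comp_lfunDl -comp_lfunZl.
Qed.

Lemma gcomp_linr U V W (g : gmor V W) :
  linear (fun f : gmor U V => gcomp_mor g f).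
Proof.
by move=> a f f'; apply: val_inj; rewrite /= comp_lfunDr -comp_lfunZr.
Qed.

Definition gvect_lincat : lincat F :=
  LinCat gcomp1m gcompm1 gcompA gcomp_linl gcomp_linr.

Lemma ghomP V W (f f' : gmor V W) :
  (forall g v, v \in gcomp V g -> vsval f v = vsval f' v) -> f = f'.
Proof.
move=> ff'; apply/val_inj/lfunP=> v; rewrite -(gproj_sum v) !linear_sum.
by apply: eq_bigr => g _; apply/ff'/memv_gproj.
Qed.

Lemma grading_direct (V : vectType F) (A : gT -> {vspace V}) (q : gT -> 'End(V)) :
    (forall g h v, v \in A h -> q g v = if g == h then v else 0) ->
  directv (\sum_g A g).
Proof.
move=> qA; apply/directv_sum_independent => u uA u0 g _.
have := congr1 (q g) u0; rewrite linear0 linear_sum (bigD1 g) //= big1.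
  by rewrite addr0 (qA g g) ?eqxx // uA.
by move=> h hg; rewrite (qA g h) ?uA // eq_sym (negPf hg).
Qed.

Lemma grading_full (V : vectType F) (A : gT -> {vspace V}) (q : gT -> 'End(V)) :
    (forall g v, q g v \in A g) -> (forall v, \sum_g q g v = v) ->
  fullv = (\sum_g A g)%VS.
Proof.
move=> qA q1; apply/esym/vspaceP=> v; rewrite memvf -(q1 v).
by apply: memv_suml => g _; apply: (subvP (sumv_sup g _ _)) (qA g v).
Qed.

(* (V (x) W)_k is the sum of the V_g (x) W_h with gh = k. *)
Definition gtens_comp V W (k : gT) : {vspace tsp (gcar V) (gcar W)} :=
  (\sum_(p : gT * gT | (p.1 * p.2)%g == k) tsub (gcomp V p.1) (gcomp W p.2))%VS.

Lemma memv_gtens V W g h v w :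
  v \in gcomp V g -> w \in gcomp W h -> ten v w \in gtens_comp V W (g * h)%g.
Proof.
move=> vP wP; apply: (subvP (sumv_sup (g, h) _ (subvv _))) => //.
exact: memv_tsub.
Qed.

Lemma gtens_ind V W k (P : tsp (gcar V) (gcar W) -> Prop) :
  (forall g h v w, (g * h)%g = k -> v \in gcomp V g -> w \in gcomp W h ->
     P (ten v w)) ->
  (forall a x y, P x -> P y -> P (a *: x + y)) ->
  forall t, t \in gtens_comp V W k -> P t.
Proof.
move=> Pten Plin t /memv_sumP[u uP ->].
have P0 : P 0.
  by rewrite -(ten0l (gcar V) (0 : gcar W)); apply: (Pten k 1%g);
    rewrite ?mulg1 ?mem0v.
have PD x y : P x -> P y -> P (x + y) by rewrite -{2}[x]scale1r; apply: Plin.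
elim/big_ind: _ => // -[g h] /= /eqP ghk.
have := uP (g, h); rewrite /= ghk eqxx => /(_ isT).
by apply: tsub_ind => // a b aP bP; apply: Pten aP bP.
Qed.

Lemma gten_ind V W (P : tsp (gcar V) (gcar W) -> Prop) :
  (forall g h v w, v \in gcomp V g -> w \in gcomp W h -> P (ten v w)) ->
  (forall a x y, P x -> P y -> P (a *: x + y)) ->
  forall t, P t.
Proof.
move=> Pten Plin; apply: ten_ind => // v w.
have P0 : P 0.
  by rewrite -(ten0l (gcar V) (0 : gcar W)); apply: (Pten 1%g 1%g); apply: mem0v.
have PD x y : P x -> P y -> P (x + y) by rewrite -{2}[x]scale1r; apply: Plin.
rewrite -(gproj_sum v) (lin_sum (@ten_linl _ _ _ _)).
elim/big_ind: _ => // g _.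
rewrite -(gproj_sum w) (lin_sum (@ten_linr _ _ _ _)).
by elim/big_ind: _ => // h _; apply: Pten; apply: memv_gproj.
Qed.

Definition gtens_proj V W (k : gT) : 'End(tsp (gcar V) (gcar W)) :=
  \sum_(p : gT * gT | (p.1 * p.2)%g == k) tmap (gproj V p.1) (gproj W p.2).

Lemma gtens_proj_homog V W k l t :
  t \in gtens_comp V W l -> gtens_proj V W k t = if k == l then t else 0.
Proof.
move: t; apply: (gtens_ind (P := fun t => gtens_proj V W k t = if k == l then t else 0))
  => [g h v w <- vP wP|a x y IH IH']; last first.
  by rewrite lfunL IH IH'; case: eqP; rewrite // scaler0 addr0.
have pE p : tmap (gproj V p.1) (gproj W p.2) (ten v w) =
    if p == (g, h) then ten v w else 0.
  rewrite tmapE (gproj_homog _ vP) (gproj_homog _ wP).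
  case: p => a b /=; rewrite xpair_eqE.
  by case: eqP; case: eqP; rewrite /= ?ten0l ?ten0r.
rewrite sum_lfunE (eq_bigr _ (fun p _ => pE p)) -big_mkcondr /=.
case: eqP => [->|kgh].
  rewrite (big_pred1 (g, h)) // => p /=.
  by case: (eqVneq p (g, h)) => [->|]; rewrite ?eqxx ?andbF.
rewrite big_pred0 // => p /=; case: (eqVneq p (g, h)) => [->|]; rewrite ?andbF //=.
by rewrite andbT; apply/eqP => ghk; case: kgh.
Qed.

Lemma memv_gtens_proj V W k t : gtens_proj V W k t \in gtens_comp V W k.
Proof.
elim/ten_ind: t => [v w|a x y IH IH']; last by rewrite lfunL memvD ?memvZ.
rewrite sum_lfunE; apply: memv_suml => -[g h] /= /eqP <-.
by rewrite tmapE; apply: memv_gtens; apply: memv_gproj.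
Qed.

Lemma gtens_proj_sum V W t : \sum_k gtens_proj V W k t = t.
Proof.
elim/gten_ind: t => [g h v w vP wP|a x y IH IH']; last first.
  by rewrite -{2}IH -{2}IH' scaler_sumr -big_split; apply: eq_bigr => k _; rewrite lfunL.
have gP := memv_gtens vP wP.
rewrite (bigD1 (g * h)%g) //= (gtens_proj_homog _ gP) eqxx big1 ?addr0 // => k /negPf kN.
by rewrite (gtens_proj_homog _ gP) kN.
Qed.

Definition gtens V W : gspace :=
  GSpace (grading_direct (@gtens_proj_homog V W))
         (grading_full (@memv_gtens_proj V W) (@gtens_proj_sum V W)).

Lemma gtensm_sub V V' W W' (f : gmor V V') (f' : gmor W W') :
  tmap (vsval f) (vsval f') \in gsub (gtens V W) (gtens V' W').
Proof.
apply/gsubP=> k; apply: (gtens_ind (P := fun t => tmap _ _ t \in gtens_comp V' W' k))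
  => [g h v w <- vP wP|a x y IH IH'].
  by rewrite tmapE; apply: memv_gtens; apply: gmor_comp.
by rewrite lfunL memvD ?memvZ.
Qed.

Definition gtensm V V' W W' (f : gmor V V') (f' : gmor W W') :
    gmor (gtens V W) (gtens V' W') := Subvs (gtensm_sub f f').

Definition gone_comp (g : gT) : {vspace F^o} := if g == 1%g then fullv else 0%VS.

Definition gone_proj (g : gT) : 'End(F^o) := if g == 1%g then \1%VF else 0.

Lemma gone_proj_homog g h (a : F^o) :
  a \in gone_comp h -> gone_proj g a = if g == h then a else 0.
Proof.
rewrite /gone_comp /gone_proj; case: (eqVneq h 1%g) => [->|h1] aP.
  by case: eqP; rewrite ?id_lfunE ?zero_lfunE.
have -> : a = 0 by apply/eqP; rewrite -memv0.
by rewrite linear0; case: ifP.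
Qed.

Lemma memv_gone_proj g (a : F^o) : gone_proj g a \in gone_comp g.
Proof.
by rewrite /gone_comp /gone_proj; case: eqP; rewrite ?memvf // zero_lfunE mem0v.
Qed.

Lemma gone_proj_sum (a : F^o) : \sum_g gone_proj g a = a.
Proof.
rewrite (bigD1 1%g) //= /gone_proj eqxx id_lfunE big1 ?addr0 // => g /negPf->.
by rewrite zero_lfunE.
Qed.

Definition gone : gspace :=
  GSpace (grading_direct gone_proj_homog)
         (grading_full memv_gone_proj gone_proj_sum).

Lemma gtensm1 V W : gtensm (gid V) (gid W) = gid (gtens V W).
Proof. by apply: val_inj; exact: tmap1. Qed.

Lemma gtensm_comp V V' V'' W W' W'' (f' : gmor V' V'') (f : gmor V V')
    (g' : gmor W' W'') (g : gmor W W') :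
  gtensm (gcomp_mor f' f) (gcomp_mor g' g) =
  gcomp_mor (gtensm f' g') (gtensm f g).
Proof. by apply: val_inj; exact: tmap_comp. Qed.

Lemma gtensm_linl V V' W W' (g : gmor W W') :
  linear (fun f : gmor V V' => gtensm f g).
Proof. by move=> a f f'; apply: val_inj; exact: tmap_linl. Qed.

Lemma gtensm_linr V V' W W' (f : gmor V V') :
  linear (fun g : gmor W W' => gtensm f g).
Proof. by move=> a f' g'; apply: val_inj; exact: tmap_linr. Qed.

Section Twisted.
Variable w : gT -> gT -> gT -> F.

(* (u (x) v) (x) z |-> w(g, h, k) u (x) (v (x) z) on U_g, V_h, W_k *)
Definition gassoc_fun U V W :
    'Hom(gcar (gtens (gtens U V) W), gcar (gtens U (gtens V W))) :=
  (tassoc (gcar U) (gcar V) (gcar W) \o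
   \sum_g \sum_h \sum_k
     w g h k *: tmap (tmap (gproj U g) (gproj V h)) (gproj W k))%VF.

Lemma sum3_delta (T : lmodType F) (E : gT -> gT -> gT -> T) (g h k : gT) :
  (forall a b c, ~~ [&& a == g, b == h & c == k] -> E a b c = 0) ->
  \sum_a \sum_b \sum_c E a b c = E g h k.
Proof.
move=> E0; rewrite (bigD1 g) //= [X in _ + X]big1 => [|a ag]; last first.
  by do 2![rewrite big1 // => ? _]; apply: E0; rewrite (negPf ag).
rewrite addr0 (bigD1 h) //= [X in _ + X]big1 => [|b bh]; last first.
  by rewrite big1 // => ? _; apply: E0; rewrite (negPf bh) andbF.
rewrite addr0 (bigD1 k) //= big1 ?addr0 // => c ck.
by apply: E0; rewrite (negPf ck) !andbF.
Qed.

Lemma gassocE U V W g h k u v z :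
  u \in gcomp U g -> v \in gcomp V h -> z \in gcomp W k ->
  gassoc_fun U V W (ten (ten u v) z) = w g h k *: ten u (ten v z).
Proof.
move=> uP vP zP; 
have pE a b c : (w a b c *: tmap (tmap (gproj U a) (gproj V b)) (gproj W c))%VF
    (ten (ten u v) z) =
    if [&& a == g, b == h & c == k] then w g h k *: ten (ten u v) z else 0.
  rewrite scale_lfunE !tmapE (gproj_homog _ uP) (gproj_homog _ vP) (gproj_homog _ zP).
  case: eqP => [->|] /=; last by rewrite !ten0l scaler0.
  case: eqP => [->|] /=; last by rewrite ten0r ten0l scaler0.
  by case: eqP => [->|] //=; rewrite ten0r scaler0.
rewrite comp_lfunE sum_lfunE.
under eq_bigr do rewrite sum_lfunE; under eq_bigr do under eq_bigr do rewrite sum_lfunE.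
rewrite (sum3_delta (g := g) (h := h) (k := k)) => [|a b c abc].
  by rewrite pE !eqxx /= linearZ /= tassocE.
by rewrite pE (negPf abc).
Qed.

Definition gassocV_fun U V W :
    'Hom(gcar (gtens U (gtens V W)), gcar (gtens (gtens U V) W)) :=
  (tassocV (gcar U) (gcar V) (gcar W) \o
   \sum_g \sum_h \sum_k
     (w g h k)^-1 *: tmap (gproj U g) (tmap (gproj V h) (gproj W k)))%VF.

Lemma gassocVE U V W g h k u v z :
  u \in gcomp U g -> v \in gcomp V h -> z \in gcomp W k ->
  gassocV_fun U V W (ten u (ten v z)) = (w g h k)^-1 *: ten (ten u v) z.
Proof.
move=> uP vP zP.
have pE a b c : ((w a b c)^-1 *: tmap (gproj U a) (tmap (gproj V b) (gproj W c)))%VF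
    (ten u (ten v z)) =
    if [&& a == g, b == h & c == k] then (w g h k)^-1 *: ten u (ten v z) else 0.
  rewrite scale_lfunE !tmapE (gproj_homog _ uP) (gproj_homog _ vP) (gproj_homog _ zP).
  case: eqP => [->|] /=; last by rewrite !ten0l scaler0.
  case: eqP => [->|] /=; last by rewrite ten0l ten0r scaler0.
  by case: eqP => [->|] //=; rewrite !ten0r scaler0.
rewrite comp_lfunE sum_lfunE.
under eq_bigr do rewrite sum_lfunE; under eq_bigr do under eq_bigr do rewrite sum_lfunE.
rewrite (sum3_delta (g := g) (h := h) (k := k)) => [|a b c abc].
  by rewrite pE !eqxx /= linearZ /= tassocVE.
by rewrite pE (negPf abc).
Qed.

Lemma gten3_ind U V W (P : gcar (gtens (gtens U V) W) -> Prop) :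
  (forall g h k u v z, u \in gcomp U g -> v \in gcomp V h -> z \in gcomp W k ->
     P (ten (ten u v) z)) ->
  (forall a x y, P x -> P y -> P (a *: x + y)) ->
  forall t, P t.
Proof.
move=> Pten Plin; apply: ten_ind => // x z; rewrite -(gproj_sum z).
have P0 : P 0 by rewrite -(ten0l _ 0) -(ten0l _ 0);
  apply: (Pten 1%g 1%g 1%g); apply: mem0v.
have PD x1 y : P x1 -> P y -> P (x1 + y) by rewrite -{2}[x1]scale1r; apply: Plin.
rewrite (lin_sum (@ten_linr _ _ _ _)); elim/big_ind: _ => // k _.
elim/gten_ind: x => [g h u v uP vP|a x y IH IH'].
  exact: Pten uP vP (memv_gproj _ _).
by rewrite ten_linl; apply: Plin.
Qed.

Lemma gten3V_ind U V W (P : gcar (gtens U (gtens V W)) -> Prop) :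
  (forall g h k u v z, u \in gcomp U g -> v \in gcomp V h -> z \in gcomp W k ->
     P (ten u (ten v z))) ->
  (forall a x y, P x -> P y -> P (a *: x + y)) ->
  forall t, P t.
Proof.
move=> Pten Plin; apply: ten_ind => // u x; rewrite -(gproj_sum u).
have P0 : P 0 by rewrite -(ten0r _ 0) -(ten0r _ 0);
  apply: (Pten 1%g 1%g 1%g); apply: mem0v.
have PD x1 y : P x1 -> P y -> P (x1 + y) by rewrite -{2}[x1]scale1r; apply: Plin.
rewrite (lin_sum (@ten_linl _ _ _ _)); elim/big_ind: _ => // g _.
elim/gten_ind: x => [h k v z vP zP|a x y IH IH'].
  exact: Pten (memv_gproj _ _) vP zP.
by rewrite ten_linr; apply: Plin.
Qed.

Lemma gassoc_sub U V W :
  gassoc_fun U V W \in gsub (gtens (gtens U V) W) (gtens U (gtens V W)).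
Proof.
apply/gsubP=> l.
apply: (gtens_ind (P := fun t => gassoc_fun U V W t \in gtens_comp U (gtens V W) l))
  => [a k x z <- xP zP|a x y IH IH']; last by rewrite lfunL memvD ?memvZ.
move: x xP; apply: (gtens_ind (P := fun x =>
    gassoc_fun U V W (ten x z) \in gtens_comp U (gtens V W) (a * k)%g))
  => [g h u v <- uP vP|b x y IH IH']; last by rewrite ten_linl lfunL memvD ?memvZ.
rewrite (gassocE uP vP zP) -mulgA; apply/memvZ/memv_gtens => //.
exact: memv_gtens.
Qed.

Lemma gassocV_sub U V W :
  gassocV_fun U V W \in gsub (gtens U (gtens V W)) (gtens (gtens U V) W).
Proof.
apply/gsubP=> l.
apply: (gtens_ind (P := fun t => gassocV_fun U V W t \in gtens_comp (gtens U V) W l))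
  => [g a u x <- uP xP|a x y IH IH']; last by rewrite lfunL memvD ?memvZ.
move: x xP; apply: (gtens_ind (P := fun x =>
    gassocV_fun U V W (ten u x) \in gtens_comp (gtens U V) W (g * a)%g))
  => [h k v z <- vP zP|b x y IH IH']; last by rewrite ten_linr lfunL memvD ?memvZ.
rewrite (gassocVE uP vP zP) mulgA; apply/memvZ/memv_gtens => //.
exact: memv_gtens.
Qed.

Definition gassoc U V W : gmor (gtens (gtens U V) W) (gtens U (gtens V W)) :=
  Subvs (gassoc_sub U V W).

Lemma glunit_sub V : tlunit (gcar V) \in gsub (gtens gone V) V.
Proof.
apply/gsubP=> k; apply: (@gtens_ind gone V k (fun t => tlunit (gcar V) t \in gcomp V k))
  => [g h a v <- aP vP|a x y IH IH']; last by rewrite lfunL memvD ?memvZ.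
rewrite tlunitE; move: aP; rewrite /= /gone_comp; case: eqP => [->|_].
  by rewrite mul1g memvZ.
by rewrite memv0 => /eqP->; rewrite scale0r mem0v.
Qed.

Lemma grunit_sub V : trunit (gcar V) \in gsub (gtens V gone) V.
Proof.
apply/gsubP=> k; apply: (@gtens_ind V gone k (fun t => trunit (gcar V) t \in gcomp V k))
  => [g h v a <- vP aP|a x y IH IH']; last by rewrite lfunL memvD ?memvZ.
rewrite trunitE; move: aP; rewrite /= /gone_comp; case: eqP => [->|_].
  by rewrite mulg1 memvZ.
by rewrite memv0 => /eqP->; rewrite scale0r mem0v.
Qed.

Definition glunit V : gmor (gtens gone V) V := Subvs (glunit_sub V).
Definition grunit V : gmor (gtens V gone) V := Subvs (grunit_sub V).

Hypotheses (wP : cocycle3 w) (wN : normalized3 w).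

Lemma gassoc_iso U V W : @is_iso F gvect_lincat _ _ (gassoc U V W).
Proof.
exists (Subvs (gassocV_sub U V W)).
have [w0 _] := wP; split; apply/val_inj/lfunP=> t; rewrite /= comp_lfunE id_lfunE.
  elim/gten3_ind: t => [g h k u v z uP vP zP|a x y IH IH']; last first.
    by rewrite !lfunL IH IH'.
  rewrite (gassocE uP vP zP) linearZ /= (gassocVE uP vP zP).
  by rewrite scalerA divff ?scale1r.
elim/gten3V_ind: t => [g h k u v z uP vP zP|a x y IH IH']; last first.
  by rewrite !lfunL IH IH'.
rewrite (gassocVE uP vP zP) linearZ /= (gassocE uP vP zP).
by rewrite scalerA mulVf ?scale1r.
Qed.

Lemma gone1 : (1 : F^o) \in gone_comp 1%g.
Proof. by rewrite /gone_comp eqxx memvf. Qed.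

Lemma glunit_iso V : @is_iso F gvect_lincat _ _ (glunit V).
Proof.
have [b bE] : exists b : 'Hom(gcar V, gcar (gtens gone V)), forall v, b v = ten 1 v.
  by exists (linfun (to_linear (@ten_linr F F^o (gcar V) 1))) => v; rewrite lfunE.
have bP : b \in gsub V (gtens gone V).
  apply/gsubP=> g v vP; rewrite bE -[g]mul1g.
  exact: (@memv_gtens gone V _ _ _ _ gone1 vP).
exists (Subvs bP); split; apply/val_inj/lfunP=> t.
  rewrite /= comp_lfunE id_lfunE.
  elim/ten_ind: t => [a v|a x y IH IH']; last by rewrite !lfunL IH IH'.
  rewrite tlunitE bE -[a in RHS]mulr1.
  by rewrite (linZ (@ten_linr F F^o (gcar V) 1)) -(linZ (@ten_linl F F^o (gcar V) v)).
by rewrite /= comp_lfunE id_lfunE bE tlunitE scale1r.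
Qed.

Lemma grunit_iso V : @is_iso F gvect_lincat _ _ (grunit V).
Proof.
have [b bE] : exists b : 'Hom(gcar V, gcar (gtens V gone)), forall v, b v = ten v 1.
  by exists (linfun (to_linear (@ten_linl F (gcar V) F^o 1))) => v; rewrite lfunE.
have bP : b \in gsub V (gtens V gone).
  apply/gsubP=> g v vP; rewrite bE -[g]mulg1.
  exact: (@memv_gtens V gone _ _ _ _ vP gone1).
exists (Subvs bP); split; apply/val_inj/lfunP=> t.
  rewrite /= comp_lfunE id_lfunE.
  elim/ten_ind: t => [v a|a x y IH IH']; last by rewrite !lfunL IH IH'.
  rewrite trunitE bE -[a in RHS]mulr1.
  by rewrite (linZ (@ten_linl F (gcar V) F^o 1)) -(linZ (@ten_linr F (gcar V) F^o v)).
by rewrite /= comp_lfunE id_lfunE bE trunitE scale1r.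
Qed.

Lemma gassoc_nat U U' V V' W W' (f : gmor U U') (g : gmor V V') (h : gmor W W') :
  gcomp_mor (gassoc U' V' W') (gtensm (gtensm f g) h) =
  gcomp_mor (gtensm f (gtensm g h)) (gassoc U V W).
Proof.
apply/val_inj/lfunP=> t; rewrite /= [LHS]comp_lfunE [RHS]comp_lfunE.
elim/gten3_ind: t => [a b c u v z uP vP zP|a x y IH IH']; last first.
  by rewrite !lfunL IH IH'.
rewrite (gassocE uP vP zP) linearZ /= !tmapE.
by rewrite (gassocE (gmor_comp f uP) (gmor_comp g vP) (gmor_comp h zP)).
Qed.

Lemma glunit_nat U V (f : gmor U V) :
  gcomp_mor (glunit V) (gtensm (gid gone) f) = gcomp_mor f (glunit U).
Proof.
apply/val_inj/thomP=> a v; rewrite /= [LHS]comp_lfunE [RHS]comp_lfunE tmapE !tlunitE id_lfunE.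
by rewrite linearZ.
Qed.

Lemma grunit_nat U V (f : gmor U V) :
  gcomp_mor (grunit V) (gtensm f (gid gone)) = gcomp_mor f (grunit U).
Proof.
apply/val_inj/thomP=> v a; rewrite /= [LHS]comp_lfunE [RHS]comp_lfunE tmapE !trunitE id_lfunE.
by rewrite linearZ.
Qed.

Lemma gpentagon U V W T :
  gcomp_mor (gcomp_mor (gtensm (gid U) (gassoc V W T)) (gassoc U (gtens V W) T))
    (gtensm (gassoc U V W) (gid T)) =
  gcomp_mor (gassoc U V (gtens W T)) (gassoc (gtens U V) W T).
Proof.
apply/val_inj/lfunP=> s; rewrite /= [LHS]comp_lfunE [LHS]comp_lfunE [RHS]comp_lfunE.
elim/gten_ind: s => [l k x t xP tP|a x y IH IH']; last by rewrite !lfunL IH IH'.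
elim/gten3_ind: x {xP} => [g h m u v z uP vP zP|a x y IH IH']; last first.
  by rewrite !ten_linl !lfunL IH IH'.
have vz := memv_gtens vP zP; have uv := memv_gtens uP vP; have zt := memv_gtens zP tP.
rewrite tmapE id_lfunE (gassocE uP vP zP) (linZ (@ten_linl _ _ _ _)) linearZ /=.
rewrite (@gassocE U (gtens V W) T _ _ _ _ _ _ uP vz tP) !linearZ /= tmapE id_lfunE.
rewrite (gassocE vP zP tP) (linZ (@ten_linr _ _ _ _)).
rewrite (@gassocE (gtens U V) W T _ _ _ _ _ _ uv zP tP).
rewrite (linZ (@lfunL _ _ _ (gassoc_fun U V (gtens W T)))).
rewrite (@gassocE U V (gtens W T) _ _ _ _ _ _ uP vP zt) !scalerA.
by have [_ <-] := wP; congr (_ *: _); ring.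
Qed.

Lemma gtriangle U V :
  gcomp_mor (gtensm (gid U) (glunit V)) (gassoc U gone V) =
  gtensm (grunit U) (gid V).
Proof.
apply/val_inj/lfunP=> s; rewrite /= [LHS]comp_lfunE.
elim/gten3_ind: s => [g h k u a v uP aP vP|a x y IH IH']; last first.
  by rewrite !lfunL IH IH'.
rewrite (gassocE uP aP vP) linearZ /= !tmapE !id_lfunE tlunitE trunitE.
rewrite (linZ (@ten_linr _ _ _ _)) (linZ (@ten_linl _ _ _ _)).
move: aP; rewrite /= /gone_comp; case: eqP => [->|_].
  by have [_ -> _] := wN g k; rewrite scale1r.
by rewrite memv0 => /eqP->; rewrite !scale0r scaler0.
Qed.

Definition Vec : moncat F :=
  @MonCat F gvect_lincat gtens gtensm gone gassoc glunit grunit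
    gtensm1 gtensm_comp gtensm_linl gtensm_linr gassoc_iso glunit_iso grunit_iso
    gassoc_nat glunit_nat grunit_nat gpentagon gtriangle.

End Twisted.
End GradedSpaces.

Definition scalar_extension (K : fieldType) (L : fieldExtType K)
    (C : moncat K) : moncat L :=
  karoubi (ext_cat L C).

Definition is_form (K : fieldType) (L : fieldExtType K) (C : moncat L)
    (CK : moncat K) : Prop :=
  is_fusion CK /\ tens_equivalent (scalar_extension L CK) C.

Definition has_split_form (K : fieldType) (L : fieldExtType K)
    (C : moncat L) : Prop :=
  exists CK : moncat K, is_form C CK /\ split_fusion CK.

(* Main.v *)
(** If [w] is cohomologous to the image of a cocycle over [K], that cocycle may be
    taken normalized, [w0 = w * d m]; then [X |-> L (x) X], with tensor structure
    multiplied by [m] in degrees [(g, h)], extends to the idempotent completion as an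
    equivalence from the scalar extension of [Vec w0] to [Vec w].

    Conversely, let [T] be an equivalence from the scalar extension of a split form
    [CK].  The simple object [delta g] is a retract of some [T S] with [S] simple in
    [CK], because objects of [CK] are sums of simple ones; as [End S = K], the
    retraction is an isomorphism.  With [Xs g] this simple object, [T] being full gives
    a nonzero [n g h : Xs g (x) Xs h -> Xs (g h)] already over [K].  In [Vec w] it
    becomes a nonzero scalar [mu g h], so the two composites
    [Xs g (x) Xs h (x) Xs k -> Xs (g h k)] differ by the factor [w * d mu].  Both are
    defined over [K] and nonzero, so this factor lies in [K]: it is the required cocycle. *)

From HB Require Import structures.
From mathcomp Require Import all_boot all_order all_fingroup all_algebra all_field.
From mathcomp Require Import boolp ring.
(* [Defs] comes last: [idm] would otherwise be the identity morphism of groups. *)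
Require Import Defs.

Set Implicit Arguments.
Unset Strict Implicit.
Unset Printing Implicit Defensive.

Import GRing.Theory.
Local Open Scope ring_scope.
Local Open Scope cat_scope.

(** * Linear categories *)

(** The obstacle in the converse is that an object of the scalar extension is a pair [(X, e)] with
    an idempotent [e] defined only over [L]. The argument therefore passes to objects [(X, 1)] with
    [X] in [CK]. Between such objects the morphism space is the scalar extension of the one in [CK],
    and two rationality facts suffice: if the extended space is nonzero, so is the original one; and
    if two vectors over [K], the second nonzero, are proportional over [L], the factor lies in [K].
    The pentagon of [CK] is never evaluated: the cocycle identity holds over [L] because [w * d mu]
    is a cocycle, and it descends since [K -> L] is injective. In the other direction, the abelian
    structure of graded spaces comes from pseudo-inverses ([f g f = f]) together with split
    idempotents. Equivalences are recognized as full, faithful and essentially surjective functors,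
    so no tensor structure is ever put on a quasi-inverse. *)

Section LinearCategories.
Variables (F : fieldType) (C : lincat F).
Implicit Types X Y Z W : C.

Lemma comp0m X Y Z (f : mor X Y) : (0 : mor Y Z) \oc f = 0.
Proof. exact: (lin0 (@comp_linl _ _ _ _ _ f)). Qed.

Lemma compm0 X Y Z (g : mor Y Z) : g \oc (0 : mor X Y) = 0.
Proof. exact: (lin0 (@comp_linr _ _ _ _ _ g)). Qed.

Lemma compZm X Y Z a (g : mor Y Z) (f : mor X Y) : (a *: g) \oc f = a *: (g \oc f).
Proof. exact: (linZ (@comp_linl _ _ _ _ _ f)). Qed.

Lemma compmZ X Y Z a (g : mor Y Z) (f : mor X Y) : g \oc (a *: f) = a *: (g \oc f).
Proof. exact: (linZ (@comp_linr _ _ _ _ _ g)). Qed.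

Lemma compBm X Y Z (g g' : mor Y Z) (f : mor X Y) :
  (g - g') \oc f = (g \oc f) - (g' \oc f).
Proof. by rewrite (linD (@comp_linl _ _ _ _ _ f)) -scaleN1r compZm scaleN1r. Qed.

Lemma compmB X Y Z (g : mor Y Z) (f f' : mor X Y) :
  g \oc (f - f') = (g \oc f) - (g \oc f').
Proof. by rewrite (linD (@comp_linr _ _ _ _ _ g)) -scaleN1r compmZ scaleN1r. Qed.

Lemma comp_suml X Y Z I (r : seq I) (P : pred I) (g : I -> mor Y Z) (f : mor X Y) :
  (\sum_(i <- r | P i) g i) \oc f = \sum_(i <- r | P i) (g i \oc f).
Proof. exact: (lin_sum (@comp_linl _ _ _ _ _ f)). Qed.

Lemma comp_sumr X Y Z I (r : seq I) (P : pred I) (g : mor Y Z) (f : I -> mor X Y) :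
  g \oc (\sum_(i <- r | P i) f i) = \sum_(i <- r | P i) (g \oc f i).
Proof. exact: (lin_sum (@comp_linr _ _ _ _ _ g)). Qed.

Lemma zero_objP X : zero_obj X <-> idm X = 0.
Proof.
split=> [/(_ X)[X0 _]|X0 Y]; [exact: X0 | split=> f]; first by rewrite -[f]comp1m X0 comp0m.
by rewrite -[f]compm1 X0 compm0.
Qed.

Lemma inverse_mor_sym X Y (f : mor X Y) g : inverse_mor f g -> inverse_mor g f.
Proof. by case. Qed.

Lemma isomorphic_sym X Y : isomorphic X Y -> isomorphic Y X.
Proof. by move=> [f [g /inverse_mor_sym gf]]; exists g, f. Qed.

Lemma iso_comp X Y Z (f : mor X Y) (g : mor Y Z) :
  is_iso f -> is_iso g -> is_iso (g \oc f).
Proof.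
move=> [f' [f'f ff']] [g' [g'g gg']]; exists (f' \oc g'); split.
  by rewrite -compA (compA g') g'g comp1m.
by rewrite -compA (compA f) ff' comp1m.
Qed.

Lemma split_mono X Y (i : mor X Y) p : p \oc i = idm X -> mono i.
Proof. by move=> pi Z g h /(congr1 (comp p)); rewrite !compA pi !comp1m. Qed.

Definition splits X (e : mor X X) : Prop :=
  exists Y (i : mor Y X) (p : mor X Y), p \oc i = idm Y /\ i \oc p = e.

Definition idem_complete : Prop :=
  forall X (e : mor X X), e \oc e = e -> splits e.

(* von Neumann regularity, not regularity in Barr's sense *)
Definition regular_cat : Prop :=
  forall X Y (f : mor X Y), exists g, f \oc g \oc f = f.

Section Regular.
Hypotheses (Creg : regular_cat) (Csplit : idem_complete).

(** If [f g f = f], then [1 - g f] is an idempotent projecting onto the kernel of [f], so splitting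
    it produces the kernel. The cokernel comes in the same way from [1 - f g]. *)
Lemma regular_kernel X Y (f : mor X Y) : exists Z (k : mor Z X), is_kernel k f.
Proof.
have [g fgf] := Creg f; pose e := idm X - (g \oc f).
have fe : f \oc e = 0 by rewrite compmB compm1 compA fgf subrr.
have [|Z [i [p [pi ip]]]] := Csplit (e := e).
  by rewrite {1}/e compBm comp1m -compA fe compm0 subr0.
exists Z, i; split; first by rewrite -[i]compm1 -pi (compA i) ip compA fe comp0m.
move=> W h fh; exists (p \oc h); split=> [|u <-]; last by rewrite compA pi comp1m.
by rewrite compA ip compBm comp1m -compA fh compm0 subr0.
Qed.

Lemma regular_cokernel X Y (f : mor X Y) : exists Z (c : mor Y Z), is_cokernel c f.
Proof.
have [g fgf] := Creg f; pose e := idm Y - (f \oc g).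
have ef : e \oc f = 0 by rewrite compBm comp1m fgf subrr.
have [|Z [i [p [pi ip]]]] := Csplit (e := e).
  by rewrite {2}/e compmB compm1 compA ef comp0m subr0.
exists Z, p; split; first by rewrite -[p]comp1m -pi -(compA p) ip -compA ef compm0.
move=> W h hf; exists (h \oc i); split=> [|u <-]; last by rewrite -compA pi compm1.
by rewrite -compA ip compmB compm1 compA hf comp0m subr0.
Qed.

Lemma regular_mono X Y (f : mor X Y) : mono f -> exists g, g \oc f = idm X.
Proof. by move=> fM; have [g fgf] := Creg f; exists g; apply: fM; rewrite compm1 compA. Qed.

Lemma regular_epi X Y (f : mor X Y) : epi f -> exists g, f \oc g = idm Y.
Proof. by move=> fE; have [g fgf] := Creg f; exists g; apply: fE; rewrite comp1m. Qed.

(** Regularity makes every mono and every epi split. A mono [f] with retraction [g] is the kernel of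
    [1 - f g], and an epi [f] with section [g] is the cokernel of [1 - g f]. *)
Lemma regular_abelian :
  (exists Z : C, zero_obj Z) ->
  (forall X Y, exists Z, direct_sum (fun a : 'I_2 => if a == 0 then X else Y) Z) ->
  abelian_cat C.
Proof.
move=> C0 C2; split=> // X Y f.
- by split; [apply: regular_kernel | apply: regular_cokernel].
- move=> fM; have [g gf] := regular_mono fM; exists Y, (idm Y - (f \oc g)); split.
    by rewrite compBm comp1m -compA gf compm1 subrr.
  move=> W h; rewrite compBm comp1m => /subr0_eq hE.
  exists (g \oc h); split=> [|u fu]; first by rewrite compA -hE.
  by apply: fM; rewrite compA -hE.
- move=> fE; have [g fg] := regular_epi fE; exists X, (idm X - (g \oc f)); split.
    by rewrite compmB compm1 compA fg comp1m subrr.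
  move=> W h; rewrite compmB compm1 => /subr0_eq hE.
  exists (h \oc g); split=> [|u uf]; first by rewrite -compA -hE.
  by apply: fE; rewrite -compA -hE.
Qed.

(** Uniqueness of the scalar is what excludes [idm X = 0]: otherwise 0 and 1 would both express the
    zero endomorphism. *)
Lemma scalar_end_neq0 X : scalar_end X -> idm X != 0.
Proof.
move=> /(_ 0)[a [_ aU]]; apply/eqP=> X0.
have := oner_neq0 F; rewrite -(aU 0) ?scale0r // => /eqP; apply.
by apply/esym/aU; rewrite X0 scaler0.
Qed.

Lemma scalar_endI X : idm X != 0 ->
  (forall f : mor X X, exists a : F, f = a *: idm X) -> scalar_end X.
Proof.
move=> X0 Xs f; have [a fE] := Xs f; exists a; split=> // b.
rewrite fE => /eqP; rewrite -subr_eq0 -scalerBl scaler_eq0 (negPf X0) orbF.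
by rewrite subr_eq0 => /eqP.
Qed.

(** A mono [f] into [X] has a retraction [g], and [f g] is a scalar [a]. From [f g f = f] follows
    [(1 - a) f = 0]: either [f = 0] and the source is zero, or [a = 1] and [g] is a two-sided
    inverse. *)
Lemma scalar_end_simple X : scalar_end X -> simple_obj X.
Proof.
move=> Xs; have X0 := scalar_end_neq0 Xs; split=> [/zero_objP/eqP|Y f fM].
  by rewrite (negPf X0).
have [g gf] := regular_mono fM; have [a [fgE _]] := Xs (f \oc g).
have [f0|fN0] := eqVneq f 0.
  by left; apply/zero_objP; rewrite -gf f0 compm0.
right; exists g; split=> //; rewrite fgE.
have /eqP : (1 - a) *: f = 0.
  rewrite scalerBl scale1r -[f in a *: f]comp1m -compZm -fgE -compA gf.
  by rewrite compm1 subrr.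
by rewrite scaler_eq0 (negPf fN0) orbF subr_eq0 => /eqP<-; rewrite scale1r.
Qed.

Lemma scalar_end_iso X Y : isomorphic X Y -> scalar_end X -> scalar_end Y.
Proof.
move=> [f [g [gf fg]]] Xs; apply: scalar_endI => [|h].
  apply/eqP=> Y0; have /eqP[] := scalar_end_neq0 Xs.
  by rewrite -gf -[g]compm1 Y0 compm0 comp0m.
have [a [hE _]] := Xs (g \oc h \oc f); exists a.
rewrite -[h]comp1m -[h]compm1 -fg -!compA (compA h) (compA g) (compA g) hE.
by rewrite compZm compmZ comp1m.
Qed.

Section Generators.
Variables (I : finType) (D : I -> C).
Hypothesis Dgen : forall X, exists n (S : 'I_n -> I),
  direct_sum (fun a => D (S a)) X.
Hypothesis Dscalar : forall j, scalar_end (D j).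

(** A nonzero [X] has a first summand. Its inclusion is a split mono from a nonzero object, hence an
    isomorphism by simplicity. *)
Lemma simple_generator X : simple_obj X -> exists j, isomorphic X (D j).
Proof.
move=> [XN0 Xs]; have [n [S [i [p [pi _ ip]]]]] := Dgen X.
case: n S i p pi ip => [|n] S i p pi ip.
  by case: XN0; apply/zero_objP; rewrite -ip big_ord0.
exists (S ord0); apply: isomorphic_sym; exists (i ord0).
have [D0|//] := Xs _ _ (split_mono (pi ord0)).
by have /eqP[] := scalar_end_neq0 (@Dscalar (S ord0)); apply/zero_objP.
Qed.

Lemma generated_semisimple : semisimple C.
Proof.
move=> X; have [n [S XS]] := Dgen X; exists n, (fun a => D (S a)); split=> // a.
exact: scalar_end_simple.
Qed.

Lemma generated_finitely_many_simples : finitely_many_simples C.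
Proof.
exists #|I|, (fun a => D (enum_val a)) => X /simple_generator[j XD].
by exists (enum_rank j); rewrite enum_rankK.
Qed.

Lemma generated_split X : simple_obj X -> scalar_end X.
Proof. by move=> /simple_generator[j /isomorphic_sym/scalar_end_iso]; apply. Qed.

End Generators.
End Regular.
End LinearCategories.

(** * Linear functors and recognition of equivalences *)

Section Functors.
Variables (F : fieldType) (C D : lincat F) (T : linfunctor C D).
Implicit Types X Y : C.

Definition full : Prop := forall X Y (h : mor (T X) (T Y)), exists f, fmor T f = h.
Definition faithful : Prop := forall X Y (f : mor X Y), fmor T f = 0 -> f = 0.
Definition essentially_surjective : Prop := forall V, exists X, isomorphic (T X) V.

Lemma fmor0 X Y : fmor T (0 : mor X Y) = 0.
Proof. exact: (lin0 (@fmor_lin _ _ _ T X Y)). Qed.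

Lemma fmorZ X Y a (f : mor X Y) : fmor T (a *: f) = a *: fmor T f.
Proof. exact: (linZ (@fmor_lin _ _ _ T X Y)). Qed.

Lemma fmorB X Y (f g : mor X Y) : fmor T (f - g) = fmor T f - fmor T g.
Proof. by rewrite (linD (@fmor_lin _ _ _ T X Y)) -scaleN1r fmorZ scaleN1r. Qed.

Lemma fmor_sum X Y I (r : seq I) (P : pred I) (f : I -> mor X Y) :
  fmor T (\sum_(i <- r | P i) f i) = \sum_(i <- r | P i) fmor T (f i).
Proof. exact: (lin_sum (@fmor_lin _ _ _ T X Y)). Qed.

Lemma faithful_inj X Y (f g : mor X Y) : faithful -> fmor T f = fmor T g -> f = g.
Proof.
move=> Tf fg; apply/eqP; rewrite -subr_eq0; apply/eqP/Tf.
by rewrite fmorB fg subrr.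
Qed.

(** Choice provides [S V] with an isomorphism [ep V] from [T (S V)] to [V]. On morphisms [S] takes
    the preimage under [T] of the conjugate by [ep]; faithfulness makes this preimage unique, hence
    functorial and linear. The unit at [X] is the preimage of the inverse of [ep (T X)]. *)
Lemma equivalence_of_full_faithful :
  full -> faithful -> essentially_surjective -> is_equivalence T.
Proof.
move=> Tfull Tff Tsurj.
pose S V := sval (cid (Tsurj V)).
have SP V : isomorphic (T (S V)) V by rewrite /S; case: cid.
pose ep V : mor (T (S V)) V := sval (cid (SP V)).
have epI V : is_iso (ep V) by rewrite /ep; case: cid.
pose ep' V := sval (cid (epI V)).
have epP V : inverse_mor (ep V) (ep' V) by rewrite /ep'; case: cid.
pose Tinv X Y h := sval (cid (Tfull X Y h)).
have TinvK X Y h : fmor T (@Tinv X Y h) = h by rewrite /Tinv; case: cid.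
have epK V : ep V \oc ep' V = idm V by case: (epP V).
have ep'K V : ep' V \oc ep V = idm (T (S V)) by case: (epP V).
pose Sm V W (f : mor V W) : mor (S V) (S W) := Tinv _ _ (ep' W \oc f \oc ep V).
have Sm1 V : Sm V V (idm V) = idm (S V).
  by apply: faithful_inj; rewrite // TinvK compm1 ep'K fmor1.
have SmM U V W (g : mor V W) (f : mor U V) : Sm _ _ (g \oc f) = Sm _ _ g \oc Sm _ _ f.
  apply: faithful_inj; rewrite // fmor_comp !TinvK -!compA; congr (_ \oc (_ \oc _)).
  by rewrite (compA (ep V)) epK comp1m.
have SmL V W : linear (Sm V W).
  move=> a f g; apply: faithful_inj; rewrite // fmor_lin !TinvK.
  by rewrite comp_linr comp_linl.
exists (LinFunctor Sm1 SmM SmL); split; last first.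
  exists ep; split=> [V|V W f]; first by exists (ep' V).
  by rewrite TinvK !compA epK comp1m.
exists (fun X => Tinv X (S (T X)) (ep' (T X))); split=> [X|X Y f].
  exists (Tinv (S (T X)) X (ep (T X))).
  by split; apply: faithful_inj; rewrite // fmor_comp !TinvK fmor1.
apply: faithful_inj; rewrite // !fmor_comp !TinvK -!compA epK.
by rewrite compm1.
Qed.

End Functors.

Section Equivalences.
Variables (F : fieldType) (C D : lincat F).

Lemma nat_iso_faithful (T : linfunctor C D) (S : linfunctor D C) :
  (exists eta : forall X : C, mor X (S (T X)),
     (forall X, is_iso (eta X)) /\
     forall X Y (f : mor X Y), eta Y \oc f = fmor S (fmor T f) \oc eta X) ->
  faithful T.
Proof.
move=> [eta [etaI etaN]] X Y f Tf0; have [g [gY _]] := etaI Y.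
by rewrite -[f]comp1m -gY -compA etaN Tf0 fmor0 comp0m compm0.
Qed.

Lemma nat_iso_faithfulV (T : linfunctor C D) (S : linfunctor D C) :
  (exists eps : forall X : D, mor (T (S X)) X,
     (forall X, is_iso (eps X)) /\
     forall X Y (f : mor X Y), eps Y \oc fmor T (fmor S f) = f \oc eps X) ->
  faithful S.
Proof.
move=> [eps [epsI epsN]] X Y f Sf0; have [g [_ Xg]] := epsI X.
by rewrite -[f]compm1 -Xg compA -epsN Sf0 fmor0 compm0 comp0m.
Qed.

(** The conjugate of [S h] by the unit is a preimage of [h]: naturality of the unit shows that its
    image under [T] and [h] agree after applying [S], which is faithful by the counit. *)
Lemma quasi_inverse_full (T : linfunctor C D) (S : linfunctor D C) :
  quasi_inverse T S -> full T.
Proof.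
move=> [[eta [etaI etaN]] /nat_iso_faithfulV Sf] X Y h.
have [u [uX Xu]] := etaI X; have [v [vY Yv]] := etaI Y.
exists (v \oc fmor S h \oc eta X); apply: (faithful_inj Sf).
rewrite -[LHS]compm1 -Xu compA -etaN !compA Yv comp1m.
by rewrite -compA Xu compm1.
Qed.

End Equivalences.

(** * Extending a tensor functor to the idempotent completion *)

Section TensorMorphisms.
Variables (F : fieldType) (C : moncat F).
Implicit Types X Y Z : C.

Lemma tensm_iso X X' Y Y' (f : mor X X') (g : mor Y Y') :
  is_iso f -> is_iso g -> is_iso (f \om g).
Proof.
move=> [f' [f'f ff']] [g' [g'g gg']]; exists (f' \om g').
by split; rewrite -tensm_comp ?f'f ?ff' ?g'g ?gg' tensm1.
Qed.

End TensorMorphisms.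

Section KaroubiExtension.
Variables (F : fieldType) (E D : moncat F) (T : tensfunctor E D).
Hypothesis Dsplit : idem_complete D.
Implicit Types X Y Z : kar_obj E.

(** The extension of [T] sends [(X, e)] to a chosen image of the idempotent [T e], which splits in
    [D]. Inclusion and projection are packed in one pair so that a single choice fixes both. *)
Lemma kar_image_exists X :
  exists V (ip : mor V (T (kar_src X)) * mor (T (kar_src X)) V),
    ip.2 \oc ip.1 = idm V /\ ip.1 \oc ip.2 = fmor T (kar_idem X).
Proof.
have [|V [i [p ipP]]] := @Dsplit _ (fmor T (kar_idem X)).
  by rewrite -fmor_comp kar_idemP.
by exists V, (i, p).
Qed.

Definition kar_image X : D := sval (cid (kar_image_exists X)).
Definition kar_maps X := sval (cid (svalP (cid (kar_image_exists X)))).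
Definition kar_in X : mor (kar_image X) (T (kar_src X)) := (kar_maps X).1.
Definition kar_pr X : mor (T (kar_src X)) (kar_image X) := (kar_maps X).2.

Lemma kar_prK X : kar_pr X \oc kar_in X = idm (kar_image X).
Proof. exact: (svalP (cid (svalP (cid (kar_image_exists X))))).1. Qed.

Lemma kar_inK X : kar_in X \oc kar_pr X = fmor T (kar_idem X).
Proof. exact: (svalP (cid (svalP (cid (kar_image_exists X))))).2. Qed.

Lemma idem_kar_in X : fmor T (kar_idem X) \oc kar_in X = kar_in X.
Proof. by rewrite -kar_inK -compA kar_prK compm1. Qed.

Lemma kar_pr_idem X : kar_pr X \oc fmor T (kar_idem X) = kar_pr X.
Proof. by rewrite -kar_inK compA kar_prK comp1m. Qed.

(** Each structure map of the extended functor is characterized by its composite with [kar_in]. As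
    [kar_in] is mono, the axioms are proved by composing with it, which reduces them to the
    corresponding axioms of [T]. *)
Lemma kar_fmor_exists X Y (f : kar_mor X Y) :
  exists h, kar_in Y \oc h = fmor T (vsval f) \oc kar_in X.
Proof.
exists (kar_pr Y \oc fmor T (vsval f) \oc kar_in X).
by rewrite !compA kar_inK -fmor_comp kar_morl.
Qed.

Definition kar_fmor X Y (f : kar_mor X Y) : mor (kar_image X) (kar_image Y) :=
  sval (cid (kar_fmor_exists f)).

Lemma kar_fmorE X Y (f : kar_mor X Y) :
  kar_in Y \oc kar_fmor f = fmor T (vsval f) \oc kar_in X.
Proof. exact: svalP (cid (kar_fmor_exists f)). Qed.

Lemma kar_in_mono X : mono (kar_in X).
Proof. exact: split_mono (kar_prK X). Qed.

Lemma kar_fmor1 X : kar_fmor (kar_idm X) = idm (kar_image X).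
Proof. by apply: kar_in_mono; rewrite kar_fmorE compm1 idem_kar_in. Qed.

Lemma kar_fmor_comp X Y Z (g : kar_mor Y Z) (f : kar_mor X Y) :
  kar_fmor (kar_comp g f) = kar_fmor g \oc kar_fmor f.
Proof.
by apply: kar_in_mono; rewrite compA !kar_fmorE -compA kar_fmorE compA fmor_comp.
Qed.

Lemma kar_fmor_lin X Y : linear (@kar_fmor X Y).
Proof.
move=> a f g; apply: kar_in_mono.
by rewrite comp_linr !kar_fmorE /= fmor_lin comp_linl.
Qed.

Definition kar_linfunctor : linfunctor (karoubi E) D :=
  @LinFunctor _ (karoubi E) D kar_image kar_fmor kar_fmor1 kar_fmor_comp kar_fmor_lin.

Lemma kar_ften_exists X Y :
  exists h, kar_in (kar_tens X Y) \oc h = ften T _ _ \oc (kar_in X \om kar_in Y).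
Proof.
exists (kar_pr (kar_tens X Y) \oc (ften T _ _ \oc (kar_in X \om kar_in Y))).
by rewrite compA kar_inK compA -ften_nat -compA -tensm_comp !idem_kar_in.
Qed.

Definition kar_ften X Y : mor (kar_image X \ox kar_image Y) (kar_image (kar_tens X Y)) :=
  sval (cid (kar_ften_exists X Y)).

Lemma kar_ftenE X Y :
  kar_in (kar_tens X Y) \oc kar_ften X Y = ften T _ _ \oc (kar_in X \om kar_in Y).
Proof. exact: svalP (cid (kar_ften_exists X Y)). Qed.

Lemma kar_ften_absorb X Y :
  fmor T (kar_idem X \om kar_idem Y) \oc (ften T _ _ \oc (kar_in X \om kar_in Y)) =
  ften T _ _ \oc (kar_in X \om kar_in Y).
Proof. by rewrite compA -ften_nat -compA -tensm_comp !idem_kar_in. Qed.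

Lemma kar_ften_iso X Y : is_iso (kar_ften X Y).
Proof.
have [b [bf fb]] := ften_iso T (kar_src X) (kar_src Y).
exists ((kar_pr X \om kar_pr Y) \oc b \oc kar_in (kar_tens X Y)); split.
  rewrite -compA kar_ftenE -compA (compA b) bf comp1m -tensm_comp.
  by rewrite !kar_prK tensm1.
apply: kar_in_mono; rewrite compA kar_ftenE -!compA (compA (_ \om _)) -tensm_comp.
rewrite !kar_inK (compA (ften _ _ _)) ften_nat -compA (compA _ b) fb comp1m.
by rewrite (idem_kar_in (kar_tens X Y)) compm1.
Qed.

Lemma kar_fone_exists : exists h, kar_in (kar_one E) \oc h = fone T.
Proof. by exists (kar_pr (kar_one E) \oc fone T); rewrite compA kar_inK fmor1 comp1m. Qed.

Definition kar_fone : mor (one D) (kar_image (kar_one E)) := sval (cid kar_fone_exists).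

Lemma kar_foneE : kar_in (kar_one E) \oc kar_fone = fone T.
Proof. exact: svalP (cid kar_fone_exists). Qed.

Lemma kar_fone_iso : is_iso kar_fone.
Proof.
have [b [bf fb]] := fone_iso T; exists (b \oc kar_in (kar_one E)); split.
  by rewrite -compA kar_foneE.
by apply: kar_in_mono; rewrite compA kar_foneE compA fb comp1m compm1.
Qed.

Lemma kar_ften_nat X X' Y Y' (f : kar_mor X X') (g : kar_mor Y Y') :
  kar_ften X' Y' \oc (kar_fmor f \om kar_fmor g) =
  kar_fmor (kar_tensm f g) \oc kar_ften X Y.
Proof.
apply: kar_in_mono.
rewrite !compA kar_ftenE kar_fmorE -!compA kar_ftenE -tensm_comp !kar_fmorE.
by rewrite tensm_comp !compA ften_nat.
Qed.

Lemma kar_ften_assoc X Y Z :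
  kar_fmor (kar_assoc X Y Z) \oc kar_ften (kar_tens X Y) Z
    \oc (kar_ften X Y \om idm (kar_image Z)) =
  kar_ften X (kar_tens Y Z) \oc (idm (kar_image X) \om kar_ften Y Z)
    \oc assoc (kar_image X) (kar_image Y) (kar_image Z).
Proof.
apply: kar_in_mono.
rewrite !compA kar_fmorE -(compA _ (kar_in _)) !kar_ftenE.
rewrite -!compA -!tensm_comp compm1 !kar_ftenE /= -assoc_nat fmor_comp -compA.
rewrite (compA (fmor _ _) (ften _ _ _)) -ften_nat -(compA (ften _ _ _)) -tensm_comp.
rewrite kar_ften_absorb idem_kar_in -[kar_in Z in LHS]comp1m tensm_comp !compA ften_assoc.
rewrite -!compA assoc_nat (compA (_ \om _)) (compA (kar_in X \om _)) -!tensm_comp.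
by rewrite comp1m compm1 kar_ftenE.
Qed.

Lemma kar_ften_lunit X :
  kar_fmor (kar_lunit X) \oc kar_ften (kar_one E) X
    \oc (kar_fone \om idm (kar_image X)) = lunit (kar_image X).
Proof.
apply: kar_in_mono.
rewrite !compA kar_fmorE -(compA _ (kar_in _)) kar_ftenE -!compA -tensm_comp.
rewrite kar_foneE compm1 /= fmor_comp -{1}[fone T]compm1 -{1}[kar_in X]comp1m.
rewrite tensm_comp -compA (compA (ften _ _ _)) (compA (fmor _ (lunit _))).
by rewrite (compA (fmor _ (lunit _))) ften_lunit lunit_nat compA idem_kar_in.
Qed.

Lemma kar_ften_runit X :
  kar_fmor (kar_runit X) \oc kar_ften X (kar_one E)
    \oc (idm (kar_image X) \om kar_fone) = runit (kar_image X).
Proof.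
apply: kar_in_mono.
rewrite !compA kar_fmorE -(compA _ (kar_in _)) kar_ftenE -!compA -tensm_comp.
rewrite kar_foneE compm1 /= fmor_comp -{1}[fone T]compm1 -{1}[kar_in X]comp1m.
rewrite tensm_comp -compA (compA (ften _ _ _)) (compA (fmor _ (runit _))).
by rewrite (compA (fmor _ (runit _))) ften_runit runit_nat compA idem_kar_in.
Qed.

Definition kar_functor : tensfunctor (karoubi E) D :=
  @TensFunctor F (karoubi E) D kar_linfunctor kar_ften kar_fone kar_ften_iso
    kar_fone_iso kar_ften_nat kar_ften_assoc kar_ften_lunit kar_ften_runit.

Lemma karoubi_equivalence :
  full T -> faithful T -> essentially_surjective T -> tens_equivalent (karoubi E) D.
Proof.
move=> Tfull Tff Tsurj; exists kar_functor; apply: equivalence_of_full_faithful.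
(* The preimage [f] under [T] of [h], transported to the ambient objects, is automatically
   compatible with the idempotents, since [T] is faithful and the equations hold after [T]. *)
- move=> X Y h; have [f fE] := Tfull _ _ (kar_in Y \oc h \oc kar_pr X).
  have fP : f \in kar_sub X Y.
    apply: kar_subI; apply: (faithful_inj Tff); rewrite fmor_comp fE.
      by rewrite !compA idem_kar_in.
    by rewrite -!compA kar_pr_idem.
  exists (Subvs fP); apply: kar_in_mono.
  by rewrite kar_fmorE /= fE -compA kar_prK compm1.
- move=> X Y f f0; apply/val_inj/Tff => /=.
  (* Since [f = f e], the morphism [T f] factors as [kar_in], [kar_fmor f], [kar_pr], and the middle
     factor is zero. *)
  rewrite -kar_morr fmor_comp -kar_inK compA -kar_fmorE.
  by rewrite [kar_fmor f]f0 compm0 comp0m.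
- move=> V; have [X [u [v [vu uv]]]] := Tsurj V.
  exists (KarObj (comp1m (idm X))).
  set X1 := KarObj _; have X1i : kar_in X1 \oc kar_pr X1 = idm (T X).
    by rewrite kar_inK fmor1.
  exists (u \oc kar_in X1), (kar_pr X1 \oc v); split.
    by rewrite -compA (compA v) vu comp1m kar_prK.
  by rewrite -compA (compA (kar_in X1)) X1i comp1m.
Qed.

End KaroubiExtension.

(** * Graded vector spaces *)

Section FiniteDirectSums.
Variables (F : fieldType) (C : lincat F).
Implicit Types X Y Z : C.

Lemma fin_direct_sum (A : finType) (S : A -> C) X
    (i : forall a, mor (S a) X) (p : forall a, mor X (S a)) :
    (forall a, p a \oc i a = idm (S a)) -> (forall a b, a != b -> p b \oc i a = 0) ->
    \sum_a (i a \oc p a) = idm X ->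
  direct_sum (fun j : 'I_#|A| => S (enum_val j)) X.
Proof.
move=> pi pi0 ip; exists (fun j => i (enum_val j)), (fun j => p (enum_val j)).
split=> // [j k jk|]; first by apply: pi0; apply: contraNneq jk => /enum_val_inj->.
by rewrite -ip (reindex _ (onW_bij _ (enum_val_bij A))).
Qed.

Lemma binary_direct_sum X Y Z (i : mor X Z) (p : mor Z X) (j : mor Y Z) (q : mor Z Y) :
    p \oc i = idm X -> q \oc j = idm Y -> q \oc i = 0 -> p \oc j = 0 ->
    (i \oc p) + (j \oc q) = idm Z ->
  direct_sum (fun a : 'I_2 => if a == 0 then X else Y) Z.
Proof.
move=> pi qj qi pj ijpq.
pose S b := if b then X else Y.
pose I b : mor (S b) Z := if b as b' return mor (S b') Z then i else j.
pose P b : mor Z (S b) := if b as b' return mor Z (S b') then p else q.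
exists (fun a => I (a == 0)), (fun a => P (a == 0)).
split=> [a|a b|]; last by rewrite big_ord_recl big_ord1.
  by rewrite /I /P; case: (a == 0).
by case: a b => [[|[|a]] aP] [[|[|b]] bP].
Qed.

End FiniteDirectSums.

Section ProjectorGrading.
Variables (gT : finGroupType) (F : fieldType) (V : vectType F) (q : gT -> 'End(V)).
Hypotheses (qq : forall g h v, q g (q h v) = if g == h then q h v else 0)
  (q1 : forall v, \sum_g q g v = v).

(** Gradings are built from complete families of orthogonal projectors, because such a family,
    unlike a family of subspaces, is carried along directly by scalar extension. *)
Lemma proj_grading_homog g h v : v \in limg (q h) -> q g v = if g == h then v else 0.
Proof. by move=> /memv_imgP[u _ ->]; rewrite qq. Qed.

Definition proj_grading : gspace gT F :=
  GSpace (grading_direct proj_grading_homog)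
         (grading_full (fun g v => memv_img (q g) (memvf v)) q1).

Lemma proj_gradingP g v : v \in gcomp proj_grading g <-> q g v = v.
Proof.
split=> [/proj_grading_homog->|<-]; first by rewrite eqxx.
by rewrite memv_img ?memvf.
Qed.

End ProjectorGrading.

Section GradedSpaces.
Variables (gT : finGroupType) (F : fieldType).
Implicit Types X Y Z : gspace gT F.

Lemma gmor_proj X Y (f : gmor X Y) g v :
  gproj Y g (vsval f v) = vsval f (gproj X g v).
Proof.
rewrite -[in LHS](gproj_sum v) linear_sum.
by apply: (@gproj_uniq _ _ Y (fun h => vsval f (gproj X h v))) => h; apply/gmor_comp/memv_gproj.
Qed.

Lemma gcompE X Y Z (g : gmor Y Z) (f : gmor X Y) v :
  vsval (@comp F (gvect_lincat gT F) X Y Z g f) v = vsval g (vsval f v).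
Proof. exact: comp_lfunE. Qed.

Lemma gidE X v : vsval (@idm F (gvect_lincat gT F) X) v = v.
Proof. exact: id_lfunE. Qed.

Lemma gmorZ X Y (f : gmor X Y) a v : vsval f (a *: v) = a *: vsval f v.
Proof. exact: linearZ. Qed.

Lemma gmorD X Y (f : gmor X Y) u v : vsval f (u + v) = vsval f u + vsval f v.
Proof. exact: linearD. Qed.

Lemma gmor0 X Y (f : gmor X Y) : vsval f 0 = 0.
Proof. exact: linear0. Qed.

Lemma gmor_sum X Y (f : gmor X Y) I (r : seq I) (P : pred I) v :
  vsval f (\sum_(i <- r | P i) v i) = \sum_(i <- r | P i) vsval f (v i).
Proof. exact: linear_sum. Qed.

Lemma linfun_linE (U V : vectType F) (f : U -> V) (fL : linear f) v :
  linfun (to_linear fL) v = f v.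
Proof. by rewrite lfunE. Qed.

(** A homogeneous basis together with its dual coordinate functionals. The index type is an
    arbitrary finite type, so that direct sums and tensor products are indexed by [A + A'] and
    [A * A'] without renumbering. *)
Record hbasis X (A : finType) (d : A -> gT) := HBasis {
  hb_vec :> A -> gcar X;
  hb_coord : A -> gcar X -> F^o;
  hb_mem : forall a, hb_vec a \in gcomp X (d a);
  hb_lin : forall a, linear (hb_coord a);
  hb_sum : forall x, \sum_a hb_coord a x *: hb_vec a = x;
  hb_coordE : forall a b, hb_coord a (hb_vec b) = (a == b)%:R }.

Section HomogeneousBasis.
Variables (X : gspace gT F) (A : finType) (d : A -> gT) (B : hbasis X d).

Lemma hb_coord0 a : hb_coord B a 0 = 0.
Proof. exact: (lin0 (@hb_lin _ _ _ B a)). Qed.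

Lemma hb_coord_sum (c : A -> F) a : hb_coord B a (\sum_b c b *: B b) = c a.
Proof.
rewrite (lin_sum (@hb_lin _ _ _ B a)) (bigD1 a) //= big1 ?addr0 => [|b ba].
  by rewrite (linZ (@hb_lin _ _ _ B a)) hb_coordE eqxx [_ *: _]mulr1.
by rewrite (linZ (@hb_lin _ _ _ B a)) hb_coordE eq_sym (negPf ba) scaler0.
Qed.

Lemma hb_homP Y (f f' : gmor X Y) : (forall a, vsval f (B a) = vsval f' (B a)) -> f = f'.
Proof.
move=> ff'; apply/val_inj/lfunP=> v; rewrite -(hb_sum B v) !linear_sum.
by apply: eq_bigr => a _; rewrite !linearZ /= ff'.
Qed.

Lemma hb_coord_proj a g v :
  hb_coord B a (gproj X g v) = if d a == g then hb_coord B a v else 0.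
Proof.
pose c := linfun (to_linear (@hb_lin _ _ _ B a)).
have cE u : hb_coord B a u = c u by rewrite linfun_linE.
rewrite !cE -{1}(hb_sum B v) !linear_sum (bigD1 a) //= big1 ?addr0 => [|b ba].
  rewrite !linearZ /= (gproj_homog _ (hb_mem B a)) eq_sym; case: eqP => _.
    by rewrite -[in RHS](hb_sum B v) -!cE hb_coordE eqxx hb_sum [_ *: _]mulr1.
  by rewrite linear0 scaler0.
rewrite !linearZ /= (gproj_homog _ (hb_mem B b)); case: eqP => _.
  by rewrite -cE hb_coordE eq_sym (negPf ba) scaler0.
by rewrite linear0 scaler0.
Qed.

Lemma hb_homog_ind g (P : gcar X -> Prop) :
    (forall a, d a = g -> P (B a)) -> (forall a x y, P x -> P y -> P (a *: x + y)) ->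
    P 0 ->
  forall x, x \in gcomp X g -> P x.
Proof.
move=> Pb Plin P0 x xP; rewrite -(hb_sum B x).
elim/big_ind: _ => // [u v Pu Pv|a _]; first by rewrite -[u]scale1r; apply: Plin.
have := hb_coord_proj a g x; rewrite (gproj_homog _ xP) eqxx; case: eqP => [da _|_ ->].
  by rewrite -[_ *: _]addr0; apply: Plin => //; apply: Pb.
by rewrite scale0r.
Qed.

Section Extension.
Variables (Y : gspace gT F) (y : A -> gcar Y).

Lemma hb_hom_lin : linear (fun x => \sum_a hb_coord B a x *: y a).
Proof.
move=> c u v; rewrite scaler_sumr -big_split; apply: eq_bigr => a _ /=.
by rewrite (hb_lin B) scalerDl scalerA.
Qed.

Lemma hb_hom_funE a : linfun (to_linear hb_hom_lin) (B a) = y a.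
Proof.
rewrite linfun_linE (bigD1 a) //= big1 ?addr0 => [|b ba].
  by rewrite hb_coordE eqxx scale1r.
by rewrite hb_coordE (negPf ba) scale0r.
Qed.

Hypothesis yP : forall a, y a \in gcomp Y (d a).

Lemma hb_hom_sub : linfun (to_linear hb_hom_lin) \in gsub X Y.
Proof.
apply/gsubP=> g v vP; rewrite linfun_linE; apply: memv_suml => a _.
have := hb_coord_proj a g v; rewrite (gproj_homog _ vP) eqxx.
by case: eqP => [<- _|_ ->]; rewrite ?scale0r ?mem0v ?memvZ.
Qed.

Lemma hb_hom_exists : exists f : gmor X Y, forall a, vsval f (B a) = y a.
Proof. by exists (Subvs hb_hom_sub) => a; apply: hb_hom_funE. Qed.

Definition hb_hom : gmor X Y := sval (cid hb_hom_exists).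

Lemma hb_homE a : vsval hb_hom (B a) = y a.
Proof. by rewrite /hb_hom; case: cid => f /=. Qed.

End Extension.
End HomogeneousBasis.

Arguments hb_homP {X A d} B {Y f f'}.

Section FreeSpaces.
Variables (A : finType) (d : A -> gT).

Let fcar : vectType F := {ffun A -> F^o}.

Lemma free_proj_lin g :
  linear (fun t : fcar => [ffun a => if d a == g then t a else 0] : fcar).
Proof.
move=> c t u; apply/ffunP=> a; rewrite !ffunE.
by case: ifP => // _; rewrite scaler0 addr0.
Qed.

Let fproj g : 'End(fcar) := linfun (to_linear (free_proj_lin g)).

Lemma fproj_idem g h t : fproj g (fproj h t) = if g == h then fproj h t else 0.
Proof.
rewrite !linfun_linE; apply/ffunP=> a; rewrite !ffunE.
have [->|gh] := eqVneq g h; rewrite ?ffunE; case: eqP => // ->.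
by rewrite (negPf gh).
Qed.

Lemma fproj_sum t : \sum_g fproj g t = t.
Proof.
apply/ffunP=> a; rewrite sum_ffunE (bigD1 (d a)) //= big1 ?addr0 => [|g gda].
  by rewrite linfun_linE ffunE eqxx.
by rewrite linfun_linE ffunE eq_sym (negPf gda).
Qed.

Definition free_gspace : gspace gT F := proj_grading fproj_idem fproj_sum.

Lemma free_hbasis : hbasis free_gspace d.
Proof.
pose e a : fcar := [ffun b => (b == a)%:R].
apply: (@HBasis free_gspace A d e (fun a (t : fcar) => t a)) => [a|a|t|a b].
- apply/proj_gradingP; rewrite linfun_linE; apply/ffunP=> b; rewrite !ffunE.
  by case: (eqVneq b a) => [->|_]; rewrite ?eqxx ?if_same.
- by move=> c t u; rewrite !ffunE.
- apply/ffunP=> a; rewrite sum_ffunE (bigD1 a) //= big1 ?addr0 => [|b ba].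
    by rewrite !ffunE eqxx [_ *: _]mulr1.
  by rewrite !ffunE eq_sym (negPf ba) scaler0.
- by rewrite ffunE.
Qed.

End FreeSpaces.

Lemma hbasis_iso X Y (A : finType) (d : A -> gT) (B : hbasis X d) (B' : hbasis Y d) :
  @isomorphic F (gvect_lincat gT F) X Y.
Proof.
exists (hb_hom B (hb_mem B')), (hb_hom B' (hb_mem B)).
split; first by apply: (hb_homP B) => a; rewrite gcompE gidE !hb_homE.
by apply: (hb_homP B') => a; rewrite gcompE gidE !hb_homE.
Qed.

(** An idempotent is split degree by degree: bases of the spaces [e (X_g)], indexed jointly by the
    dependent sum over [g], form a homogeneous basis of its image. Taking [e] to be the identity
    yields a homogeneous basis of any graded space. *)
Lemma idem_free_split X (e : gmor X X) : @comp F (gvect_lincat gT F) _ _ _ e e = e ->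
  exists (A : finType) (d : A -> gT)
    (i : @mor F (gvect_lincat gT F) (free_gspace d) X)
    (p : @mor F (gvect_lincat gT F) X (free_gspace d)),
    p \oc i = idm _ /\ i \oc p = e.
Proof.
move=> ee; have eeE v : vsval e (vsval e v) = vsval e v.
  by rewrite -gcompE ee.
pose W g := (vsval e @: gcomp X g)%VS.
pose A : finType := {g : gT & 'I_(\dim (W g))}.
pose d (a : A) := tag a; pose x (a : A) := (vbasis (W (tag a)))`_(tagged a).
have xW a : x a \in W (d a) by apply: vbasis_mem; rewrite mem_nth ?size_tuple.
have xP a : x a \in gcomp X (d a).
  by have /memv_imgP[u uP ->] := xW a; apply: gmor_comp.
have ex a : vsval e (x a) = x a by have /memv_imgP[u _ ->] := xW a.
pose i := hb_hom (free_hbasis d) xP.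
pose pf (v : gcar X) : gcar (free_gspace d) :=
  \sum_a (coord (vbasis (W (tag a))) (tagged a) (vsval e (gproj X (tag a) v)) *:
    free_hbasis d a).
have pL : linear pf.
  move=> c u v; rewrite scaler_sumr -big_split; apply: eq_bigr => a _ /=.
  by rewrite !linearP /= scalerDl scalerA.
have pP : linfun (to_linear pL) \in gsub X (free_gspace d).
  apply/gsubP=> g v vP; rewrite linfun_linE; apply: memv_suml => a _.
  rewrite (gproj_homog _ vP); case: (eqVneq (tag a) g) => [<-|_].
    by apply/memvZ/hb_mem.
  by rewrite !linear0 scale0r mem0v.
pose p : gmor X (free_gspace d) := Subvs pP.
have pE v : vsval p v = pf v by exact: linfun_linE.
exists A, d, i, p; split.
  apply: (hb_homP (free_hbasis d)) => a; rewrite gcompE gidE hb_homE.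
  rewrite pE /pf (bigD1 a) //= big1 ?addr0 => [|b ba].
    rewrite (gproj_homog _ (xP a)) eqxx ex coord_free ?(basis_free (vbasisP _)) //.
    by rewrite eqxx scale1r.
  rewrite (gproj_homog _ (xP a)); case: eqP => [dba|_]; last first.
    by rewrite !linear0 scale0r.
  (* Once the pairs are opened, the equality of degrees can be substituted, and only then do both
     basis indices lie in the same ordinal type. *)
  rewrite ex /x; case: a b dba ba {xW xP ex i pP p pE} => g j [h k] /= hg; subst h => kj.
  rewrite coord_free ?(basis_free (vbasisP _)) //; have [kjE|_] := eqVneq k j.
    by rewrite kjE eqxx in kj.
  by rewrite scale0r.
apply/val_inj/lfunP=> v; rewrite gcompE pE /pf gmor_sum -[in RHS](gproj_sum v) gmor_sum.
rewrite (eq_bigr (fun a : A => coord (vbasis (W (tag a))) (tagged a)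
  (vsval e (gproj X (tag a) v)) *: x a))  => [|a _]; last by rewrite gmorZ hb_homE.
(* The sum over the dependent pairs becomes a double sum, whose inner sum is the expansion of
   [e (v_g)] in the basis of [e (X_g)]. *)
rewrite -(sig_big_dep xpredT (fun _ _ => true)
  (fun g j => coord (vbasis (W g)) j (vsval e (gproj X g v)) *: (vbasis (W g))`_j)) /=.
apply: eq_bigr => g _.
by rewrite -coord_vbasis // memv_img ?memv_gproj.
Qed.

End GradedSpaces.

Arguments hb_homP {gT F X A d} B {Y f f'}.
Arguments hb_homog_ind {gT F X A d} B {g} P.
Arguments free_gspace {gT} F {A} d.
Arguments free_hbasis {gT} F {A} d.

(** * Graded spaces as a semisimple abelian category; bases of tensor products *)

Section GradedFusion.
Variables (gT : finGroupType) (F : fieldType).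
Implicit Types X Y Z : gspace gT F.
Local Notation gvect := (gvect_lincat gT F).

Lemma gvect_idem_complete : idem_complete gvect.
Proof.
move=> X e ee; have [A [d [i [p [pi ip]]]]] := idem_free_split ee.
by exists (free_gspace F d), i, p.
Qed.

Lemma hbasis_iso_trans X Y (A : finType) (d : A -> gT) :
  @isomorphic F gvect X Y -> hbasis X d -> inhabited (hbasis Y d).
Proof.
move=> [f [g [gf fg]]] B.
have gfE v : vsval g (vsval f v) = v by rewrite -gcompE gf gidE.
have fgE v : vsval f (vsval g v) = v by rewrite -gcompE fg gidE.
apply: inhabits; apply: (@HBasis _ _ Y A d (fun a => vsval f (B a))
  (fun a y => hb_coord B a (vsval g y))) => [a|a|y|a b].
- exact/gmor_comp/hb_mem.
- by move=> c u v; rewrite gmorD gmorZ hb_lin.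
- rewrite -[RHS]fgE -[in RHS](hb_sum B (vsval g y)) gmor_sum.
  by apply: eq_bigr => a _; rewrite gmorZ.
- by rewrite gfE hb_coordE.
Qed.

Lemma hbasis_exists X : exists (A : finType) (d : A -> gT), inhabited (hbasis X d).
Proof.
have [|A [d [i [p [pi ip]]]]] := @idem_free_split _ _ X (gid X); first exact: (@comp1m F gvect).
exists A, d; apply: hbasis_iso_trans (free_hbasis F d).
by exists i, p.
Qed.

(* The degree-preserving part of a linear pseudo-inverse is still a pseudo-inverse. *)
Lemma gvect_regular : regular_cat gvect.
Proof.
move=> X Y f; have gP : gdiag_fun ((vsval f)^-1)%VF \in gsub Y X.
  by apply/gsubP=> g v vP; rewrite (gdiagE _ vP) memv_gproj.
exists (Subvs gP); apply: ghomP => g v vP; rewrite !gcompE.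
rewrite [vsval (Subvs gP) _](gdiagE _ (gmor_comp f vP)) -gmor_proj.
by rewrite limg_lfunVK ?memv_img ?memvf // (gproj_homog _ (gmor_comp f vP)) eqxx.
Qed.

Definition simple_gspace (g : gT) : gspace gT F := free_gspace F (fun _ : unit => g).
Definition simple_hbasis g : hbasis (simple_gspace g) (fun _ : unit => g) :=
  free_hbasis F (fun _ : unit => g).

Lemma hbasis1_scalar X (d : unit -> gT) (B : hbasis X d) : @scalar_end F gvect X.
Proof.
apply: scalar_endI => [|f].
  apply/eqP=> /(congr1 (fun f : gmor X X => hb_coord B tt (vsval f (B tt)))).
  by rewrite gidE hb_coordE zero_lfunE hb_coord0 => /eqP; rewrite oner_eq0.
exists (hb_coord B tt (vsval f (B tt))); apply: (hb_homP B) => -[].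
by rewrite /= scale_lfunE id_lfunE -[LHS](hb_sum B) (bigD1 tt) //= big1 ?addr0 // => -[].
Qed.

Lemma simple_gspace_scalar g : @scalar_end F gvect (simple_gspace g).
Proof. exact: hbasis1_scalar (simple_hbasis g). Qed.

Lemma gvect_generated X : exists n (S : 'I_n -> gT),
  @direct_sum F gvect n (fun a => simple_gspace (S a)) X.
Proof.
have [A [d [B]]] := hbasis_exists X.
exists #|A|, (fun j => d (enum_val j)).
pose i a : gmor (simple_gspace (d a)) X := hb_hom (simple_hbasis (d a)) (fun _ => hb_mem B a).
pose e a b : gcar (simple_gspace (d a)) := if a == b then simple_hbasis (d a) tt else 0.
have eP a b : e a b \in gcomp (simple_gspace (d a)) (d b).
  by rewrite /e; case: eqP => [<-|_]; rewrite ?mem0v // (hb_mem (simple_hbasis _)).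
pose p a : gmor X (simple_gspace (d a)) := hb_hom B (eP a).
have iE a u : vsval (i a) (simple_hbasis (d a) u) = B a by rewrite hb_homE.
have pE a b : vsval (p a) (B b) = e a b by rewrite hb_homE.
apply: (@fin_direct_sum F gvect A (fun a => simple_gspace (d a)) X i p) => [a|a b ab|].
- apply: (hb_homP (simple_hbasis (d a))) => -[].
  by rewrite gcompE gidE iE pE /e eqxx.
- apply: (hb_homP (simple_hbasis (d a))) => u.
  by rewrite gcompE iE pE /e eq_sym (negPf ab) zero_lfunE.
- apply: (hb_homP B) => b; rewrite gidE raddf_sum sum_lfunE (bigD1 b) //= big1 ?addr0.
    by rewrite comp_lfunE pE /e eqxx iE.
  by move=> a ab; rewrite comp_lfunE pE /e (negPf ab) linear0.
Qed.

Lemma gvect_zero : exists Z : gvect, zero_obj Z.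
Proof.
exists (free_gspace F (fun a : void => of_void gT a)); apply/zero_objP.
by apply: (hb_homP (free_hbasis F (fun a : void => of_void gT a))) => -[].
Qed.

Lemma gvect_binary_sum (X Y : gvect) :
  exists Z, direct_sum (fun a : 'I_2 => if a == 0 then X else Y) Z.
Proof.
have [A [d [B]]] := hbasis_exists X; have [A' [d' [B']]] := hbasis_exists Y.
pose dd (s : A + A') := match s with inl a => d a | inr a => d' a end.
pose Z := free_gspace F dd; pose C := free_hbasis F dd.
pose i : gmor X Z := hb_hom B (fun a => hb_mem C (inl a)).
pose j : gmor Y Z := hb_hom B' (fun a => hb_mem C (inr a)).
pose x (s : A + A') : gcar X := if s is inl a then B a else 0.
pose y (s : A + A') : gcar Y := if s is inr a then B' a else 0.
have xP s : x s \in gcomp X (dd s) by case: s => a; rewrite ?mem0v ?(hb_mem B).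
have yP s : y s \in gcomp Y (dd s) by case: s => a; rewrite ?mem0v ?(hb_mem B').
pose p : gmor Z X := hb_hom C xP; pose q : gmor Z Y := hb_hom C yP.
have iE a : vsval i (B a) = C (inl a) by rewrite hb_homE.
have jE a : vsval j (B' a) = C (inr a) by rewrite hb_homE.
have pE s : vsval p (C s) = x s by rewrite hb_homE.
have qE s : vsval q (C s) = y s by rewrite hb_homE.
exists Z; apply: (@binary_direct_sum F gvect X Y Z i p j q).
- by apply: (hb_homP B) => a; rewrite gcompE gidE iE pE.
- by apply: (hb_homP B') => a; rewrite gcompE gidE jE qE.
- by apply: (hb_homP B) => a; rewrite gcompE iE qE zero_lfunE.
- by apply: (hb_homP B') => a; rewrite gcompE jE pE zero_lfunE.
- apply: (hb_homP C) => -[a|a]; rewrite gidE /= add_lfunE !comp_lfunE pE qE /=.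
    by rewrite iE linear0 addr0.
  by rewrite jE linear0 add0r.
Qed.

Section MatrixUnits.
Variables (X Y : gspace gT F) (A A' : finType) (d : A -> gT) (d' : A' -> gT).
Variables (B : hbasis X d) (B' : hbasis Y d').

Lemma matrix_unit_mem a b a' :
  (if (a' == a) && (d' b == d a) then B' b else 0) \in gcomp Y (d a').
Proof.
case: (eqVneq a' a) => [->|_]; last by rewrite mem0v.
by case: eqP => [<-|_]; rewrite ?mem0v ?hb_mem.
Qed.

(** Defined for all pairs of indices, and zero when the degrees differ. The matrix entry of a graded
    morphism vanishes there as well, so the usual expansion in matrix units remains valid. *)
Definition matrix_unit a b : gmor X Y := hb_hom B (matrix_unit_mem a b).

Lemma hb_coord_gmor (f : gmor X Y) a b :
  d' b != d a -> hb_coord B' b (vsval f (B a)) = 0.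
Proof.
move=> bNa; have := hb_coord_proj B' b (d a) (vsval f (B a)).
by rewrite (negPf bNa) (gproj_homog _ (gmor_comp f (hb_mem B a))) eqxx.
Qed.

Lemma matrix_unit_decomp (f : gmor X Y) :
  f = \sum_a \sum_b hb_coord B' b (vsval f (B a)) *: matrix_unit a b.
Proof.
apply: (hb_homP B) => a; rewrite raddf_sum sum_lfunE (big_only1 a) // => [|a' a'a _].
  rewrite raddf_sum sum_lfunE -[LHS](hb_sum B'); apply: eq_bigr => b _.
  rewrite /= scale_lfunE hb_homE eqxx /=; case: eqP => // /eqP ba.
  by rewrite hb_coord_gmor ?scale0r.
rewrite raddf_sum sum_lfunE big1 // => b _.
by rewrite /= scale_lfunE hb_homE eq_sym (negPf a'a) scaler0.
Qed.

End MatrixUnits.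

Section TensorBasis.
Variables (X Y : gspace gT F) (A A' : finType) (d : A -> gT) (d' : A' -> gT).
Variables (B : hbasis X d) (B' : hbasis Y d').

Lemma hb_tens_bilin ab :
  bilin (fun x y => hb_coord B ab.1 x * hb_coord B' ab.2 y : F^o).
Proof.
split=> [y|x] c u v; rewrite hb_lin; first by rewrite mulrDl -mulrA.
by rewrite mulrDr mulrCA.
Qed.

(** Kept transparent, so that its basis vectors reduce to pure tensors by conversion. *)
Definition hb_tens : hbasis (gtens X Y) (fun ab : A * A' => (d ab.1 * d' ab.2)%g).
Proof.
apply: (@HBasis _ _ (gtens X Y) _ _ (fun ab => ten (B ab.1) (B' ab.2))
  (fun ab => tlift (fun x y => hb_coord B ab.1 x * hb_coord B' ab.2 y : F^o)))
  => [ab|ab|t|ab ab'].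
- by apply: memv_gtens; apply: hb_mem.
- exact: lfunL.
- elim/ten_ind: t => [x y|c t u IHt IHu].
    rewrite -[in RHS](hb_sum B x) -[in RHS](hb_sum B' y) (lin_sum (@ten_linl _ _ _ _)).
    rewrite -(pair_bigA _ (fun a b => tlift (fun x y => hb_coord B a x * hb_coord B' b y : F^o)
       (ten x y) *: ten (B a) (B' b))) /=; apply: eq_bigr => a _.
    rewrite (linZ (@ten_linl _ _ _ _)) (lin_sum (@ten_linr _ _ _ _)) scaler_sumr.
    apply: eq_bigr => b _; rewrite (tliftE _ _ (hb_tens_bilin (a, b))).
    by rewrite (linZ (@ten_linr _ _ _ _)) scalerA.
  rewrite -[in RHS]IHt -[in RHS]IHu scaler_sumr -big_split; apply: eq_bigr => ab _.
  by rewrite lfunL scalerDl scalerA.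
- rewrite (tliftE _ _ (hb_tens_bilin ab)) !hb_coordE -natrM mulnb.
  by case: ab ab' => a b [a' b'].
Defined.

Lemma hb_tensE ab : hb_tens ab = ten (B ab.1) (B' ab.2). Proof. by []. Qed.

End TensorBasis.

Definition hb_one : hbasis (gone gT F) (fun _ : unit => 1%g).
Proof.
apply: (@HBasis _ _ (gone gT F) _ _ (fun _ => 1) (fun _ x => x)) => [_|_|x|[] []] //.
- exact: gone1.
- by rewrite (bigD1 tt) //= big1 ?addr0 => [|[]] //; rewrite [_ *: _]mulr1.
Defined.

End GradedFusion.

(** * Fusion structure of [Vec] *)

Section TwistedFusion.
Variables (gT : finGroupType) (F : fieldType) (w : gT -> gT -> gT -> F).
Hypotheses (wP : cocycle3 w) (wN : normalized3 w).
Local Notation VecG := (Vec wP wN).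
Implicit Types X Y Z : VecG.

Lemma vcompE X Y Z (g : mor Y Z) (f : mor X Y) v : vsval (g \oc f) v = vsval g (vsval f v).
Proof. exact: gcompE. Qed.

Lemma vidE X v : vsval (idm X) v = v.
Proof. exact: gidE. Qed.

Lemma vtensmE X X' Y Y' (f : mor X X') (g : mor Y Y') u v :
  vsval (f \om g) (ten u v) = ten (vsval f u) (vsval g v).
Proof. exact: tmapE. Qed.

Lemma vassocE X Y Z g h k u v z :
    u \in gcomp X g -> v \in gcomp Y h -> z \in gcomp Z k ->
  vsval (assoc X Y Z) (ten (ten u v) z) = w g h k *: ten u (ten v z).
Proof. exact: gassocE. Qed.

Lemma vlunitE X a v : vsval (lunit X) (ten a v) = (a : F) *: v.
Proof. exact: tlunitE. Qed.

Lemma vrunitE X a v : vsval (runit X) (ten v a) = (a : F) *: v.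
Proof. exact: trunitE. Qed.

Lemma vcomp_tensl X Y Z U V x y z u v a b
    (n : mor (X \ox Y) U) (m : mor (U \ox Z) V) :
    vsval n (ten x y) = a *: u -> vsval m (ten u z) = b *: v ->
  vsval (m \oc (n \om idm Z)) (ten (ten x y) z) = (a * b) *: v.
Proof.
move=> nE mE.
by rewrite vcompE vtensmE nE vidE (linZ (@ten_linl _ _ _ _)) gmorZ mE scalerA.
Qed.

Lemma vcomp_tensr X Y Z U V g h k x y z u v a b
    (n : mor (Y \ox Z) U) (m : mor (X \ox U) V) :
    x \in gcomp X g -> y \in gcomp Y h -> z \in gcomp Z k ->
    vsval n (ten y z) = a *: u -> vsval m (ten x u) = b *: v ->
  vsval (m \oc (idm X \om n) \oc assoc X Y Z) (ten (ten x y) z) = (w g h k * a * b) *: v.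
Proof.
move=> xP yP zP nE mE; rewrite !vcompE (vassocE xP yP zP) !gmorZ vtensmE nE vidE.
by rewrite (linZ (@ten_linr _ _ _ _)) gmorZ mE !scalerA.
Qed.

(** This is the cocycle identity at [(g^-1, g, g^-1, g)]: the other three factors have an argument 1
    and equal 1 by normalization. *)
Lemma cocycle3_inv g : w g g^-1 g * w g^-1 g g^-1 = 1.
Proof.
have [_ /(_ g^-1 g g^-1 g)%g] := wP; rewrite mulVg mulgV.
have [_ -> _] := wN g^-1%g g; have [-> _ _] := wN g^-1%g g.
by have [_ _ ->] := wN g^-1%g g; rewrite !mulr1.
Qed.

Section Dual.
Variables (X Y : VecG) (A : finType) (d : A -> gT).
Variables (B : hbasis X d) (B' : hbasis Y (fun a => (d a)^-1)%g).

Lemma hb_dual : exists ev coev, @dual_pair F VecG Y X ev coev.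
Proof.
have [w0 _] := wP.
(* In the first zig-zag the associator contributes [w (d a) (d a)^-1 (d a)], which [kap a] cancels
   inside the evaluation. In the second, the inverse associator contributes the inverse of
   [w (d a)^-1 (d a) (d a)^-1], and [cocycle3_inv] makes the product 1. *)
pose kap a := (w (d a) (d a)^-1 (d a))^-1.
pose e ab : gcar (gone gT F) := if ab.1 == ab.2 :> A then kap ab.1 else 0.
have eP ab : e ab \in gcomp (gone gT F) ((d ab.1)^-1 * d ab.2)%g.
  rewrite /e; case: eqP => [->|_]; last exact: mem0v.
  by rewrite mulVg /= /gone_comp eqxx memvf.
pose ev : @mor F VecG (Y \ox X) (one VecG) := hb_hom (hb_tens B' B) eP.
have evE a b : vsval ev (ten (B' a) (B b)) = if a == b then kap a else 0.
  by rewrite -(hb_tensE B' B (a, b)) hb_homE.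
pose c (_ : unit) : gcar (gtens X Y) := \sum_a ten (B a) (B' a).
have cP u : c u \in gcomp (gtens X Y) 1%g.
  by apply: memv_suml => a _; rewrite -(mulgV (d a)); apply: memv_gtens; apply: hb_mem.
pose coev : @mor F VecG (one VecG) (X \ox Y) := hb_hom (hb_one gT F) cP.
have coevE : vsval coev (1 : F^o) = \sum_a ten (B a) (B' a).
  exact: (hb_homE (hb_one gT F) cP tt).
have [b [ba ab]] := assoc_iso Y X Y.
have bE g h k (u v z : gcar _) : u \in gcomp Y g -> v \in gcomp X h -> z \in gcomp Y k ->
    vsval b (ten u (ten v z)) = (w g h k)^-1 *: ten (ten u v) z.
  move=> uP vP zP; have := congr1 (fun f : gmor (Y \ox X \ox Y) (Y \ox X \ox Y) =>
    vsval f (ten (ten u v) z)) ba.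
  by rewrite vcompE vidE (vassocE uP vP zP) gmorZ => <-; rewrite scalerA mulVf ?scale1r.
exists ev, coev; split; last exists b => //.
- apply: (hb_homP (hb_tens (hb_one gT F) B)) => -[u a].
  rewrite hb_tensE !vcompE vtensmE coevE vidE (lin_sum (@ten_linl _ _ _ _)) !gmor_sum.
  rewrite (big_only1 a) // => [|a' a'a _].
    rewrite (vassocE (hb_mem B a) (hb_mem B' a) (hb_mem B a)) !gmorZ vtensmE vidE evE.
    by rewrite eqxx vrunitE vlunitE scalerA divff ?w0 //=.
  rewrite (vassocE (hb_mem B a') (hb_mem B' a') (hb_mem B a)) !gmorZ vtensmE vidE evE.
  by rewrite (negPf a'a) vrunitE scale0r scaler0.
- apply: (hb_homP (hb_tens B' (hb_one gT F))) => -[a u].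
  rewrite hb_tensE !vcompE vtensmE coevE vidE (lin_sum (@ten_linr _ _ _ _)) !gmor_sum.
  rewrite (big_only1 a) // => [|a' a'a _].
    rewrite (bE _ _ _ _ _ _ (hb_mem B' a) (hb_mem B a) (hb_mem B' a)) !gmorZ vtensmE.
    rewrite vidE evE eqxx vrunitE vlunitE scalerA -invfM mulrC cocycle3_inv.
    by rewrite invr1.
  rewrite (bE _ _ _ _ _ _ (hb_mem B' a) (hb_mem B a') (hb_mem B' a')) !gmorZ vtensmE.
  by rewrite vidE evE eq_sym (negPf a'a) vlunitE scale0r scaler0.
Qed.

End Dual.

Lemma Vec_rigid : rigid VecG.
Proof.
move=> X; have [A [d [B]]] := hbasis_exists X.
(* The same object serves on both sides: inverting its degrees returns [d], so [hb_dual] applies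
   with the two roles exchanged. *)
pose d' a := (d a)^-1%g; have d'K : (fun a => (d' a)^-1)%g = d.
  by apply/funext=> a; rewrite invgK.
split; exists (free_gspace F d'); first exact: hb_dual B (free_hbasis F d').
by apply: (hb_dual (free_hbasis F d')); rewrite d'K.
Qed.

Lemma Vec_split_fusion : split_fusion VecG.
Proof.
have reg := @gvect_regular gT F; have gen := @gvect_generated gT F.
have sc := @simple_gspace_scalar gT F; pose S := @simple_gspace gT F.
split; last by move=> X; apply: (@generated_split F (gvect_lincat gT F) gT S gen sc).
have fin := @generated_finitely_many_simples F (gvect_lincat gT F) gT S gen sc.
split; [split | exact: fin | exact: Vec_rigid |].
- apply: regular_abelian => //; first exact: gvect_idem_complete.
    exact: gvect_zero.
  exact: gvect_binary_sum.
- exact: (@generated_semisimple F (gvect_lincat gT F) reg gT S gen sc).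
- exact: hbasis1_scalar (hb_one gT F).
Qed.

End TwistedFusion.

(** * Scalar extension of graded spaces *)

Section ScalarExtensionOfSpaces.
Variables (K : fieldType) (L : fieldExtType K).

Section SemilinearLift.
Variables (V : vectType K) (W : vectType L) (phi : V -> W).
Hypothesis phiL : forall a u v, phi (a *: u + v) = a%:A *: phi u + phi v.

(** The universal property of scalar extension: [phi] extends to an [L]-linear map, uniquely by
    [ext_homP]. As [W] carries only its [L]-structure, [K]-linearity of [phi] is phrased through
    [a%:A]. *)
Definition semilift (x : ext L V) : W := \sum_i x 0 i *: phi (vbasis fullv)`_i.

Lemma semilift_lin : linear semilift.
Proof.
move=> a x y; rewrite /semilift scaler_sumr -big_split; apply: eq_bigr => i _ /=.
by rewrite !mxE scalerDl scalerA.
Qed.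

Lemma semiliftE v : semilift (ext_in L v) = phi v.
Proof.
have phi0 : phi 0 = 0.
  by have := phiL (-1) 0 0; rewrite scaler0 addr0 scaleN1r scaleNr scale1r addNr.
have phiD u v' : phi (u + v') = phi u + phi v'.
  by have := phiL 1 u v'; rewrite !scale1r.
have phiZ a u : phi (a *: u) = a%:A *: phi u.
  by have := phiL a u 0; rewrite phi0 !addr0.
rewrite /semilift [v in RHS]vcoordK (big_morph phi phiD phi0).
by apply: eq_bigr => i _; rewrite phiZ !mxE.
Qed.

Lemma semilift_exists :
  exists f : 'Hom(ext L V, W), forall v, f (ext_in L v) = phi v.
Proof. by exists (linfun (to_linear semilift_lin)) => v; rewrite linfun_linE semiliftE. Qed.

End SemilinearLift.

Lemma ext_homP (V : vectType K) (W : vectType L) (f g : 'Hom(ext L V, W)) :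
  (forall v, f (ext_in L v) = g (ext_in L v)) -> f = g.
Proof.
move=> fg; apply/lfunP=> x; elim/ext_ind: x => [v|a x y IHx IHy] //.
by rewrite !lfunL IHx IHy.
Qed.

Lemma ext_map_exists (U V : vectType K) (f : 'Hom(U, V)) :
  exists h : 'Hom(ext L U, ext L V), forall u, h (ext_in L u) = ext_in L (f u).
Proof. by apply: semilift_exists => a u v; rewrite lfunL ext_in_is_lin. Qed.

Definition ext_map (U V : vectType K) (f : 'Hom(U, V)) : 'Hom(ext L U, ext L V) :=
  sval (cid (ext_map_exists f)).

Lemma ext_mapE (U V : vectType K) (f : 'Hom(U, V)) u :
  ext_map f (ext_in L u) = ext_in L (f u).
Proof. by rewrite /ext_map; case: cid. Qed.

Lemma ext_in_inj (V : vectType K) : injective (@ext_in K L V).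
Proof.
move=> u v /rowP uv; rewrite [u]vcoordK [v]vcoordK; apply: eq_bigr => i _.
have := uv i; rewrite !mxE => /eqP; rewrite -subr_eq0 -scalerBl scaler_eq0 oner_eq0 orbF.
by rewrite subr_eq0 => /eqP->.
Qed.

Section ExtendedGrading.
Variable gT : finGroupType.
Implicit Types X Y Z : gspace gT K.

Lemma ext_proj_idem X g h (x : ext L (gcar X)) :
  ext_map (gproj X g) (ext_map (gproj X h) x) =
  if g == h then ext_map (gproj X h) x else 0.
Proof.
elim/ext_ind: x => [u|a x y IHx IHy]; last first.
  by rewrite !lfunL IHx IHy; case: eqP => // _; rewrite scaler0 addr0.
rewrite !ext_mapE (gproj_homog _ (memv_gproj h u)).
by case: eqP => // _; rewrite ext_in0.
Qed.

Lemma ext_proj_sum X (x : ext L (gcar X)) : \sum_g ext_map (gproj X g) x = x.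
Proof.
elim/ext_ind: x => [u|a x y IHx IHy].
  by under eq_bigr do rewrite ext_mapE; rewrite -ext_in_sum gproj_sum.
rewrite -[in RHS]IHx -[in RHS]IHy scaler_sumr -big_split.
by apply: eq_bigr => g _; rewrite lfunL.
Qed.

Definition ext_gspace X : gspace gT L :=
  proj_grading (@ext_proj_idem X) (@ext_proj_sum X).

Lemma memv_ext_in X g u : u \in gcomp X g -> ext_in L u \in gcomp (ext_gspace X) g.
Proof.
by move=> uP; apply/proj_gradingP; rewrite ext_mapE (gproj_homog _ uP) eqxx.
Qed.

Lemma hb_ext_exists X (A : finType) (d : A -> gT) (B : hbasis X d) :
  exists B' : hbasis (ext_gspace X) d, forall a, B' a = ext_in L (B a).
Proof.
have /choice[c cE] : forall a, exists f : 'Hom(ext L (gcar X), L^o),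
    forall u, f (ext_in L u) = (hb_coord B a u)%:A.
  move=> a; apply: semilift_exists => k u v; rewrite hb_lin.
  by rewrite scalerDl -scalerA -mulr_algl.
unshelve eexists.
  apply: (@HBasis _ _ (ext_gspace X) A d (fun a => ext_in L (B a)) c) => [a|a|x|a b].
  - exact/memv_ext_in/hb_mem.
  - exact: lfunL.
  - elim/ext_ind: x => [u|k x y IHx IHy].
      rewrite -[in RHS](hb_sum B u) ext_in_sum; apply: eq_bigr => a _.
      by rewrite cE ext_inZ.
    rewrite -[in RHS]IHx -[in RHS]IHy scaler_sumr -big_split; apply: eq_bigr => a _ /=.
    by rewrite lfunL scalerDl scalerA.
  - by rewrite cE hb_coordE; case: (a == b); rewrite ?scale1r ?scale0r.
by [].
Qed.

Definition hb_ext X (A : finType) (d : A -> gT) (B : hbasis X d) :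
  hbasis (ext_gspace X) d := sval (cid (hb_ext_exists B)).

Lemma hb_extE X (A : finType) (d : A -> gT) (B : hbasis X d) a :
  hb_ext B a = ext_in L (B a).
Proof. by rewrite /hb_ext; case: cid. Qed.

(** The canonical map from the extension of a morphism space to the morphisms of the extended
    spaces. The universal property is used twice: for each single [f], and then for the dependence
    on [f]. *)
Lemma ext_gmor_exists X Y : exists T : ext L (gmor X Y) -> gmor (ext_gspace X) (ext_gspace Y),
  linear T /\ forall f u, vsval (T (ext_in L f)) (ext_in L u) = ext_in L (vsval f u).
Proof.
have /choice[T0 T0E] : forall f : gmor X Y, exists h : gmor (ext_gspace X) (ext_gspace Y),
    forall u, vsval h (ext_in L u) = ext_in L (vsval f u).
  move=> f; have fP : ext_map (vsval f) \in gsub (ext_gspace X) (ext_gspace Y).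
    apply/gsubP=> g x /proj_gradingP <-; elim/ext_ind: x => [u|a x y IHx IHy].
      by rewrite !ext_mapE; apply/memv_ext_in/gmor_comp/memv_gproj.
    by rewrite !lfunL memvD ?memvZ.
  by exists (Subvs fP) => u; apply: ext_mapE.
have [|T TE] := @semilift_exists (gmor X Y) _ T0.
  move=> a f g; apply/val_inj/ext_homP => u.
  by rewrite /= add_lfunE scale_lfunE !T0E /= add_lfunE scale_lfunE ext_in_is_lin.
by exists T; split=> [|f u]; [apply: lfunL | rewrite TE].
Qed.

Definition ext_gmor X Y : ext L (gmor X Y) -> gmor (ext_gspace X) (ext_gspace Y) :=
  sval (cid (ext_gmor_exists X Y)).

Lemma ext_gmor_lin X Y : linear (@ext_gmor X Y).
Proof. by rewrite /ext_gmor; case: cid => T []. Qed.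

Lemma ext_gmorE X Y (f : gmor X Y) u :
  vsval (ext_gmor (ext_in L f)) (ext_in L u) = ext_in L (vsval f u).
Proof. by rewrite /ext_gmor; case: cid => T []. Qed.

End ExtendedGrading.
End ScalarExtensionOfSpaces.

(** * The tensor functor from the extended category over [K] to [Vec] over [L] *)

Section ExtensionFunctor.
Variables (K : fieldType) (L : fieldExtType K) (gT : finGroupType).
Variables (w0 : gT -> gT -> gT -> K) (w : gT -> gT -> gT -> L) (m : gT -> gT -> L).
Hypotheses (w0P : cocycle3 w0) (w0N : normalized3 w0).
Hypotheses (wP : cocycle3 w) (wN : normalized3 w).
Hypotheses (m0 : forall g h, m g h != 0)
  (wm : forall g h k, (w0 g h k)%:A = w g h k * coboundary m g h k).
Local Notation E := (ext_cat L (Vec w0P w0N)).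
Local Notation D := (Vec wP wN).
Implicit Types X Y Z : gspace gT K.

Lemma ext_gmor1 X : ext_gmor (ext_in L (gid X)) = gid (ext_gspace L X).
Proof. by apply/val_inj/ext_homP => u; rewrite ext_gmorE !id_lfunE. Qed.

Lemma ext_gmor_comp X Y Z (g : @mor L E Y Z) (f : @mor L E X Y) :
  ext_gmor (g \oc f) = gcomp_mor (ext_gmor g) (ext_gmor f).
Proof.
elim/ext_ind: g => [g|a g g' IH IH']; last first.
  by rewrite comp_linl !ext_gmor_lin IH IH' gcomp_linl.
elim/ext_ind: f => [f|a f f' IH IH']; last first.
  by rewrite comp_linr !ext_gmor_lin IH IH' gcomp_linr.
rewrite [X in ext_gmor X]ext_compE.
by apply/val_inj/ext_homP => u; rewrite comp_lfunE !ext_gmorE comp_lfunE.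
Qed.

Definition ext_linfunctor : linfunctor E D :=
  @LinFunctor L E D (@ext_gspace K L gT) (@ext_gmor K L gT) ext_gmor1 ext_gmor_comp
    (@ext_gmor_lin K L gT).

(** The matrix entries of [ext_gmor f] recover [f], which gives faithfulness. Fullness uses the same
    expression with the entries of an arbitrary graded morphism as coefficients. *)
Lemma ext_gmor_decomp X Y (A A' : finType) (d : A -> gT) (d' : A' -> gT)
    (B : hbasis X d) (B' : hbasis Y d') (f : ext L (gmor X Y)) :
  f = \sum_a \sum_b hb_coord (hb_ext L B') b (vsval (ext_gmor f) (hb_ext L B a)) *:
        ext_in L (matrix_unit B B' a b).
Proof.
elim/ext_ind: f => [f|c f f' IH IH'].
  rewrite [in LHS](matrix_unit_decomp B B' f) ext_in_sum; apply: eq_bigr => a _.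
  rewrite ext_in_sum; apply: eq_bigr => b _; rewrite hb_extE ext_gmorE ext_inZ.
  congr (_ *: _).
  rewrite -[in RHS](hb_sum B' (vsval f (B a))) ext_in_sum.
  rewrite (_ : \sum_(i <- _ | _) _ = \sum_i (hb_coord B' i (vsval f (B a)))%:A *: hb_ext L B' i).
    by rewrite hb_coord_sum.
  by apply: eq_bigr => i _; rewrite ext_inZ hb_extE.
rewrite [in LHS]IH [in LHS]IH' scaler_sumr -big_split; apply: eq_bigr => a _ /=.
rewrite scaler_sumr -big_split; apply: eq_bigr => b _ /=.
by rewrite ext_gmor_lin /= add_lfunE scale_lfunE hb_lin scalerDl scalerA.
Qed.

Lemma ext_faithful : faithful ext_linfunctor.
Proof.
move=> X Y f f0; have [A [d [B]]] := hbasis_exists X; have [A' [d' [B']]] := hbasis_exists Y.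
rewrite (ext_gmor_decomp B B' f) big1 // => a _; rewrite big1 // => b _.
by rewrite [ext_gmor f]f0 zero_lfunE hb_coord0 scale0r.
Qed.

Lemma ext_full : full ext_linfunctor.
Proof.
move=> X Y h; have [A [d [B]]] := hbasis_exists X; have [A' [d' [B']]] := hbasis_exists Y.
pose c a b := hb_coord (hb_ext L B') b (vsval h (hb_ext L B a)).
exists (\sum_a \sum_b c a b *: ext_in L (matrix_unit B B' a b)).
apply: (hb_homP (hb_ext L B)) => a.
rewrite fmor_sum raddf_sum sum_lfunE (big_only1 a) // => [|a' a'a _];
  rewrite fmor_sum raddf_sum sum_lfunE.
  rewrite -[RHS](hb_sum (hb_ext L B')); apply: eq_bigr => b _.
  rewrite fmorZ /= scale_lfunE /= hb_extE ext_gmorE hb_homE eqxx /=.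
  case: eqP => [_|/eqP ba]; first by rewrite /c !hb_extE.
  rewrite ext_in0 scaler0 -(hb_extE L B a).
  by rewrite (hb_coord_gmor (hb_ext L B) (hb_ext L B') h ba) scale0r.
rewrite big1 // => b _; rewrite fmorZ /= scale_lfunE /= hb_extE ext_gmorE hb_homE.
by rewrite eq_sym (negPf a'a) ext_in0 scaler0.
Qed.

Lemma ext_surj : essentially_surjective ext_linfunctor.
Proof.
move=> V; have [A [d [B]]] := hbasis_exists V; exists (free_gspace K d).
exact: hbasis_iso (hb_ext L (free_hbasis K d)) B.
Qed.

(** The map is prescribed on a basis of pure tensors. Since the factor [m] depends only on degrees,
    the formula extends bilinearly to all homogeneous vectors and does not depend on the basis. *)
Lemma ext_ften_exists X Y :
  exists J : gmor (gtens (ext_gspace L X) (ext_gspace L Y)) (ext_gspace L (gtens X Y)),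
    forall g h u v, u \in gcomp X g -> v \in gcomp Y h ->
    vsval J (ten (ext_in L u) (ext_in L v)) = m g h *: ext_in L (ten u v).
Proof.
have [A [d [B]]] := hbasis_exists X; have [A' [d' [B']]] := hbasis_exists Y.
pose C := hb_tens (hb_ext L B) (hb_ext L B').
pose y ab := m (d ab.1) (d' ab.2) *: hb_ext L (hb_tens B B') ab.
have yP ab : y ab \in gcomp (ext_gspace L (gtens X Y)) (d ab.1 * d' ab.2)%g.
  exact/memvZ/hb_mem.
exists (hb_hom C yP) => g h u v uP vP; move: u uP.
apply: (hb_homog_ind B) => [a <-|a x x' IHx IHx'|]; last first.
- by rewrite !ext_in0 !ten0l ext_in0 gmor0 scaler0.
- rewrite ext_in_is_lin !ten_linl ext_in_is_lin gmorD gmorZ IHx IHx'.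
  by rewrite scalerDr !scalerA mulrC.
move: v vP; apply: (hb_homog_ind B') => [b <-|b x x' IHx IHx'|]; last first.
- by rewrite !ext_in0 !ten0r ext_in0 gmor0 scaler0.
- rewrite ext_in_is_lin !ten_linr ext_in_is_lin gmorD gmorZ IHx IHx'.
  by rewrite scalerDr !scalerA mulrC.
have := hb_homE C yP (a, b).
by rewrite hb_tensE /y /= !hb_extE hb_tensE.
Qed.

Local Notation T := ext_linfunctor.

Lemma ext_fmorE (X Y : E) (f : gmor X Y) u :
  vsval (fmor T (ext_in L f)) (ext_in L u) = ext_in L (vsval f u).
Proof. exact: ext_gmorE. Qed.

Definition ext_ften (X Y : E) : @mor L D (T X \ox T Y) (T (X \ox Y)) :=
  sval (cid (ext_ften_exists X Y)).

Lemma ext_ftenE X Y g h u v : u \in gcomp X g -> v \in gcomp Y h ->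
  vsval (ext_ften X Y) (ten (ext_in L u) (ext_in L v)) = m g h *: ext_in L (ten u v).
Proof. by rewrite /ext_ften; case: cid => J JE; apply: JE. Qed.

Lemma ext_ften_iso (X Y : E) : is_iso (ext_ften X Y).
Proof.
have [A [d [B]]] := hbasis_exists X; have [A' [d' [B']]] := hbasis_exists Y.
pose C := hb_tens (hb_ext L B) (hb_ext L B'); pose C' := hb_ext L (hb_tens B B').
pose y ab := (m (d ab.1) (d' ab.2))^-1 *: C ab.
have yP ab : y ab \in gcomp (gtens (ext_gspace L X) (ext_gspace L Y)) (d ab.1 * d' ab.2)%g.
  exact/memvZ/hb_mem.
have JE ab : vsval (ext_ften X Y) (C ab) = m (d ab.1) (d' ab.2) *: C' ab.
  by rewrite hb_tensE !hb_extE (ext_ftenE (hb_mem B _) (hb_mem B' _)) hb_tensE.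
exists (hb_hom C' yP); split.
  apply: (hb_homP C) => ab; rewrite vcompE vidE JE gmorZ hb_homE scalerA.
  by rewrite divff ?scale1r.
apply: (hb_homP C') => ab; rewrite vcompE vidE hb_homE gmorZ JE scalerA.
by rewrite mulVf ?scale1r.
Qed.

Lemma ext_ften_nat (X X' Y Y' : E) (f : mor X X') (g : mor Y Y') :
  ext_ften X' Y' \oc (fmor T f \om fmor T g) = fmor T (f \om g) \oc ext_ften X Y.
Proof.
elim/ext_ind: f => [f|a f f' IH IH']; last first.
  by rewrite fmor_lin !tensm_linl fmor_lin comp_linr comp_linl IH IH'.
elim/ext_ind: g => [g|a g g' IH IH']; last first.
  by rewrite fmor_lin !tensm_linr fmor_lin comp_linr comp_linl IH IH'.
have [A [d [B]]] := hbasis_exists X; have [A' [d' [B']]] := hbasis_exists Y.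
apply: (hb_homP (hb_tens (hb_ext L B) (hb_ext L B'))) => -[a b].
rewrite hb_tensE !hb_extE !vcompE vtensmE !ext_fmorE.
rewrite (ext_ftenE (gmor_comp f (hb_mem B a)) (gmor_comp g (hb_mem B' b))).
rewrite (ext_ftenE (hb_mem B a) (hb_mem B' b)) gmorZ.
rewrite (_ : @tensm L E _ _ _ _ (ext_in L f) (ext_in L g) =
  ext_in L (@tensm K (Vec w0P w0N) _ _ _ _ f g)); last exact: ext_tensmE.
rewrite ext_fmorE.
by rewrite vtensmE.
Qed.

(** On homogeneous vectors of degrees [g, h, k] the two sides carry the factors
    [w0 g h k * m (g h) k * m g h] and [w g h k * m h k * m g (h k)]; their equality is exactly the
    relation [wm]. *)
Lemma ext_ften_assoc (X Y Z : E) :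
  fmor T (assoc X Y Z) \oc ext_ften (X \ox Y) Z \oc (ext_ften X Y \om idm (T Z)) =
  ext_ften X (Y \ox Z) \oc (idm (T X) \om ext_ften Y Z) \oc assoc (T X) (T Y) (T Z).
Proof.
have [A [d [B]]] := hbasis_exists X; have [A' [d' [B']]] := hbasis_exists Y.
have [A'' [d'' [B'']]] := hbasis_exists Z.
apply: (hb_homP (hb_tens (hb_tens (hb_ext L B) (hb_ext L B')) (hb_ext L B''))).
move=> [[a b] c]; rewrite !hb_tensE !hb_extE !vcompE vtensmE vidE.
have aP := hb_mem B a; have bP := hb_mem B' b; have cP := hb_mem B'' c.
have abP : ten (B a) (B' b) \in gcomp (gtens X Y) (d a * d' b)%g := memv_gtens aP bP.
have bcP : ten (B' b) (B'' c) \in gcomp (gtens Y Z) (d' b * d'' c)%g := memv_gtens bP cP.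
rewrite (ext_ftenE aP bP) (linZ (@ten_linl _ _ _ _)) gmorZ.
rewrite (ext_ftenE abP cP) !gmorZ ext_fmorE (vassocE aP bP cP) ext_inZ.
rewrite (vassocE (memv_ext_in L aP) (memv_ext_in L bP) (memv_ext_in L cP)) gmorZ vtensmE vidE.
rewrite (ext_ftenE bP cP) (linZ (@ten_linr _ _ _ _)) !gmorZ (ext_ftenE aP bcP).
rewrite !scalerA wm /coboundary; congr (_ *: _); field.
by rewrite !m0.
Qed.

(** Both cocycles are 1 at [(g, 1, h)], and there the coboundary is [m 1 h / m g 1]. All these
    values thus equal [m 1 1], so one rescaling of the unit, by its inverse, satisfies both unit
    axioms. *)
Lemma m_unit g h : m 1%g h = m g 1%g.
Proof.
have := wm g 1%g h; have [_ -> _] := w0N g h; have [_ -> _] := wN g h.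
rewrite /coboundary mul1g mulg1 scale1r mul1r => /esym/eqP.
rewrite -subr_eq0 => /eqP mE; apply/eqP; rewrite -subr_eq0; apply/eqP.
rewrite -[RHS](mul0r (m g 1%g)) -mE; field; by rewrite !m0.
Qed.

Lemma ext_fone_exists : exists f : gmor (gone gT L) (ext_gspace L (gone gT K)),
  vsval f (1 : L^o) = (m 1%g 1%g)^-1 *: ext_in L (1 : K^o).
Proof.
pose C := hb_ext L (hb_one gT K).
have yP u : (m 1%g 1%g)^-1 *: C u \in gcomp (ext_gspace L (gone gT K)) 1%g.
  exact/memvZ/hb_mem.
exists (hb_hom (hb_one gT L) yP); have := hb_homE (hb_one gT L) yP tt.
by rewrite hb_extE.
Qed.

Definition ext_fone : @mor L D (one D) (T (one E)) :=
  sval (cid ext_fone_exists).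

Lemma ext_foneE : vsval ext_fone (1 : L^o) = (m 1%g 1%g)^-1 *: ext_in L (1 : K^o).
Proof. by rewrite /ext_fone; case: cid. Qed.

Lemma ext_fone_iso : is_iso ext_fone.
Proof.
pose B := hb_one gT L; pose C := hb_ext L (hb_one gT K).
have yP u : m 1%g 1%g *: B u \in gcomp (gone gT L) 1%g by apply/memvZ/hb_mem.
exists (hb_hom C yP); split.
  apply: (hb_homP B) => u; rewrite vcompE vidE.
  have -> : vsval ext_fone (B u) = (m 1%g 1%g)^-1 *: C u by rewrite hb_extE -ext_foneE.
  by rewrite gmorZ hb_homE scalerA mulVf ?scale1r.
apply: (hb_homP C) => u; rewrite vcompE vidE hb_homE gmorZ.
have -> : vsval ext_fone (B u) = (m 1%g 1%g)^-1 *: C u by rewrite hb_extE -ext_foneE.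
by rewrite scalerA divff ?scale1r.
Qed.

Lemma ext_ften_lunit (X : E) :
  fmor T (lunit X) \oc ext_ften (one E) X \oc (ext_fone \om idm (T X)) = lunit (T X).
Proof.
have [A [d [B]]] := hbasis_exists X.
apply: (hb_homP (hb_tens (hb_one gT L) (hb_ext L B))) => -[u a].
rewrite hb_tensE !vcompE vtensmE vidE ext_foneE (linZ (@ten_linl _ _ _ _)) !gmorZ.
have oneP : (1 : K^o) \in gcomp (gone gT K) 1%g := gone1 gT K.
rewrite hb_extE (ext_ftenE oneP (hb_mem B a)) gmorZ ext_fmorE !vlunitE.
by rewrite scalerA (m_unit 1) mulVf ?m0 // !scale1r.
Qed.

Lemma ext_ften_runit (X : E) :
  fmor T (runit X) \oc ext_ften X (one E) \oc (idm (T X) \om ext_fone) = runit (T X).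
Proof.
have [A [d [B]]] := hbasis_exists X.
apply: (hb_homP (hb_tens (hb_ext L B) (hb_one gT L))) => -[a u].
rewrite hb_tensE !vcompE vtensmE vidE ext_foneE (linZ (@ten_linr _ _ _ _)) !gmorZ.
have oneP : (1 : K^o) \in gcomp (gone gT K) 1%g := gone1 gT K.
rewrite hb_extE (ext_ftenE (hb_mem B a) oneP) gmorZ ext_fmorE !vrunitE.
by rewrite scalerA -(m_unit _ 1) mulVf ?m0 // !scale1r.
Qed.

Definition ext_functor : tensfunctor E D :=
  @TensFunctor L E D ext_linfunctor ext_ften ext_fone ext_ften_iso ext_fone_iso
    ext_ften_nat ext_ften_assoc ext_ften_lunit ext_ften_runit.

Lemma Vec_scalar_extension : tens_equivalent (scalar_extension L (Vec w0P w0N)) D.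
Proof.
apply: (@karoubi_equivalence L E D ext_functor); first exact: gvect_idem_complete.
- exact: ext_full.
- exact: ext_faithful.
- exact: ext_surj.
Qed.

End ExtensionFunctor.

(** * Cocycles and split forms *)

Section CocycleNormalization.
Variables (gT : finGroupType) (F : fieldType).
Implicit Types w : gT -> gT -> gT -> F.

Lemma cocycle3_cohomologous w w' : cocycle3 w -> cohomologous w w' -> cocycle3 w'.
Proof.
move=> [w0 wP] [m m0 wm]; split=> [g h k|g h k l].
  by rewrite wm /coboundary !(mulf_eq0, invr_eq0) !negb_or w0 !m0.
have cP : coboundary m h k l * coboundary m g (h * k)%g l * coboundary m g h k =
    coboundary m (g * h)%g k l * coboundary m g h (k * l)%g.
  by rewrite /coboundary !mulgA; field; rewrite !m0.
rewrite !wm -[RHS]mulrACA -wP -cP; ring.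
Qed.

(* The cocycle identity expresses [w g 1 l], [w 1 k l] and [w g h 1] through [w _ 1 1] and
   [w 1 1 _], which forces the values of [m] at [(g, 1)] and [(1, h)]. *)
Lemma cocycle3_normalize w : cocycle3 w ->
  exists w', [/\ cocycle3 w', normalized3 w' & cohomologous w w'].
Proof.
move=> wC; have [w0 wP] := wC.
pose m g h := if h == 1%g then w g 1%g 1%g else if g == 1%g then (w 1%g 1%g h)^-1 else 1.
have m0 g h : m g h != 0 by rewrite /m; do 2?case: ifP => _; rewrite ?invr_eq0 ?oner_neq0.
pose w' g h k := w g h k * coboundary m g h k.
have ww' : cohomologous w w' by exists m.
exists w'; split=> //; first exact: cocycle3_cohomologous ww'.
have wmid g l : w g 1%g l = w g 1%g 1%g * w 1%g 1%g l.
  have := wP g 1%g 1%g l; rewrite !mulg1 !mul1g => E.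
  by apply: (mulfI (w0 g 1%g l)); rewrite -E; ring.
have wleft k l : w 1%g 1%g (k * l)%g = w 1%g k l * w 1%g 1%g k.
  have := wP 1%g 1%g k l; rewrite !mul1g => E.
  by apply: (mulfI (w0 1%g k l)); rewrite -E; ring.
have wright g h : w (g * h)%g 1%g 1%g = w h 1%g 1%g * w g h 1%g.
  have := wP g h 1%g 1%g; rewrite !mulg1 => E.
  by apply: (mulfI (w0 g h 1%g)); rewrite mulrC -E; ring.
have w1 : w 1%g 1%g 1%g = 1.
  by apply: (mulfI (w0 1%g 1%g 1%g)); rewrite mulr1 -wmid.
have m1l l : m 1%g l = (w 1%g 1%g l)^-1.
  by rewrite /m; case: eqP => [->|_]; rewrite ?eqxx ?w1 ?invr1.
have mr1 g : m g 1%g = w g 1%g 1%g by rewrite /m eqxx.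
move=> g h; rewrite /w' /coboundary !mul1g !mulg1 !m1l !mr1; split.
- by rewrite wleft; field; rewrite !w0 !m0.
- by rewrite wmid; field; rewrite !w0 !m0.
- by rewrite wright; field; rewrite !w0 !m0.
Qed.

End CocycleNormalization.

(** At a coordinate where [v] does not vanish, [c] is a quotient of two elements of [K]. Through
    this lemma the associativity factor descends to [K]. *)
Lemma ext_in_scalar (K : fieldType) (L : fieldExtType K) (V : vectType K) (u v : V) (c : L) :
  v != 0 -> ext_in L u = c *: ext_in L v -> exists k : K, c = k%:A.
Proof.
move=> v0 /rowP uv.
have [i vi] : exists i, coord (vbasis fullv) i v != 0.
  apply/existsP; apply: contraNT v0 => /existsPn v0.
  by rewrite [v]vcoordK big1 // => i _; move: (v0 i); rewrite negbK => /eqP->; rewrite scale0r.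
exists (coord (vbasis fullv) i u / coord (vbasis fullv) i v).
have := uv i; rewrite !mxE => uvi.
have vA : (coord (vbasis fullv) i v)%:A != 0 :> L by rewrite scaler_eq0 oner_eq0 orbF.
apply: (mulIf vA); rewrite -uvi mulr_algl scalerA.
by rewrite divfK.
Qed.

(** * From a split form to a cocycle over the base field *)

Section FormToCocycle.
Variables (K : fieldType) (L : fieldExtType K) (gT : finGroupType).
Variables (w : gT -> gT -> gT -> L) (wP : cocycle3 w) (wN : normalized3 w).
Variable CK : moncat K.
Local Notation E := (ext_cat L CK).
Local Notation KE := (karoubi E).
Local Notation D := (Vec wP wN).
Variable T : tensfunctor KE D.
Hypotheses (Tfull : full T) (Tfaithful : faithful T) (Tsurj : essentially_surjective T).
Hypotheses (CKss : semisimple CK)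
  (CKsplit : forall X : CK, simple_obj X -> scalar_end X).
Local Notation delta g := (simple_gspace L g : D).
Local Notation eps g := (simple_hbasis L g tt).

Definition kar_of (X : CK) : KE := KarObj (comp1m (idm (X : E))).

Lemma kar_lift_sub (A B : kar_obj E) (f : mor (kar_src A) (kar_src B)) :
  kar_idem B \oc f \oc kar_idem A \in kar_sub A B.
Proof. by apply: kar_subI; rewrite -?compA ?kar_idemP // !compA kar_idemP. Qed.

Definition kar_lift (A B : KE) (f : @mor L E (kar_src A) (kar_src B)) : mor A B :=
  Subvs (kar_lift_sub f).

Lemma kar_liftE (A B : KE) (f : @mor L E (kar_src A) (kar_src B)) :
  vsval (kar_lift f) = kar_idem B \oc f \oc kar_idem A.
Proof. by []. Qed.

Lemma kar_compE (A B C : KE) (g : mor B C) (f : mor A B) :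
  vsval (g \oc f) = vsval g \oc vsval f.
Proof. by []. Qed.

Lemma kar_assocE (X Y Z : CK) :
  vsval (assoc (kar_of X) (kar_of Y) (kar_of Z)) = ext_in L (assoc X Y Z).
Proof.
rewrite -[RHS](comp1m (ext_in L (assoc X Y Z) : @mor L E _ _)).
by congr (_ \oc _); rewrite /= !ext_tensmE !tensm1.
Qed.

Lemma ext_comp_tensl (X Y Z V W : CK) (m : mor (V \ox Z) W) (n : mor (X \ox Y) V) m' n' :
  m' = ext_in L m -> n' = ext_in L n ->
  ext_comp m' (ext_tensm n' (ext_in L (idm Z))) = ext_in L (m \oc (n \om idm Z)).
Proof. by move=> -> ->; rewrite ext_tensmE ext_compE. Qed.

Lemma ext_comp_tensr (X Y Z V W U : CK) (m : mor (X \ox V) W) (n : mor (Y \ox Z) V)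
    (a : mor U (X \ox (Y \ox Z))) m' n' a' :
  m' = ext_in L m -> n' = ext_in L n -> a' = ext_in L a ->
  ext_comp (ext_comp m' (ext_tensm (ext_in L (idm X)) n')) a' =
  ext_in L (m \oc (idm X \om n) \oc a).
Proof. by move=> -> -> ->; rewrite ext_tensmE !ext_compE. Qed.

Lemma kar_of_scalar (X : CK) : scalar_end X ->
  forall f : mor (kar_of X) (kar_of X), exists c : L, f = c *: idm _.
Proof.
move=> Xs f.
have [c cE] : exists c : L, vsval f = c *: idm (X : E).
  elim/ext_ind: (vsval f) => [h|a x y [c ->] [c' ->]].
    by have [a [-> _]] := Xs h; exists a%:A; rewrite ext_inZ.
  by exists (a * c + c'); rewrite scalerDl scalerA.
by exists c; apply: val_inj; rewrite /= cE.
Qed.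

(** A preimage [Z] of [delta g] is only known up to an idempotent over [L], so its underlying object
    of [CK] is decomposed instead. The identity of [delta g] becomes a sum of composites through the
    simple summands, and one of these composites is a nonzero scalar. *)
Lemma simple_preimage g : exists X : CK, isomorphic (T (kar_of X)) (delta g).
Proof.
have [Z [u [v [vu uv]]]] := Tsurj (delta g).
have [n [S [Ss [i [p [pi pi0 ip]]]]]] := CKss (kar_src Z).
pose a j : mor (T (kar_of (S j))) (delta g) :=
  u \oc fmor T (@kar_lift (kar_of (S j)) Z (ext_in L (i j))).
pose b j : mor (delta g) (T (kar_of (S j))) :=
  fmor T (@kar_lift Z (kar_of (S j)) (ext_in L (p j))) \oc v.
have liftE j : vsval (@kar_lift (kar_of (S j)) Z (ext_in L (i j)) \oc
      @kar_lift Z (kar_of (S j)) (ext_in L (p j))) =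
    kar_idem Z \oc (ext_in L (i j \oc p j) : @mor L E _ _) \oc kar_idem Z.
  rewrite -[ext_in L (i j \oc p j)]ext_compE kar_compE !kar_liftE.
  by rewrite (comp1m (ext_in L (p j) : @mor L E _ _)) compm1 !compA.
have sum1 : \sum_j (a j \oc b j) = idm (delta g).
  transitivity (u \oc fmor T (idm Z) \oc v); last by rewrite fmor1 compm1.
  have -> : idm Z = \sum_j ((@kar_lift (kar_of (S j)) Z (ext_in L (i j))) \oc
      (@kar_lift Z (kar_of (S j)) (ext_in L (p j)))).
    apply: val_inj; rewrite [RHS]raddf_sum (eq_bigr _ (fun j _ => liftE j)).
    rewrite -comp_suml -comp_sumr -ext_in_sum ip.
    by rewrite [X in X \oc _](@compm1 L E) kar_idemP.
  rewrite fmor_sum comp_sumr comp_suml; apply: eq_bigr => j _.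
  by rewrite /a /b fmor_comp !compA.
have [j abj] : exists j, a j \oc b j != 0.
  apply/existsP; apply: contraT => /existsPn ab0.
  have := scalar_end_neq0 (@simple_gspace_scalar _ L g); rewrite -sum1 big1 ?eqxx // => j _.
  by apply/eqP; rewrite -[_ == _]negbK ab0.
have [c [abE _]] := @simple_gspace_scalar gT L g (a j \oc b j).
have [f fE] := Tfull (b j \oc a j).
have [c' fE'] := kar_of_scalar (CKsplit (Ss j)) f.
have baE : b j \oc a j = c' *: idm _ by rewrite -fE fE' fmorZ fmor1.
(* Both composites are scalars, and evaluating [a j \oc b j \oc a j] in two ways gives
   [c *: a j = c' *: a j] with [a j] nonzero. Hence [c^-1 *: b j] is inverse to [a j] on both
   sides. *)
have cc' : c = c'.
  apply/eqP; rewrite -subr_eq0; have : (c - c') *: a j == 0.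
    rewrite scalerBl -[X in c *: X]comp1m -[X in _ - c' *: X]compm1 -compZm -compmZ.
    by rewrite -abE -baE compA subrr.
  rewrite scaler_eq0 => /orP[//|/eqP a0].
  by rewrite a0 comp0m eqxx in abj.
have c0 : c != 0 by apply: contraNneq abj => c0; rewrite abE c0 scale0r.
exists (S j), (a j), (c^-1 *: b j); split.
  by rewrite compZm baE -cc' scalerA mulVf // scale1r.
by rewrite compmZ abE scalerA mulVf // scale1r.
Qed.

Definition simple_lift g : CK := sval (cid (simple_preimage g)).
Local Notation Xs := simple_lift.

Lemma simple_lift_iso g :
  exists uv : mor (T (kar_of (Xs g))) (delta g) * mor (delta g) (T (kar_of (Xs g))),
  uv.2 \oc uv.1 = idm _ /\ uv.1 \oc uv.2 = idm _.
Proof.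
have [u [v [vu uv]]] : isomorphic (T (kar_of (Xs g))) (delta g).
  by rewrite /simple_lift; case: cid.
by exists (u, v).
Qed.

Definition to_delta g : mor (T (kar_of (Xs g))) (delta g) := (sval (cid (simple_lift_iso g))).1.
Definition of_delta g : mor (delta g) (T (kar_of (Xs g))) := (sval (cid (simple_lift_iso g))).2.

Lemma to_deltaK g : of_delta g \oc to_delta g = idm _.
Proof. by rewrite /of_delta /to_delta; case: cid => uv []. Qed.

Lemma of_deltaK g : to_delta g \oc of_delta g = idm _.
Proof. by rewrite /of_delta /to_delta; case: cid => uv []. Qed.

Lemma of_delta_iso g : is_iso (of_delta g).
Proof. by exists (to_delta g); split; [apply: of_deltaK | apply: to_deltaK]. Qed.

Lemma delta_tens_mem (g h : gT) : eps (g * h)%g \in gcomp (simple_gspace L (g * h)%g) (g * h)%g.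
Proof. exact: (hb_mem (simple_hbasis L (g * h)%g) tt). Qed.

(** The canonical map of [delta g \ox delta h], transported through [T], lies in the extension of a
    morphism space of [CK]. It is nonzero, so that space is nonzero; the transported map itself is
    not claimed to be defined over [K]. *)
Lemma simple_product_exists g h : exists m : mor (Xs g \ox Xs h) (Xs (g * h)%g), m != 0.
Proof.
pose C := hb_tens (simple_hbasis L g) (simple_hbasis L h).
pose can : @mor L D (delta g \ox delta h) (delta (g * h)%g) :=
  hb_hom C (fun _ => delta_tens_mem g h).
have can0 : can != 0.
  apply/eqP => /(congr1 (fun f : gmor (gtens (simple_gspace L g) (simple_gspace L h)) _ =>
    hb_coord (simple_hbasis L (g * h)%g) tt (vsval f (C (tt, tt))))).
  by rewrite hb_homE hb_coordE zero_lfunE hb_coord0 => /eqP; rewrite oner_eq0.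
have [b [bf fb]] := ften_iso T (kar_of (Xs g)) (kar_of (Xs h)).
have [f fE] := Tfull (of_delta (g * h)%g \oc can \oc (to_delta g \om to_delta h) \oc b).
apply: contrapT => noM; move/negP: can0; apply; apply/eqP.
have f0 : f = 0.
  apply: val_inj => /=; elim/ext_ind: (val f) => [m|a x y -> ->]; last by rewrite scaler0 addr0.
  rewrite -[RHS](ext_in0 L); congr ext_in; apply/eqP; apply: contrapT => /negP mN0.
  by apply: noM; exists m.
have : to_delta (g * h)%g \oc fmor T f \oc ften T _ _ \oc (of_delta g \om of_delta h) = can.
  rewrite fE -!compA (compA b) bf comp1m -tensm_comp !of_deltaK tensm1 compm1.
  by rewrite compA of_deltaK comp1m.
by move=> <-; rewrite f0 fmor0 compm0 !comp0m.
Qed.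

(* The index [x] of the target is free, so that the equal but not convertible objects
   [Xs (g * (h * k))] and [Xs (g * h * k)] need no cast. *)
Lemma simple_product_exists' g h x :
  exists m : mor (Xs g \ox Xs h) (Xs x), x = (g * h)%g -> m != 0.
Proof.
have [->|xgh] := eqVneq x (g * h)%g; last by exists 0 => xE; rewrite xE eqxx in xgh.
by have [m m0] := simple_product_exists g h; exists m.
Qed.

Definition simple_product g h x : mor (Xs g \ox Xs h) (Xs x) :=
  sval (cid (simple_product_exists' g h x)).

Lemma simple_product_neq0 g h : simple_product g h (g * h)%g != 0.
Proof. by rewrite /simple_product; case: cid => m /= ->. Qed.

Definition lift_product g h x : mor (kar_of (Xs g) \ox kar_of (Xs h)) (kar_of (Xs x)) :=
  @kar_lift (kar_of (Xs g) \ox kar_of (Xs h)) (kar_of (Xs x))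
    (ext_in L (simple_product g h x)).

Lemma delta_product_exists g h x : exists n : mor (delta g \ox delta h) (delta x),
  of_delta x \oc n =
  fmor T (lift_product g h x) \oc (ften T _ _ \oc (of_delta g \om of_delta h)).
Proof.
exists (to_delta x \oc (fmor T (lift_product g h x) \oc
  (ften T _ _ \oc (of_delta g \om of_delta h)))).
by rewrite compA to_deltaK comp1m.
Qed.

Definition delta_product g h x : mor (delta g \ox delta h) (delta x) :=
  sval (cid (delta_product_exists g h x)).

Lemma of_delta_product g h x :
  of_delta x \oc delta_product g h x =
  fmor T (lift_product g h x) \oc (ften T _ _ \oc (of_delta g \om of_delta h)).
Proof. exact: svalP (cid (delta_product_exists g h x)). Qed.

(** For [x = g h] this is the cochain [mu]: the scalar by which the chosen product over [K] acts on
    the basis vectors of the [delta]. *)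
Definition product_coef g h x : L :=
  hb_coord (simple_hbasis L x) tt (vsval (delta_product g h x) (ten (eps g) (eps h))).

Lemma product_coefE g h x :
  vsval (delta_product g h x) (ten (eps g) (eps h)) = product_coef g h x *: eps x.
Proof.
by rewrite -[LHS](hb_sum (simple_hbasis L x)) (big_only1 tt).
Qed.

Lemma vsval_lift_product g h x : vsval (lift_product g h x) = ext_in L (simple_product g h x).
Proof.
rewrite kar_liftE (comp1m (ext_in L (simple_product g h x) : @mor L E _ _)).
by rewrite -[RHS](compm1 (ext_in L (simple_product g h x) : @mor L E _ _)) -tensm1.
Qed.

(** Up to isomorphisms [delta_product] is the image under [T] of [lift_product]. A zero coefficient
    would make it vanish, hence also [lift_product] by faithfulness, and [simple_product] by
    injectivity of [ext_in]. *)
Lemma product_coef_neq0 g h : product_coef g h (g * h)%g != 0.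
Proof.
apply/eqP=> mu0; have /eqP[] := simple_product_neq0 g h; apply: (@ext_in_inj K L).
suff M0 : lift_product g h (g * h)%g = 0 by rewrite ext_in0 -vsval_lift_product M0.
apply: Tfaithful.
have N0 : delta_product g h (g * h)%g = 0.
  apply: (hb_homP (hb_tens (simple_hbasis L g) (simple_hbasis L h))) => -[[] []].
  by rewrite hb_tensE product_coefE mu0 scale0r zero_lfunE.
have := of_delta_product g h (g * h)%g; rewrite N0 compm0.
have [b [_ vb]] := tensm_iso (of_delta_iso g) (of_delta_iso h).
have [c [_ fc]] := ften_iso T (kar_of (Xs g)) (kar_of (Xs h)).
move=> /(congr1 (fun f => f \oc b \oc c)).
by rewrite !comp0m -!compA (compA _ b) vb comp1m fc compm1.
Qed.

Section Associativity.
Variables g h k : gT.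
Let x := (g * h * k)%g.

Lemma vsval_left_assoc :
  vsval (lift_product (g * h)%g k x \oc
    (lift_product g h (g * h)%g \om idm (kar_of (Xs k)))) =
  ext_in L (simple_product (g * h)%g k x \oc (simple_product g h (g * h)%g \om idm (Xs k))).
Proof.
exact: (ext_comp_tensl (vsval_lift_product (g * h)%g k x) (vsval_lift_product g h (g * h)%g)).
Qed.

Lemma vsval_right_assoc :
  vsval (lift_product g (h * k)%g x \oc
    (idm (kar_of (Xs g)) \om lift_product h k (h * k)%g) \oc
    assoc (kar_of (Xs g)) (kar_of (Xs h)) (kar_of (Xs k))) =
  ext_in L (simple_product g (h * k)%g x \oc (idm (Xs g) \om simple_product h k (h * k)%g)
    \oc assoc (Xs g) (Xs h) (Xs k)).
Proof.
exact: (ext_comp_tensr (vsval_lift_product g (h * k)%g x)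
  (vsval_lift_product h k (h * k)%g) (kar_assocE (Xs g) (Xs h) (Xs k))).
Qed.

(** [J3 \oc v3] identifies the triple product of the [delta] with the image under [T] of the triple
    product of the lifts. Both bracketings are compared through this one isomorphism. *)
Let v3 := (of_delta g \om of_delta h) \om of_delta k.
Let J3 := ften T (kar_of (Xs g) \ox kar_of (Xs h)) (kar_of (Xs k)) \oc
  (ften T (kar_of (Xs g)) (kar_of (Xs h)) \om idm (T (kar_of (Xs k)))).

Lemma left_assoc_delta :
  fmor T (lift_product (g * h)%g k x \oc (lift_product g h (g * h)%g \om idm (kar_of (Xs k))))
    \oc (J3 \oc v3) =
  of_delta x \oc (delta_product (g * h)%g k x \oc (delta_product g h (g * h)%g \om idm (delta k))).
Proof.
rewrite fmor_comp /J3 !compA -(compA _ (fmor T (_ \om _))) -ften_nat fmor1.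
rewrite -!compA -!tensm_comp !comp1m -of_delta_product -[of_delta k in LHS]compm1.
by rewrite tensm_comp !compA of_delta_product !compA.
Qed.

Lemma right_assoc_delta :
  fmor T (lift_product g (h * k)%g x \oc
    (idm (kar_of (Xs g)) \om lift_product h k (h * k)%g) \oc
    assoc (kar_of (Xs g)) (kar_of (Xs h)) (kar_of (Xs k))) \oc (J3 \oc v3) =
  of_delta x \oc (delta_product g (h * k)%g x \oc (idm (delta g) \om delta_product h k (h * k)%g)
    \oc assoc (delta g) (delta h) (delta k)).
Proof.
have E : fmor T (assoc (kar_of (Xs g)) (kar_of (Xs h)) (kar_of (Xs k))) \oc (J3 \oc v3) =
    ften T _ _ \oc (idm _ \om ften T _ _) \oc (of_delta g \om (of_delta h \om of_delta k))
      \oc assoc _ _ _.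
  by rewrite compA /J3 compA ften_assoc -compA assoc_nat compA.
rewrite fmor_comp -compA E compA [RHS]compA; congr (_ \oc _).
rewrite fmor_comp !compA -(compA _ (fmor T (_ \om _))) -ften_nat fmor1.
rewrite -!compA -!tensm_comp !comp1m -of_delta_product -[of_delta g in LHS]compm1.
by rewrite tensm_comp !compA of_delta_product !compA.
Qed.

(** The source has a single basis vector. On it the right bracketing acts by
    [w g h k * mu h k * mu g (h k)] and the left one by [mu (g h) k * mu g h]; the quotient is
    [w * d mu]. *)
Lemma delta_assoc :
  delta_product g (h * k)%g x \oc (idm (delta g) \om delta_product h k (h * k)%g)
    \oc assoc (delta g) (delta h) (delta k) =
  (w g h k * coboundary (fun g h => product_coef g h (g * h)%g) g h k) *:
    (delta_product (g * h)%g k x \oc (delta_product g h (g * h)%g \om idm (delta k))).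
Proof.
have epsP (g' : gT) : eps g' \in gcomp (simple_gspace L g') g' := hb_mem (simple_hbasis L g') tt.
apply: (hb_homP (hb_tens (hb_tens (simple_hbasis L g) (simple_hbasis L h)) (simple_hbasis L k))).
move=> [[[] []] []]; rewrite [hb_vec _ _](_ : _ = ten (ten (eps g) (eps h)) (eps k)) //.
rewrite (vcomp_tensr (epsP g) (epsP h) (epsP k) (product_coefE h k _)
  (product_coefE g (h * k)%g _)).
rewrite scale_lfunE (vcomp_tensl (product_coefE g h _) (product_coefE (g * h)%g k _)).
(* The coboundary mentions the target [g (h k)], which [mulgA] turns into the common target [x]. *)
rewrite scalerA /coboundary mulgA -/x; congr (_ *: _).
have := product_coef_neq0 g h; have := product_coef_neq0 (g * h)%g k; rewrite -/x => m1 m2.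
by field; rewrite m1 m2.
Qed.

Lemma assoc_scalar : exists c : K,
  c%:A = w g h k * coboundary (fun g h => product_coef g h (g * h)%g) g h k.
Proof.
have [b [_ Jb]] : is_iso (J3 \oc v3).
  apply: iso_comp; first by do 2?apply: tensm_iso; apply: of_delta_iso.
  apply: iso_comp (ften_iso T _ _); apply: tensm_iso (ften_iso T _ _) _.
  by exists (idm _); split; apply: comp1m.
set c := _ * _; have := right_assoc_delta; rewrite delta_assoc -/c compmZ -left_assoc_delta.
move=> /(congr1 (fun f => f \oc b)); rewrite compZm -!(compA _ (J3 \oc v3)) Jb !compm1 -fmorZ.
move=> /(faithful_inj Tfaithful)/(congr1 val) rlE.
have [|c0 ->] := @ext_in_scalar K L _ _ _ c _ (etrans (esym vsval_right_assoc)
    (etrans rlE (congr1 ( *:%R c) vsval_left_assoc))); last by exists c0.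
(* Descent requires the left bracketing to be nonzero over [K]. If it vanished, so would its value
   [mu (g h) k * mu g h] on the basis vector. *)
apply/eqP => l0.
have left0 : lift_product (g * h)%g k x \oc
    (lift_product g h (g * h)%g \om idm (kar_of (Xs k))) = 0.
  by apply: val_inj; rewrite [LHS]vsval_left_assoc l0 ext_in0.
have := left_assoc_delta; rewrite left0 fmor0 comp0m => /esym/(congr1 (comp (to_delta x))).
rewrite compm0 compA of_deltaK comp1m.
move=> /(congr1 (fun f : gmor (gtens (gtens (simple_gspace L g) (simple_gspace L h))
    (simple_gspace L k)) (simple_gspace L x) =>
  hb_coord (simple_hbasis L x) tt (vsval f (ten (ten (eps g) (eps h)) (eps k))))).
rewrite (vcomp_tensl (product_coefE g h _) (product_coefE (g * h)%g k _)).
rewrite zero_lfunE hb_coord0 (linZ (@hb_lin _ _ _ _ _ (simple_hbasis L x) tt)) hb_coordE.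
move/eqP; rewrite !mulf_eq0 oner_eq0 (negPf (product_coef_neq0 g h)).
by rewrite (negPf (product_coef_neq0 (g * h)%g k)).
Qed.

End Associativity.
End FormToCocycle.

Section Forms.
Variables (K : fieldType) (L : fieldExtType K) (gT : finGroupType).
Variables (w : gT -> gT -> gT -> L) (wP : cocycle3 w) (wN : normalized3 w).

Lemma cocycle_of_split_form : has_split_form (Vec wP wN) ->
  exists w0 : gT -> gT -> gT -> K, cocycle3 w0 /\ cohomologous w (fun g h k => (w0 g h k)%:A).
Proof.
move=> [CK [[CKf [T [S TS]]] [_ CKs]]]; have [[_ CKss] _ _ _] := CKf.
have Tfull := quasi_inverse_full TS; have [/nat_iso_faithful Tff epsP] := TS.
have Tsurj : essentially_surjective T.
  by move=> V; have [eps [epsI _]] := epsP; exists (S V), (eps V).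
have [w0 w0E] : exists w0 : gT -> gT -> gT -> K, forall g h k, (w0 g h k)%:A =
    w g h k * coboundary (fun g h => product_coef Tfull Tsurj CKss CKs g h (g * h)%g) g h k.
  exists (fun g h k => sval (cid (assoc_scalar Tfull Tff Tsurj CKss CKs g h k))) => g h k.
  by case: cid.
have ww0 : cohomologous w (fun g h k => (w0 g h k)%:A).
  exists (fun g h => product_coef Tfull Tsurj CKss CKs g h (g * h)%g) => [g h|]; last exact: w0E.
  exact: product_coef_neq0.
(* Over [L] the function is a cocycle because it is cohomologous to [w]. Nonvanishing and the
   cocycle identity are pulled back to [K] along the injection [in_alg L]. *)
exists w0; split=> //; have [wN0 wC] := cocycle3_cohomologous wP ww0; split=> [g h k|g h k l].
  by apply: contraNneq (wN0 g h k) => ->; rewrite scale0r.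
by apply: (fmorph_inj (in_alg L)); rewrite !rmorphM; apply: wC.
Qed.

Lemma split_form_of_cocycle (w0 : gT -> gT -> gT -> K) : cocycle3 w0 ->
  cohomologous w (fun g h k => (w0 g h k)%:A) -> has_split_form (Vec wP wN).
Proof.
(* [Vec] is formed from a normalized cocycle, so [w0] is replaced by a normalized representative of
   its class. The resulting coboundary is mapped to [L] and absorbed in [m]. *)
move=> w0P ww0; have [w1 [w1P w1N w01]] := cocycle3_normalize w0P.
have [m m0 wm] : cohomologous w (fun g h k => (w1 g h k)%:A).
  apply: cohomologous_trans ww0 _.
  exact: (@cohomologous_map _ _ _ (in_alg L) (MkZ3 w0P) (MkZ3 w1P) w01).
exists (Vec w1P w1N); have [F S] := Vec_split_fusion w1P w1N.
by split=> //; split=> //; apply: Vec_scalar_extension m0 wm.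
Qed.

End Forms.

Theorem proposition2p14 (K : fieldType) (L : splittingFieldType K)
    (hL : galois (1%VS : {vspace L}) (fullv : {vspace L}))
    (gT : finGroupType) (w : Z3 gT L) (hw : normalized3 w) :
  has_split_form (Vec (Z3P w) hw) <->
  exists x : H3 gT K, H3map (GRing.in_alg L) x = H3class w.
Proof.
split=> [/cocycle_of_split_form[w0 [w0P ww0]]|[x xw]].
  by exists (H3class (MkZ3 w0P)); rewrite H3mapE; apply/H3class_eq/cohomologous_sym.
have [w0 x0] := H3P x; have xE : x = H3class w0 by apply: H3_inj.
apply: (@split_form_of_cocycle K L gT w (Z3P w) hw w0 (Z3P w0)).
by apply/cohomologous_sym/(H3class_eq (Z3map (in_alg L) w0) w); rewrite -H3mapE -xE.
Qed.
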